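(* Let $n\geq 2$. There is a global conjugacy class for the conjugation action of $S_n$ if and only if $n=6$ or $n\geq 8$. More precisely: (i) Let $\lambda$ be a partition of $n$ into distinct parts, such that all parts greater than $1$ are odd primes, and such that $\lambda$ has at least two parts. If $n=6$ or $n\geq 9$, then every irreducible representation of $S_n$ occurs in the conjugacy class indexed by $\lambda$ (that is, this class is global). (ii) If $n=8$, every irreducible representation of $S_8$ occurs in the conjugacy class indexed by the partition $(7,1)$.
   Context: All representations are over the complex numbers. The symmetric group $S_n$ acts on itself by conjugation; its orbits are the conjugacy classes, indexed by partitions $\lambda$ of $n$ (cycle type). Each conjugacy class thus affords a permutation representation of $S_n$. An irreducible representation of $S_n$ is said to occur in a conjugacy class if it occurs with positive multiplicity in this permutation representation. A conjugacy class of $S_n$ is called global if every irreducible representation of $S_n$ occurs in it. *)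

(* Defs.v *)
From mathcomp Require Import all_boot all_order all_fingroup all_algebra.
From mathcomp Require Import all_solvable all_field all_character.

Set Implicit Arguments.
Unset Strict Implicit.
Unset Printing Implicit Defensive.

Import GroupScope GRing.Theory.

(* Complex representations are handled by the MathComp character library,     *)
(* whose field of coefficients is algC, the algebraic complex numbers.        *)

Section PermutationRepresentation.

Variables (aT : finGroupType) (T : finType) (to : {action aT &-> T}).
Variables (G : {group aT}) (S : {set T}).

(* The basis of the representation space is indexed by S. MathComp matrices   *)
(* act on row vectors from the right, so row x of the matrix of g is the      *)
(* basis vector of index x acted upon by g.                                   *)
Definition perm_repr_mx (g : aT) : 'M[algC]_#|S| :=
  (\matrix_(i, j) (to (enum_val i) g == enum_val j)%:R)%R.

Lemma perm_repr_mxP : [acts G, on S | to] -> mx_repr G perm_repr_mx.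
Proof.
move=> actsGS; split=> [|g h Gg Gh]; apply/matrixP=> i j.
  by rewrite !mxE act1 (inj_eq enum_val_inj).
have Sgi: to (enum_val i) g \in S by rewrite (acts_act actsGS) ?enum_valP.
rewrite !mxE (bigD1 (enum_rank_in Sgi (to (enum_val i) g))) //= !mxE.
rewrite enum_rankK_in // eqxx mul1r actM big1 ?addr0 // => k ne_k.
rewrite !mxE; case: eqP => [def_k|_]; last by rewrite mul0r.
by case/eqP: ne_k; apply: enum_val_inj; rewrite enum_rankK_in.
Qed.

Definition perm_repr (actsGS : [acts G, on S | to]) :
  mx_representation algC G #|S| := MxRepresentation (perm_repr_mxP actsGS).

End PermutationRepresentation.

Section ConjugacyClasses.

Variables (gT : finGroupType) (G : {group gT}).

Lemma acts_class (C : {set gT}) : C \in classes G -> [acts G, on C | 'J].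
Proof. by case/imsetP=> x _ ->; rewrite astabsJ class_norm. Qed.

Definition class_repr (C : {set gT}) (clC : C \in classes G) :
  mx_representation algC G #|C| := perm_repr (acts_class clC).

(* irr_constt phi consists of the i such that '[phi, 'chi_i] != 0; for the    *)
(* character phi of a representation, '[phi, 'chi_i] is the multiplicity of   *)
(* the irreducible representation 'Chi_i.                                     *)
Definition occurs_in_class (C : {set gT}) (clC : C \in classes G)
    (i : Iirr G) : Prop :=
  i \in irr_constt (cfRepr (class_repr clC)).

Definition global_class (C : {set gT}) : Prop :=
  exists clC : C \in classes G, forall i : Iirr G, occurs_in_class clC i.

End ConjugacyClasses.

Definition is_partition (n : nat) (la : seq nat) : bool :=
  [&& sorted geq la, 0 \notin la & sumn la == n].

(* porbits s contains the singletons of fixed points, so parts equal to 1 are *)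
(* included.                                                                  *)
Definition cycle_type (n : nat) (s : 'S_n) : seq nat :=
  sort geq [seq #|X| | X : {set 'I_n} in porbits s].

Definition cycle_type_class (n : nat) (la : seq nat) : {set 'S_n} :=
  [set s : 'S_n | cycle_type s == la].

(* Main.v *)
From HB Require Import structures.
Require Import Defs.
From mathcomp Require Import all_boot all_order all_fingroup all_algebra.
From mathcomp Require Import all_solvable all_field all_character.
From mathcomp Require Import zify ring.

(* By Frobenius reciprocity, an irreducible representation occurs in the class *)
(* of g exactly when it has a nonzero vector fixed by the centralizer of g. If *)
(* the cycles of g have distinct lengths, this centralizer is generated by the *)
(* cycles, and a common fixed vector is sought one cycle at a time: the vectors *)
(* fixed by a cycle form a representation of the permutations of the remaining *)
(* points. The base case is that of two cycles, of lengths p > q, p prime.     *)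
(* If p is prime and a representation H of S_p has no nonzero vector fixed by  *)
(* a p-cycle, the sum of all p-cycles acts on H by the scalar - (p - 2)!. This *)
(* sum is a product of Jucys-Murphy elements, and comparing eigenvalues leaves *)
(* only the shapes (p - 1, 1) and (2, 1, ..., 1) for the constituents of H.    *)
(* When no nonzero vector is fixed by disjoint cycles of lengths p and q, this *)
(* applies to the vectors fixed by a q-cycle for every choice of its support,  *)
(* and the relations so obtained for varying supports force H = 0.             *)
(* In degree at least 9, a partition of the required form exists because the   *)
(* sums of distinct odd primes less than n exceed n by enough, by Chebyshev's  *)
(* bound. Conversely, if the class of g is global, the sign character shows    *)
(* that the centralizer of g is even, hence the cycle lengths of g are         *)
(* distinct and odd; in degrees 2, 3, 4, 5 and 7 this leaves the n-cycles and  *)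
(* the type (3, 1), which fix no nonzero vector of coordinate sum zero in a    *)
(* suitable permutation representation.                                        *)

(** The occurrence criterion is [occursP]. By [cent_fixed], a vector fixed by every cycle of [g] is
    fixed by the whole centralizer, so all rests on [cycfix_exists], an induction on the number of
    cycles that ends with two cycles in [pair_exists].

    The case of two cycles is by contradiction. If [H] is [nofix], then for each q-set [Q] the
    vectors of [H] fixed by a q-cycle on [Q] form a space that is [bad] for the p remaining points.
    If it is nonzero, [bad_type] finds in it a vector invariant or alternating on p - 1 points.
    Cycles of odd length are even, so a sign twist preserves [nofix] and exchanges the two
    alternatives; it remains to exclude the invariant one, which is [nofix_subfull].

    For this, vectors invariant on [Q] and on all but one of the other points are excluded first
    ([nofix_case1]). By [nofix_edge], [H] contains no nonzero vector behaving like a difference of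
    two points. It follows that such a vector is also invariant on [Q] enlarged by the exceptional
    point, hence of two-row shape. If p is at least q + 4, there is room to repeat the argument
    ([nofix_tworow]). For twin primes, a product of four factors 1 - (a b) is shown to kill the
    vector, and the factors are then removed one by one ([twin_four], [taus_descent]). After
    [nofix_case1], only the sign-twisted shape is left for the invariants of [Q]
    ([nofix_hyper_sgn]), and it is incompatible with invariance on many points.

    For the converse, [global_fixed] provides fixed vectors in every nonzero submodule of every
    representation; it is applied to the sign and to hyperplanes of permutation modules. *)

Set Implicit Arguments.
Unset Strict Implicit.
Unset Printing Implicit Defensive.

(** * Cycles and orbits of permutations *)

Section Cycles.

Import GroupScope.

Variable T : finType.
Implicit Types (s t g : {perm T}) (x y a b : T) (A D P Q : {set T}).

(** On a singleton the only cycle is the identity, so parts equal to 1 are treated like the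
    others. *)
Definition cycle_on P s : bool :=
  perm_on P s && [forall x in P, porbit s x == P].

Lemma perm_on_tperm P a b : a \in P -> b \in P -> perm_on P (tperm a b).
Proof.
move=> aP bP; apply: subset_trans (tperm_on a b) _.
by apply/subsetP=> z; rewrite !inE => /orP[]/eqP->.
Qed.

Lemma perm_onS P Q s : P \subset Q -> perm_on P s -> perm_on Q s.
Proof. by move=> sPQ sP; apply: subset_trans sP sPQ. Qed.

Lemma perm_onX P s i : perm_on P s -> perm_on P (s ^+ i).
Proof.
move=> sP; elim: i => [|i IH]; first by rewrite expg0 perm_on1.
by rewrite expgS perm_onM.
Qed.

Lemma porbit_out P s x : perm_on P s -> x \notin P -> porbit s x = [set x].
Proof.
move=> sP xP; apply/setP=> y; rewrite inE; apply/porbitP/eqP=> [[i ->]|->].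
  by rewrite permX_fix // (out_perm sP).
by exists 0%N; rewrite expg0 perm1.
Qed.

Lemma porbit_sub P s x : perm_on P s -> x \in P -> porbit s x \subset P.
Proof.
move=> sP xP; apply/subsetP=> y /porbitP[i ->].
by rewrite (perm_closed _ (perm_onX i sP)).
Qed.

Lemma card_porbits_on P s : perm_on P s ->
  #|porbits s| = (#|~: P| + #|porbit s @: P|)%N.
Proof.
move=> sP.
have -> : porbits s = (set1 @: ~: P) :|: (porbit s @: P).
  apply/setP=> X; rewrite inE; apply/imsetP/orP=> [[x _ ->]|].
    case xP: (x \in P); [right; exact: imset_f | left].
    by rewrite (porbit_out sP) ?xP // imset_f // inE xP.
  case=> /imsetP[x]; rewrite ?inE => xP ->; exists x => //.
  by rewrite (porbit_out sP).
rewrite cardsU (card_imset _ set1_inj) disjoint_setI0 ?cards0 ?subn0 //.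
rewrite -setI_eq0; apply/eqP/setP=> X; rewrite !inE; apply/negP=> /andP[].
case/imsetP=> x; rewrite inE => xP -> /imsetP[y yP /setP/(_ x)].
rewrite inE eqxx => /esym /(subsetP (porbit_sub sP yP)).
by rewrite (negPf xP).
Qed.

(** Points off [P] are singleton orbits, so transitivity on [P] is a count of orbits; multiplying by
    a transposition changes this count in a known way. *)
Lemma cycle_on_card P s : P != set0 ->
  cycle_on P s = perm_on P s && (#|porbits s| == #|~: P|.+1).
Proof.
move=> /set0Pn[x0 x0P]; rewrite /cycle_on; case sP: (perm_on P s) => //=.
rewrite (card_porbits_on sP) -addn1 eqn_add2l.
apply/forall_inP/cards1P=> [orb|[X imX] x xP].
  exists P; apply/setP=> X; rewrite inE.
  apply/imsetP/eqP=> [[x xP ->]|->]; first exact/eqP/orb.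
  by exists x0 => //; apply/esym/eqP/orb.
have Xeq y : y \in P -> porbit s y = X.
  by move=> yP; apply/set1P; rewrite -imX imset_f.
rewrite Xeq //; apply/eqP/setP=> y; apply/idP/idP=> [|yP].
  by rewrite -(Xeq x) //; apply/subsetP/porbit_sub.
by rewrite -(Xeq y) // porbit_id.
Qed.

Lemma cycle_on_perm P s : cycle_on P s -> perm_on P s.
Proof. by case/andP. Qed.

Lemma cycle_on_porbit P s x : cycle_on P s -> x \in P -> porbit s x = P.
Proof. by case/andP=> _ /forall_inP H xP; apply/eqP/H. Qed.

Lemma cycle_on1 x s : cycle_on [set x] s = (s == 1).
Proof.
apply/idP/eqP=> [/andP[sx _]|->].
  by apply: (perm_on_id sx); rewrite cards1.
rewrite /cycle_on perm_on1; apply/forall_inP=> y /set1P->.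
by rewrite (@porbit_out set0) ?perm_on1 ?inE.
Qed.

Lemma odd_cycle_on P s : P != set0 -> cycle_on P s -> odd_perm s = ~~ odd #|P|.
Proof.
move=> P0; rewrite cycle_on_card // => /andP[_ /eqP E].
by rewrite /odd_perm E -(cardsC P) oddD /=; case: (odd _); case: (odd _).
Qed.

Lemma cycle_on_expg_card P s : P != set0 -> cycle_on P s -> s ^+ #|P| = 1.
Proof.
move=> P0 cs; apply/permP=> x; rewrite perm1.
case xP: (x \in P); first by rewrite -(cycle_on_porbit cs xP) permX iter_porbit.
by rewrite permX_fix // (out_perm (cycle_on_perm cs)) ?xP.
Qed.

Lemma cycle_onX P s i : P != set0 -> cycle_on P s -> coprime #|P| i ->
  cycle_on P (s ^+ i).
Proof.
move=> P0 cs co; rewrite /cycle_on perm_onX ?(cycle_on_perm cs) //=.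
apply/forall_inP=> x xP; rewrite -[X in _ == X](cycle_on_porbit cs xP) porbit.unlock.
have: generator <[s]> (s ^+ i).
  rewrite generator_coprime; apply: coprime_dvdl co.
  by rewrite order_dvdn (cycle_on_expg_card P0 cs).
by move=> /eqP <-.
Qed.

Definition cycles P : {set {perm T}} := [set s | cycle_on P s].

Lemma tperm_cycle_on P x a s : x \notin P -> P != set0 -> a \in P ->
  s x = x -> perm_on P s -> cycle_on (x |: P) (tperm a x * s) = cycle_on P s.
Proof.
move=> xP P0 aP sx sP.
have xP0: x |: P != set0 by apply/set0Pn; exists x; rewrite setU11.
have sP' := perm_onS (subsetUr [set x] P) sP.
rewrite !cycle_on_card // sP perm_onM ?perm_on_tperm ?setU11 ?setU1r //=.
have ax: a != x by apply: contraNneq xP => <-.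
have := porbits_mul_tperm s a x; rewrite /= ax.
have -> : a \notin porbit s x by rewrite (porbit_out sP) // inE.
move=> E; apply/eqP/eqP=> H; move: E; rewrite H; have := cardsC P;
  have := cardsC (x |: P); rewrite cardsU1 xP /=; move: #|porbits _| => N;
  rewrite -muln2; lia.
Qed.

(* Every cycle on [x |: P] is uniquely [tperm a x * s] with [a] in [P] and [s] *)
(* a cycle on [P], namely for [a] the preimage of [x].                        *)
Lemma cycles_setU1 P x : x \notin P -> P != set0 ->
  cycles (x |: P) = [set tperm u.1 x * u.2 | u in setX P (cycles P)]
  /\ {in setX P (cycles P) &, injective (fun u => tperm u.1 x * u.2)}.
Proof.
move=> xP P0; split.
  apply/setP=> s; rewrite inE; apply/idP/imsetP=> [cs|[[a t]]].
    pose a := s^-1 x.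
    have sax : s a = x by rewrite permKV.
    have sP := cycle_on_perm cs.
    have [y yP] := set0Pn _ P0.
    have aNx : a != x.
      apply: contraNneq xP => ax; move: sax; rewrite ax => sx.
      have: y \in porbit s x.
        by rewrite (cycle_on_porbit cs) ?setU11 // setU1r.
      by case/porbitP=> i; rewrite permX_fix // => <-.
    have aP : a \in P.
      have: a \in x |: P by rewrite -(perm_closed _ sP) sax setU11.
      by rewrite !inE (negPf aNx).
    exists (a, tperm a x * s); last by rewrite /= tpermKg.
    set t := tperm a x * s.
    have tx : t x = x by rewrite permM tpermR.
    have tP : perm_on P t.
      apply/subsetP=> z; rewrite inE => tz.
      have: z \in x |: P.
        apply: contraR tz => zxP.
        have tPx: perm_on (x |: P) t.
          by rewrite perm_onM // perm_on_tperm ?setU11 ?setU1r.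
        by rewrite (out_perm tPx).
      have zx : z != x by apply: contraNneq tz => ->; rewrite tx.
      by rewrite !inE (negPf zx).
    rewrite !inE /= aP -(@tperm_cycle_on P x a) //.
    by rewrite /t tpermKg.
  rewrite !inE /= => /andP[aP ct] ->.
  have tP := cycle_on_perm ct.
  by rewrite tperm_cycle_on // (out_perm tP).
move=> [a s] [b t]; rewrite !inE /= => /andP[aP cs] /andP[bP ct] E.
have sx := out_perm (cycle_on_perm cs) xP.
have tx := out_perm (cycle_on_perm ct) xP.
have aE: (tperm a x * s) a = x by rewrite permM tpermL.
have bE: (tperm b x * t) b = x by rewrite permM tpermL.
have ab: a = b by apply: (@perm_inj _ (tperm a x * s)); rewrite aE {1}E bE.
by move: E; rewrite ab => /mulgI ->.
Qed.

Lemma card_cycles P : P != set0 -> #|cycles P| = (#|P|.-1)`!.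
Proof.
have [n] := ubnP #|P|; elim: n P => // n IH P leP P0.
have [x xP] := set0Pn _ P0.
have [E|P'0] := eqVneq (P :\ x) set0.
  have -> : P = [set x] by rewrite -(setD1K xP) E setU0.
  have -> : cycles [set x] = [set 1] by apply/setP=> s; rewrite !inE cycle_on1.
  by rewrite !cards1.
have xD : x \notin P :\ x by rewrite !inE eqxx.
have [] := cycles_setU1 xD P'0; rewrite (setD1K xP) => -> inj.
rewrite (card_in_imset inj) cardsX IH //; last first.
  by move: leP; rewrite [#|P|](cardsD1 x P) xP; lia.
rewrite [#|P|](cardsD1 x P) xP /=.
by case: #|_| (cards_eq0 (P :\ x)) => [/idP|m _] //=; rewrite (negPf P'0).
Qed.

Lemma cycle_on_ex P : P != set0 -> exists s, cycle_on P s.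
Proof.
move=> P0; have: 0 < #|cycles P| by rewrite card_cycles // fact_gt0.
by case/card_gt0P=> s; rewrite inE; exists s.
Qed.

Lemma subset_card_ex A k : k <= #|A| -> exists2 B : {set T}, B \subset A & #|B| = k.
Proof.
move=> leA; exists [set x | x \in take k (enum A)].
  by apply/subsetP=> x; rewrite inE -[x \in A]mem_enum; apply: mem_take.
have /card_uniqP E : uniq (take k (enum A)) by rewrite take_uniq ?enum_uniq.
by rewrite cardsE E size_takel // -cardE.
Qed.

Lemma exists_notin A P : #|A| < #|P| -> exists2 z, z \in P & z \notin A.
Proof.
by move=> lt; apply/subsetPn; apply: contraL lt => /subset_leq_card; rewrite -leqNgt.
Qed.

Lemma cards3_le a b c : #|[set a; b; c]| <= 3.
Proof.
by rewrite setUC cardsU1 cards2 (leq_add (leq_b1 _)) // ltnS leq_b1.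
Qed.

(** Transpositions generate the symmetric group on [A]: composing [s] with the transposition of [x]
    and its preimage fixes [x] and moves no new point. *)
Lemma perm_on_ind (R : {perm T} -> Prop) A :
  R 1 -> (forall a b s, a \in A -> b \in A -> a != b -> perm_on A s -> R s ->
          R (tperm a b * s)) -> forall s, perm_on A s -> R s.
Proof.
move=> R1 RM s; have [n] := ubnP #|[pred x | s x != x]|.
elim: n s => // n IH s /ltnSE len sA.
case: (pickP (fun x => s x != x)) => [x sx|s_id]; last first.
  suff -> : s = 1 by [].
  by apply/permP=> x; rewrite perm1; apply/eqP/negPn; rewrite s_id.
have xA : x \in A by apply: (subsetP sA).
pose t := tperm x (s^-1 x) * s.
have yA : s^-1 x \in A by rewrite (perm_closed _ (perm_onV sA)).
have tA : perm_on A t by rewrite perm_onM // perm_on_tperm.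
have -> : s = tperm x (s^-1 x) * t by rewrite /t tpermKg.
apply: RM => //; first by rewrite -(canF_eq (permK _)).
apply: IH => //; rewrite (cardD1 x) !inE sx in len.
apply: leq_ltn_trans len; apply: subset_leq_card; apply/subsetP=> y.
rewrite !inE permM permE /=.
have [-> | ne_yx] := eqVneq y x; first by rewrite permKV eqxx.
have [-> _|_] := eqVneq y (s^-1 x).
  by rewrite permKV -(canF_eq (permK _)) eq_sym in ne_yx *.
by [].
Qed.

End Cycles.

Section Orbits.

Variable T : finType.
Implicit Types (s t g h c : {perm T}) (x y z b : T) (D P : {set T}).

Lemma eq_in_porbit s t x : {in porbit s x, s =1 t} -> porbit s x = porbit t x.
Proof.
move=> st; have E i : (s ^+ i)%g x = (t ^+ i)%g x.
  elim: i => [|i IH]; first by rewrite !expg0.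
  by rewrite !expgSr !permM -IH st ?mem_porbit.
apply/setP=> y; apply/porbitP/porbitP => -[i ->]; exists i;
  by rewrite ?E // -E.
Qed.

(** Both equalities say that [i] and [j] are congruent modulo the common orbit length. *)
Lemma eq_iter_porbit s t x y i j : #|porbit s x| = #|porbit t y| ->
  (iter i s x == iter j s x) = (iter i t y == iter j t y).
Proof.
have E (u : {perm T}) z k : iter k u z = iter (k %% #|porbit u z|) u z :> T.
  rewrite {1}(divn_eq k #|porbit u z|) addnC iterD; congr (iter _ _ _).
  elim: (k %/ _) => [|m IH]; first by rewrite mul0n.
  by rewrite mulSn iterD IH iter_porbit.
have F (u : {perm T}) z k l : (iter k u z == iter l u z)
    = (k %% #|porbit u z| == l %% #|porbit u z|).
  have n0 : 0 < #|porbit u z| by rewrite lt0n card_porbit_neq0.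
  rewrite [in LHS]E [X in _ == X]E.
  rewrite -[X in X == _](nth_traject u (ltn_pmod k n0)).
  rewrite -[X in _ == X](nth_traject u (ltn_pmod l n0)).
  by rewrite nth_uniq ?size_traject ?ltn_pmod ?uniq_traject_porbit.
by move=> st; rewrite !F st.
Qed.

(* Matching cycles of equal length, starting from arbitrary base points.      *)
Lemma perm_conj s t :
    (forall x y, #|porbit s x| = #|porbit s y| -> porbit s x = porbit s y) ->
    (forall x, exists y, #|porbit t y| = #|porbit s x|) ->
  exists k : {perm T}, t = (s ^ k)%g.
Proof.
move=> inj ex.
pose base x := odflt x [pick y in porbit s x].
have baseP x : base x \in porbit s x.
  by rewrite /base; case: pickP => //= none; have := none x; rewrite porbit_id.
have base_eq x y : porbit s x = porbit s y -> base x = base y.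
  move=> E; have := baseP x; have := baseP y; rewrite /base E.
  by case: pickP => //= none; rewrite none.
have porb_base x : porbit s (base x) = porbit s x.
  by apply/eqP; rewrite eq_porbit_mem.
pose tgt x := odflt x [pick y | #|porbit t y| == #|porbit s x|].
have tgtP x : #|porbit s (base x)| = #|porbit t (tgt x)|.
  rewrite porb_base /tgt; case: pickP => [y /eqP -> //|none].
  by have [y yE] := ex x; have := none y; rewrite yE eqxx.
have tgt_eq x y : #|porbit s x| = #|porbit s y| -> tgt x = tgt y.
  move=> E; rewrite /tgt E; case: pickP => //= none.
  by have [z zE] := ex y; have := none z; rewrite zE eqxx.
pose idx x := index x (traject s (base x) #|porbit s (base x)|).
have idxP x : iter (idx x) s (base x) = x.
  have xT : x \in traject s (base x) #|porbit s (base x)|.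
    by rewrite -porbit_traject porb_base porbit_id.
  rewrite -[RHS](nth_index x xT) -/(idx x); symmetry.
  by rewrite (set_nth_default (base x)) ?nth_traject //;
    move: xT; rewrite -index_mem size_traject.
pose f x := iter (idx x) t (tgt x).
have orbf x : porbit t (f x) = porbit t (tgt x).
  by rewrite /f -permX porbit_perm.
(* The length of the [t]-orbit of [f x] recovers the [s]-orbit of [x], and the position in it then
   recovers [x]. On a finite type injectivity makes [f] a permutation. *)
have inj_f : injective f.
  move=> x y fxy.
  have Exy : porbit s x = porbit s y.
    by apply: inj; rewrite -(porb_base x) -(porb_base y) !tgtP -!orbf fxy.
  rewrite -(idxP x) -(idxP y) -(base_eq _ _ Exy); apply/eqP.
  rewrite (eq_iter_porbit _ _ (tgtP x)); apply/eqP.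
  by move: fxy; rewrite /f -(tgt_eq x y) // Exy.
exists (perm inj_f); apply/permP=> z.
have [x ->] : exists x, z = perm inj_f x.
  by exists ((perm inj_f)^-1 z)%g; rewrite permKV.
rewrite permJ !permE.
have Ex : porbit s (s x) = porbit s x by apply: (porbit_perm s 1 x).
have -> : t (f x) = iter (idx x).+1 t (tgt x) by [].
rewrite {1}/f -(tgt_eq (s x) x) ?Ex //; symmetry; apply/eqP.
rewrite -(eq_iter_porbit _ _ (tgtP (s x))) idxP (base_eq _ _ Ex) /= idxP.
by rewrite eqxx.
Qed.

Lemma porbitJ s k x : porbit (s ^ k)%g (k x) = k @: porbit s x.
Proof.
apply/setP=> y; apply/porbitP/imsetP => [[i ->]|[z /porbitP[i ->] ->]].
  by exists ((s ^+ i)%g x); rewrite ?mem_porbit // -conjXg permJ.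
by exists i; rewrite -conjXg permJ.
Qed.

Lemma card_porbitJ s k x : #|porbit (s ^ k)%g (k x)| = #|porbit s x|.
Proof. by rewrite porbitJ card_imset //; apply: perm_inj. Qed.

End Orbits.

Section CycleType.

Variable n : nat.
Implicit Types (s t g : 'S_n) (la : seq nat).

Lemma mem_cycle_type s k :
  reflect (exists x, #|porbit s x| = k) (k \in cycle_type s).
Proof.
rewrite /cycle_type mem_sort; apply: (iffP imageP) => [[_ /imsetP[x _ ->] ->]|].
  by exists x.
by case=> x <-; exists (porbit s x); rewrite ?imset_f.
Qed.

Lemma cycle_type_inj s x y : uniq (cycle_type s) ->
  #|porbit s x| = #|porbit s y| -> porbit s x = porbit s y.
Proof.
rewrite sort_uniq => /dinjectiveP inj; apply: inj; exact: imset_f.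
Qed.

Lemma cycle_typeE s la : sorted geq la -> uniq la ->
    (forall x, #|porbit s x| \in la) ->
    (forall k, k \in la -> exists x, #|porbit s x| = k) ->
    (forall x y, #|porbit s x| = #|porbit s y| -> porbit s x = porbit s y) ->
  cycle_type s = la.
Proof.
move=> sla ula h1 h2 inj.
have gt_trans : transitive geq by move=> a b c /= ba ac; apply: leq_trans ac ba.
have gt_anti : antisymmetric geq by move=> a b; rewrite andbC; apply: anti_leq.
have gt_total : total geq by move=> a b; apply: leq_total.
apply: (sorted_eq gt_trans gt_anti) => //; first exact: sort_sorted.
apply: uniq_perm => // [|k].
  rewrite sort_uniq; apply/dinjectiveP=> _ _ /imsetP[x _ ->] /imsetP[y _ ->].
  exact: inj.
by apply/mem_cycle_type/idP => [[x <-]|/h2].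
Qed.

Lemma cycle_type_class_class la g : sorted geq la -> uniq la ->
  cycle_type g = la -> cycle_type_class n la = (g ^: [set: 'S_n])%g.
Proof.
move=> sla ula gla; have ug : uniq (cycle_type g) by rewrite gla.
have injg := fun x y => @cycle_type_inj g x y ug.
apply/setP=> t; rewrite inE; apply/eqP/imsetP => [tla|[k _ ->]].
  have [|k ->] := @perm_conj _ g t injg; last by exists k; rewrite ?inE.
  move=> x; apply/mem_cycle_type; rewrite tla -gla.
  by apply/mem_cycle_type; exists x.
apply: cycle_typeE => // [x|j|x y].
- rewrite -(permKV k x) card_porbitJ -gla; apply/mem_cycle_type.
  by exists (k^-1 x)%g.
- by rewrite -gla => /mem_cycle_type[x <-]; exists (k x); rewrite card_porbitJ.
rewrite -(permKV k x) -(permKV k y) !card_porbitJ !porbitJ.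
by move=> /injg ->.
Qed.

End CycleType.

(** * Partitions into distinct odd primes and 1 *)

Definition part_ok p : bool := (p == 1) || prime p && odd p.

(** The two excluded types are not global: shape (2,2) does not occur in the class (3,1), nor shape
    (4,4) in the class (5,3). *)
Definition parts_ok (la : seq nat) : bool :=
  [&& uniq la, all part_ok la, 1 < size la,
      ~~ perm_eq la [:: 3; 1] & ~~ perm_eq la [:: 5; 3]].

Section PrimeCount.

Implicit Types (n m p k x y L : nat).

Lemma central_bin_ge m : 2 ^ m <= 'C(m.*2, m).
Proof.
elim: m => // m IH; rewrite expnS doubleS.
have E : m.+1 * 'C(m.*2.+2, m.+1) = 2 * (m.*2.+1 * 'C(m.*2, m)).
  rewrite -(mul_bin_diag m.*2.+2 m) (mul_bin_down m.*2.+1 m) /=.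
  have -> : m.*2.+1 - m = m.+1 by lia.
  have -> : m.*2.+2 = 2 * m.+1 by lia.
  by rewrite mulnA.
rewrite -(@leq_pmul2l m.+1) // E mulnCA leq_mul2l /=.
by apply: leq_mul => //; lia.
Qed.

(** In Legendre's formula, the i-th term for (2m)! exceeds twice the one for m! by at most 1, and
    only if p^i is at most 2m. *)
Lemma logn_central_bin m p : prime p -> 0 < m ->
  p ^ logn p 'C(m.*2, m) <= m.*2.
Proof.
move=> pP m0; have p1 := prime_gt1 pP.
have d0 : 0 < m.*2 by rewrite double_gt0.
apply: leq_trans (trunc_logP p1 d0); rewrite leq_exp2l //.
have E : logn p 'C(m.*2, m) + (logn p m`! + logn p m`!) = logn p (m.*2)`!.
  have := @bin_fact m.*2 m; rewrite -addnn leq_addr addnK => /(_ isT) <-.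
  by rewrite addnn !lognM ?muln_gt0 ?fact_gt0 ?bin_gt0 // -addnn leq_addr.
have F k : k <= m.*2 -> logn p k`! = \sum_(1 <= i < m.*2.+1) k %/ p ^ i.
  move=> km; rewrite logn_fact //.
  rewrite [RHS](big_cat_nat _ (n := k.+1)) //= [X in _ + X]big1_seq ?addn0 //.
  move=> i; rewrite mem_index_iota => /andP[_ /andP[ki _]].
  apply: divn_small; apply: leq_trans ki _; apply: ltnW; exact: ltn_expl.
have : logn p 'C(m.*2, m) <= \sum_(1 <= i < m.*2.+1) (p ^ i <= m.*2).
  rewrite -(leq_add2r (logn p m`! + logn p m`!)) E !F //; last first.
    by rewrite -addnn leq_addr.
  rewrite -!big_split /=; apply: leq_sum => i _.
  have q0 : 0 < p ^ i by rewrite expn_gt0 prime_gt0.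
  have [le|gt] := leqP (p ^ i) m.*2; last by rewrite divn_small.
  have -> : m.*2 = (m %/ p ^ i + m %/ p ^ i) * p ^ i + (m %% p ^ i + m %% p ^ i).
    by rewrite mulnDl addnACA -!divn_eq addnn.
  rewrite divnMDl // addnC leq_add2r -ltnS ltn_divLR //.
  have := ltn_pmod m q0; lia.
move/leq_trans; apply.
rewrite (big_cat_nat _ (n := (trunc_log p m.*2).+1)) //=; last first.
  rewrite ltnS; apply: ltnW; apply: leq_trans (trunc_logP p1 d0).
  exact: ltn_expl.
rewrite [X in _ + X]big1_seq ?addn0; last first.
  move=> i; rewrite mem_index_iota => /andP[_ /andP[li _]].
  apply/eqP; rewrite eqb0 -ltnNge.
  apply: leq_trans (trunc_log_ltn m.*2 p1) _; by rewrite leq_exp2l.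
apply: (@leq_trans (\sum_(1 <= i < (trunc_log p m.*2).+1) 1)).
  by apply: leq_sum => i _; apply: leq_b1.
by rewrite sum_nat_const_nat muln1 subn1.
Qed.

Lemma prime_dvd_fact p n : prime p -> p %| n`! -> p <= n.
Proof.
move=> pP; elim: n => [|n IH]; first by rewrite fact0 Euclid_dvd1.
rewrite factS Euclid_dvdM // => /orP[/dvdn_leq->//|/IH]; exact: leqW.
Qed.

Definition primes_upto x := [seq p <- iota 0 x.+1 | prime p].

Lemma central_bin_le m : 0 < m ->
  'C(m.*2, m) <= m.*2 ^ size (primes_upto m.*2).
Proof.
move=> m0; have b0 : 0 < 'C(m.*2, m) by rewrite bin_gt0 -addnn leq_addr.
rewrite {1}(prod_prime_decomp b0) prime_decompE big_map /=.
apply: (@leq_trans (\prod_(p <- primes 'C(m.*2, m)) m.*2)).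
  rewrite big_seq [X in _ <= X]big_seq; apply: leq_prod => p.
  by rewrite mem_primes => /andP[pP _]; apply: logn_central_bin.
rewrite big_const_seq count_predT iter_muln_1 leq_pexp2l ?double_gt0 //.
apply: uniq_leq_size; first exact: primes_uniq.
move=> p; rewrite mem_primes mem_filter mem_iota add0n ltnS => /and3P[pP _ pd].
rewrite pP /=; have : p %| (m.*2)`!.
  apply: dvdn_trans pd _; rewrite -(@bin_fact m.*2 m) ?dvdn_mulr //.
  by rewrite -addnn leq_addr.
exact: prime_dvd_fact.
Qed.

Definition odd_primes x := [seq p <- iota 0 x.+1 | prime p && odd p].
(** The added 1 is the part 1: for positive [x] this is the largest sum of distinct admissible parts
    bounded by [x]. *)
Definition psum x := (sumn (odd_primes x)).+1.

Lemma size_primes_upto x : size (primes_upto x) <= (size (odd_primes x)).+1.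
Proof.
rewrite !size_filter -[X in _ <= X]addn1.
rewrite (eq_count (a2 := predU (fun p => prime p && odd p) (pred1 2))); last first.
  move=> p /=; have [->|n2] := eqVneq p 2; first by [].
  rewrite orbF; case pP: (prime p) => //=; symmetry.
  by have [/eqP|] := even_prime pP; rewrite ?(negPf n2).
apply: (@leq_trans (count (fun p => prime p && odd p) (iota 0 x.+1)
  + count (pred1 2) (iota 0 x.+1))).
  by rewrite -count_predUI leq_addr.
by rewrite leq_add2l count_uniq_mem ?iota_uniq ?leq_b1.
Qed.

Lemma sumn_odds a l : path ltn a l -> odd a -> all odd l ->
  size l * a + size l * (size l).+1 <= sumn l.
Proof.
elim: l a => //= b l IH a /andP[ab pb] oa /andP[ob ol].
have := IH b pb ob ol; have : a.+2 <= b.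
  by rewrite ltn_neqAle ab andbT; apply: contraTneq ob => <-; rewrite /= oa.
by move: (size l) (sumn l) => c s; nia.
Qed.

(** Together with 1, the odd primes are distinct odd numbers, and the k smallest odd numbers add up
    to k^2. *)
Lemma psum_sq x : (size (odd_primes x)).+1 ^ 2 <= psum x.
Proof.
have H : size (odd_primes x) * 1 + size (odd_primes x) * (size (odd_primes x)).+1
    <= sumn (odd_primes x).
  apply: sumn_odds => //; last first.
    by apply/allP=> p; rewrite mem_filter => /andP[/andP[]].
  rewrite path_sortedE; last exact: ltn_trans.
  apply/andP; split.
    by apply/allP=> p; rewrite mem_filter => /andP[/andP[/prime_gt1]].
  by apply: sorted_filter; [apply: ltn_trans|apply: iota_ltn_sorted].
rewrite /psum; move: (size _) (sumn _) H => c s; rewrite expnS expn1; clear; nia.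
Qed.

Lemma psumS x :
  psum x.+1 = if prime x.+1 && odd x.+1 then psum x + x.+1 else psum x.
Proof.
rewrite /psum /odd_primes -[x.+2]addn1 iotaD filter_cat sumn_cat add0n /=.
by case: (prime x.+1 && ~~ odd x) => /=; rewrite ?addn0.
Qed.

Lemma psum_mono x y : x <= y -> psum x <= psum y.
Proof.
move=> /subnKC <-; elim: (y - x) => [|k IH]; first by rewrite addn0.
apply: leq_trans IH _; rewrite addnS psumS.
by case: ifP => // _; apply: leq_addr.
Qed.

Lemma quad_lt_expn L : 9 < L -> 2 * L ^ 2 + 7 <= 2 ^ (L - 2).
Proof.
move=> /subnKC <-; elim: (L - 10) => // k IH.
have -> : 10 + k.+1 - 2 = (10 + k - 2).+1 by lia.
rewrite expnS; apply: (@leq_trans (2 * (2 * (10 + k) ^ 2 + 7))).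
  by rewrite !expnS !expn0 !muln1; nia.
by rewrite leq_mul2l IH.
Qed.

(** With [k] bounding the number of primes up to 2m and 2m < 2^L, Chebyshev's estimate 2^m <=
    C(2m,m) <= (2m)^k gives m <= L k. Hence k^2 >= (m/L)^2, which beats 2m + 7 since L is
    logarithmic in m. *)
Lemma psum_large x : 511 < x -> x + 6 <= psum x.
Proof.
move=> x_ge; set m := x./2; have m_ge : 255 < m by rewrite /m; lia.
have xm : x <= m.*2.+1 by rewrite /m; lia.
have mx : m.*2 <= x by rewrite /m; lia.
set k := (size (odd_primes x)).+1.
have k_ge : size (primes_upto m.*2) <= k.
  apply: leq_trans (size_primes_upto _) _; rewrite ltnS.
  rewrite /odd_primes -(subnKC mx) -addSn iotaD filter_cat size_cat.
  exact: leq_addr.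
apply: leq_trans (psum_sq x); rewrite -/k.
set L := (trunc_log 2 m.*2).+1.
have m0 : 0 < m by apply: leq_trans m_ge.
have ltL : m.*2 < 2 ^ L by apply: trunc_log_ltn.
have leL : 2 ^ (L - 2) <= m.
  have : 2 ^ L.-1 <= m.*2 by apply: trunc_logP; rewrite ?double_gt0.
  case: (L) ltL => [|[|l]] /=; rewrite ?expn0 ?expn1; [lia|lia|].
  by move=> _; rewrite subn2 /= expnS; lia.
have L9 : 9 < L.
  by rewrite -(ltn_exp2l _ _ (isT : 1 < 2)); apply: leq_ltn_trans ltL; rewrite -mul2n; lia.
have mLk : m <= L * k.
  rewrite -(leq_exp2l _ _ (isT : 1 < 2)) expnM.
  apply: leq_trans (central_bin_ge m) _; apply: leq_trans (central_bin_le m0) _.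
  apply: (@leq_trans (m.*2 ^ k)).
    by rewrite leq_pexp2l // double_gt0.
  by rewrite leq_exp2r // ltnW.
have quad := quad_lt_expn L9.
have mge : 2 * L ^ 2 + 7 <= m by apply: leq_trans quad leL.
have : m ^ 2 <= L ^ 2 * k ^ 2 by rewrite -expnMn leq_exp2r.
have : L ^ 2 * (m.*2 + 7) <= m ^ 2.
  by move: mge L9; rewrite -mul2n !expnS !expn0 !muln1; clear; nia.
move=> h1 h2; have := leq_trans h1 h2; rewrite leq_pmul2l ?expn_gt0; last by lia.
by apply: leq_trans; lia.
Qed.

Lemma psum_ge x : 9 < x -> x + 6 <= psum x.
Proof.
move=> x9; have [|lt] := ltnP 511 x; first exact: psum_large.
have h a b : a <= x -> x <= b -> b + 6 <= psum a -> x + 6 <= psum x.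
  move=> ax xb ba; apply: leq_trans (psum_mono ax); apply: leq_trans ba.
  by rewrite leq_add2r.
(* Each interval ends where [psum] of its chosen lower point is still large enough: [psum] is 16,
   27, 57 and 280 at 10, 11, 17 and 43. *)
have [x10|x10] := leqP x 10; first by apply: (h 10 10).
have [x21|x21] := leqP x 21; first by apply: (h 11 21).
have [x51|x51] := leqP x 51; first by apply: (h 17 51) => //; apply: ltnW; apply: ltn_trans x21.
have [x274|x274] := leqP x 274; first by apply: (h 43 274) => //; lia.
by apply: (h 100 511) => //; lia.
Qed.

Definition rep x m := exists la, [/\ uniq la, all part_ok la,
  all (fun p => p <= x) la & sumn la = m].

Lemma repS x m : rep x m -> rep x.+1 m.
Proof.
case=> la [u ok /allP le E]; exists la; split=> //.
by apply/allP=> p /le; apply: leqW.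
Qed.

Lemma rep_add x m : prime x.+1 -> odd x.+1 -> rep x m -> rep x.+1 (x.+1 + m).
Proof.
move=> pP oP [la [u ok /allP le E]]; exists (x.+1 :: la); split=> //=.
- by rewrite u andbT; apply/negP=> /le; rewrite ltnn.
- by rewrite ok andbT /part_ok pP oP orbT.
- by rewrite leqnn; apply/allP=> p /le; apply: leqW.
by rewrite E.
Qed.

(** Taking complements in the set of all parts exchanges the exceptional values 2 and [psum x] - 2.
    When a prime p = z + 1 is added, the old exceptional value S - 2 and all values above S are
    reached through p; the margin S >= z + 6 makes S - 2 - p greater than 2, so the remainder is
    never the exceptional 2. *)
Lemma rep_all x m : 6 < x -> m <= psum x -> m != 2 -> m + 2 != psum x -> rep x m.
Proof.
move=> /subnKC <-; elim: (x - 7) m => [|k IH] m.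
  rewrite addn0 [psum 7](_ : _ = 16) // => m16 m2 m14.
  pose parts i := nth [::] [:: [::]; [:: 1]; [::]; [:: 3]; [:: 3; 1]; [:: 5];
    [:: 5; 1]; [:: 7]; [:: 7; 1]; [:: 5; 3; 1]; [:: 7; 3]; [:: 7; 3; 1];
    [:: 7; 5]; [:: 7; 5; 1]; [::]; [:: 7; 5; 3]; [:: 7; 5; 3; 1]] i.
  pose good i := [&& uniq (parts i), all part_ok (parts i),
    all (fun p => p <= 7) (parts i) & sumn (parts i) == i].
  have all_good : all (fun i => (i == 2) || (i == 14) || good i) (iota 0 17) by [].
  have := allP all_good m; rewrite mem_iota /= add0n ltnS m16 => /(_ isT).
  have -> : (m == 14) = false by move: m14; clear; lia.
  rewrite (negPf m2) /= => /and4P[h1 h2 h3 /eqP h4].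
  by exists (parts m).
rewrite addnS psumS; set z := 7 + k in IH *.
case: ifP => [/andP[pP oP]|_] mS m2 mS2; last by apply/repS/IH.
have z9 : 9 < z.
  rewrite ltnNge; apply/negP => z9.
  have : z \in [:: 7; 8; 9].
    by rewrite !inE; move: z9; rewrite /z; clear; lia.
  by rewrite !inE => /or3P[]/eqP zE; move: pP; rewrite zE.
have big := psum_ge z9; move: (psum z) IH mS mS2 big => S IH mS mS2 big.
have [mle|mgt] := leqP m S.
  have [mS'|mS'] := eqVneq (m + 2) S; last by apply/repS/IH.
  have -> : m = z.+1 + (m - z.+1) by lia.
  by apply: rep_add => //; apply: IH; lia.
have -> : m = z.+1 + (m - z.+1) by lia.
by apply: rep_add => //; apply: IH; lia.
Qed.

Lemma parts_exist n : 8 < n -> exists la, is_partition n la /\ parts_ok la.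
Proof.
move=> n8; case: n n8 => // n n8.
have big : n + 6 <= psum n.
  have [n9|n9] := ltnP 9 n; first exact: psum_ge.
  have /orP[] : (n == 8) || (n == 9) by lia.
    by move/eqP->.
  by move/eqP->.
(* Parts bounded by [n] and adding up to n + 1 are at least two in number. *)
have [la [u ok le E]] : rep n n.+1.
  by apply: rep_all; move: big n8; clear; lia.
exists (sort geq la); have pe : perm_eq (sort geq la) la by rewrite perm_sort.
split.
  rewrite /is_partition sort_sorted; last by move=> a b; apply: leq_total.
  rewrite (perm_sumn pe) E eqxx andbT mem_sort.
  by apply/negP => /(allP ok).
have s1 : 1 < size la.
  case: la u ok le E {pe} => [|a [|b l]] //= _ _.
  by rewrite addn0 andbT => + aE; rewrite aE ltnn.
apply/and5P; split.
- by rewrite sort_uniq.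
- by rewrite (perm_all _ pe).
- by rewrite size_sort.
- apply/negP=> /perm_sumn; rewrite (perm_sumn pe) E /=.
  by move: n8; clear; lia.
- apply/negP=> /perm_sumn; rewrite (perm_sumn pe) E /=.
  by move: n8; clear; lia.
Qed.

End PrimeCount.

(** * The action of permutations on vectors *)

Import GRing.Theory Num.Theory.
Local Open Scope ring_scope.

HB.lock Definition actv (T : finType) (d : nat)
  (rG : mx_representation algC [set: {perm T}]%G d) (v : 'rV[algC]_d)
  (s : {perm T}) : 'rV[algC]_d := v *m rG s.

Ltac vring := apply/rowP=> ?; rewrite !mxE; ring.

Section Action.

Variables (T : finType) (d : nat).
Variable rG : mx_representation algC [set: {perm T}]%G d.

Local Notation "v |> s" := (actv rG v s) (at level 45, left associativity).

Implicit Types (v w : 'rV[algC]_d) (s t g : {perm T}) (a b c x y z : T).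
Implicit Types (A B D P Q : {set T}) (H U : 'M[algC]_d).

Lemma actv1 v : v |> 1%g = v.
Proof. by rewrite actv.unlock repr_mx1 mulmx1. Qed.

Lemma actvM v s t : v |> s |> t = v |> (s * t)%g.
Proof. by rewrite actv.unlock -mulmxA -repr_mxM ?inE. Qed.

Lemma actvD v w s : (v + w) |> s = (v |> s) + (w |> s).
Proof. by rewrite actv.unlock mulmxDl. Qed.

Lemma actvN v s : (- v) |> s = - (v |> s).
Proof. by rewrite actv.unlock mulNmx. Qed.

Lemma actvB v w s : (v - w) |> s = (v |> s) - (w |> s).
Proof. by rewrite actvD actvN. Qed.

Lemma actvZ k v s : (k *: v) |> s = k *: (v |> s).
Proof. by rewrite actv.unlock scalemxAl. Qed.

Lemma actv0 s : 0 |> s = 0.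
Proof. by rewrite actv.unlock mul0mx. Qed.

Lemma actv_sum (I : Type) (r : seq I) (F : pred I) (f : I -> 'rV_d) s :
  (\sum_(i <- r | F i) f i) |> s = \sum_(i <- r | F i) (f i |> s).
Proof. by rewrite actv.unlock mulmx_suml. Qed.

Lemma actvK v s : v |> s |> s^-1%g = v.
Proof. by rewrite actvM mulgV actv1. Qed.

Lemma actv_eq0 v s : (v |> s == 0) = (v == 0).
Proof. by apply/eqP/eqP=> [E|->]; rewrite ?actv0 // -(actvK v s) E actv0. Qed.

Lemma actvJ v s t : v |> s |> t = v |> t |> (s ^ t)%g.
Proof. by rewrite !actvM -conjgC. Qed.

Lemma actv_tpermJ v a b s : v |> tperm a b |> s = v |> s |> tperm (s a) (s b).
Proof. by rewrite actvJ tpermJ. Qed.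

Lemma actv_tt v a b : v |> tperm a b |> tperm a b = v.
Proof. by rewrite actvM tperm2 actv1. Qed.

Lemma actv_ttC v a b c z : a != c -> a != z -> b != c -> b != z ->
  v |> tperm a b |> tperm c z = v |> tperm c z |> tperm a b.
Proof. by move=> *; rewrite actv_tpermJ !tpermD // eq_sym. Qed.

Lemma actv_tt_l v x y z : x != y -> x != z -> y != z ->
  v |> tperm x y |> tperm x z = v |> tperm y z |> tperm x y.
Proof.
move=> xy xz yz; rewrite [RHS]actv_tpermJ tpermR tpermD //.
Qed.

Lemma actv_tt_r v x y z : x != y -> x != z -> y != z ->
  v |> tperm x y |> tperm x z = v |> tperm x z |> tperm z y.
Proof.
by move=> xy xz yz; rewrite actv_tpermJ tpermL tpermD // 1?eq_sym.
Qed.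

Definition invar A v := forall a b, a \in A -> b \in A -> v |> tperm a b = v.
Definition alter A v :=
  forall a b, a \in A -> b \in A -> a != b -> v |> tperm a b = - v.

Lemma invarS A B v : A \subset B -> invar B v -> invar A v.
Proof. by move=> /subsetP sAB iv a b aA bA; apply: iv; apply: sAB. Qed.

Lemma alterS A B v : A \subset B -> alter B v -> alter A v.
Proof. by move=> /subsetP sAB iv a b aA bA; apply: iv; apply: sAB. Qed.

Lemma invarP A v : (forall a b, a \in A -> b \in A -> a != b ->
  v |> tperm a b = v) -> invar A v.
Proof.
by move=> H a b aA bA; have [->|] := eqVneq a b; [rewrite tperm1 actv1|apply: H].
Qed.

Lemma invar_perm A v s : invar A v -> perm_on A s -> v |> s = v.
Proof.
move=> iv; move: s; apply: perm_on_ind => [|a b s aA bA _ _ E].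
  by rewrite actv1.
by rewrite -actvM iv.
Qed.

Lemma alter_perm A v s : alter A v -> perm_on A s -> v |> s = (-1) ^+ s *: v.
Proof.
move=> iv; move: s; apply: perm_on_ind => [|a b s aA bA ab _ E].
  by rewrite actv1 odd_perm1 scale1r.
by rewrite -actvM iv // actvN E odd_mul_tperm ab signr_addb expr1 mulN1r scaleNr.
Qed.

Lemma invarB A v w : invar A v -> invar A w -> invar A (v - w).
Proof. by move=> iv iw a b aA bA; rewrite actvB iv ?iw. Qed.

Lemma invarD A v w : invar A v -> invar A w -> invar A (v + w).
Proof. by move=> iv iw a b aA bA; rewrite actvD iv ?iw. Qed.

Lemma alterD A v w : alter A v -> alter A w -> alter A (v + w).
Proof. by move=> iv iw a b aA bA ab; rewrite actvD iv ?iw // opprD. Qed.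

Lemma invar0 A : invar A 0.
Proof. by move=> a b _ _; rewrite actv0. Qed.

Lemma alter0 A : alter A 0.
Proof. by move=> a b _ _ _; rewrite actv0 oppr0. Qed.

Lemma invar_sum A (I : Type) (r : seq I) (F : pred I) (f : I -> 'rV_d) :
  (forall i, F i -> invar A (f i)) -> invar A (\sum_(i <- r | F i) f i).
Proof. by move=> H; elim/big_rec: _ => [|i v /H]; [apply: invar0|apply: invarD]. Qed.

Lemma alter_sum A (I : Type) (r : seq I) (F : pred I) (f : I -> 'rV_d) :
  (forall i, F i -> alter A (f i)) -> alter A (\sum_(i <- r | F i) f i).
Proof. by move=> H; elim/big_rec: _ => [|i v /H]; [apply: alter0|apply: alterD]. Qed.

Lemma invar_act A v s : invar A v -> invar (s @: A) (v |> s).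
Proof.
move=> iv _ _ /imsetP[a aA ->] /imsetP[b bA ->].
by rewrite -actv_tpermJ iv.
Qed.

Lemma alter_act A v s : alter A v -> alter (s @: A) (v |> s).
Proof.
move=> iv _ _ /imsetP[a aA ->] /imsetP[b bA ->] ab.
by rewrite -actv_tpermJ iv ?actvN //; apply: contraNneq ab => ->.
Qed.

Lemma imset_fixed A s : {in A, forall a, s a = a} -> s @: A = A.
Proof. by move=> H; rewrite (eq_in_imset H) imset_id. Qed.

Lemma invar_actD A v a b : a \notin A -> b \notin A -> invar A v ->
  invar A (v |> tperm a b).
Proof.
move=> aA bA /(@invar_act _ _ (tperm a b)); rewrite imset_fixed // => c cA.
by rewrite tpermD //; apply: contraTneq cA => <-.
Qed.

Lemma alter_actD A v a b : a \notin A -> b \notin A -> alter A v ->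
  alter A (v |> tperm a b).
Proof.
move=> aA bA /(@alter_act _ _ (tperm a b)); rewrite imset_fixed // => c cA.
by rewrite tpermD //; apply: contraTneq cA => <-.
Qed.

(* Coset representatives of Sym A in Sym (b |: A) give the symmetrization. *)
Lemma invar_symm A b v : b \notin A -> invar A v ->
  invar (b |: A) (v + \sum_(x in A) (v |> tperm x b)).
Proof.
move=> bA iv x z xA zA.
have -> : v + \sum_(x in A) (v |> tperm x b)
          = \sum_(x in b |: A) (v |> tperm x b).
  by rewrite big_setU1 //= tperm1 actv1.
set s := tperm x z; rewrite actv_sum.
have sA : perm_on (b |: A) s by apply: perm_on_tperm.
have E: s @: (b |: A) = b |: A by apply: im_perm_on.
rewrite -[in RHS]E big_imset /=; last by move=> ? ? _ _; apply: perm_inj.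
apply: eq_bigr => u uA.
have suA : s u \in b |: A by rewrite perm_closed.
rewrite actvM -[in LHS](mulgKV (tperm (s u) b) (tperm u b * s)%g) -actvM.
congr (_ |> _); rewrite tpermV; apply: (invar_perm iv).
set r := (_ * _)%g; have rb : r b = b by rewrite !permM tpermR tpermL.
have rA : perm_on (b |: A) r.
  by rewrite !perm_onM // perm_on_tperm ?setU11.
apply/subsetP=> y; rewrite inE => ry.
have : y \in b |: A by apply: contraR ry => /(out_perm rA) ->.
by rewrite !inE => /orP[/eqP yb|//]; rewrite yb rb eqxx in ry.
Qed.

Definition stab P H := forall s, perm_on P s -> (H *m rG s <= H)%MS.

Lemma stab_act P H v s : stab P H -> perm_on P s -> (v <= H)%MS ->
  (v |> s <= H)%MS.
Proof.
move=> sH sP vH; rewrite actv.unlock.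
by apply: submx_trans (sH s sP); apply: submxMr.
Qed.

Lemma stab_tperm P H v a b : stab P H -> a \in P -> b \in P -> (v <= H)%MS ->
  (v |> tperm a b <= H)%MS.
Proof. by move=> sH aP bP; apply: stab_act sH _; apply: perm_on_tperm. Qed.

Lemma stabS P Q H : P \subset Q -> stab Q H -> stab P H.
Proof. by move=> sPQ sH s sP; apply: sH; apply: perm_onS sPQ sP. Qed.

Lemma stabP P H : (forall v s, (v <= H)%MS -> perm_on P s -> (v |> s <= H)%MS)
  -> stab P H.
Proof.
move=> sH s sP; apply/row_subP=> i; rewrite row_mul.
by have := sH (row i H) s (row_sub _ _) sP; rewrite actv.unlock.
Qed.

Lemma stab_cap P H U : stab P H -> stab P U -> stab P (H :&: U)%MS.
Proof.
move=> sH sU; apply: stabP => v s; rewrite !sub_capmx => /andP[vH vU] sP.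
by rewrite (stab_act sH) ?(stab_act sU).
Qed.

Lemma submxB (v w : 'rV[algC]_d) H : (v <= H)%MS -> (w <= H)%MS -> (v - w <= H)%MS.
Proof. by move=> vH wH; rewrite addmx_sub // eqmx_opp. Qed.

(* Maschke's theorem. *)
Lemma stab_compl P H U : stab P H -> stab P U -> (U <= H)%MS ->
  exists W : 'M[algC]_d, [/\ stab P W, (W <= H)%MS,
    forall v, (v <= H)%MS -> exists u, (u <= U)%MS /\ (v - u <= W)%MS
  & forall v, (v <= U)%MS -> (v <= W)%MS -> v = 0].
Proof.
move=> sH sU UH.
have sG : perm.Sym_group P \subset [set: {perm T}]%G by apply: subsetT.
pose rP := subg_repr rG sG.
have modU : mxmodule rP U.
  by apply/mxmoduleP=> s; rewrite inE => sP; apply: sU.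
have char0 : pgroup [pchar algC]^' (perm.Sym_group P).
  by apply/pgroupP=> q _ _; rewrite inE /= pchar_num.
have [W [modW UW /mxdirect_addsP dUW]] :=
  mx_Maschke_pchar rP char0 modU (submx1 U).
exists (H :&: W)%MS; split.
- apply: stab_cap sH _ => s sP.
  by move/mxmoduleP: modW; apply; rewrite inE.
- exact: capmxSl.
- move=> v vH; have: (v <= U + W)%MS by rewrite UW submx1.
  case/sub_addsmxP=> [[u w]] /= E; exists (u *m U).
  rewrite submxMl sub_capmx; split=> //; apply/andP; split.
    by rewrite submxB // (submx_trans _ UH) ?submxMl.
  by rewrite E addrC addKr submxMl.
- move=> v vU; rewrite sub_capmx => /andP[_ vW]; apply/eqP.
  by rewrite -submx0 -dUW sub_capmx vU.
Qed.

End Action.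

(** * Twisting by the sign character *)

Section SignTwist.

Variables (T : finType) (d : nat).
Variable rG : mx_representation algC [set: {perm T}]%G d.

Lemma sgn_mx_repr :
  mx_repr [set: {perm T}]%G (fun s : {perm T} => (-1) ^+ s *: rG s).
Proof.
split=> [|s t _ _]; first by rewrite odd_perm1 scale1r repr_mx1.
by rewrite odd_permM signr_addb repr_mxM ?inE // -scalemxAl -scalemxAr scalerA.
Qed.

Definition sgn_repr := MxRepresentation sgn_mx_repr.

Implicit Types (v : 'rV[algC]_d) (A P : {set T}).

Lemma actv_sgn v s : actv sgn_repr v s = (-1) ^+ s *: actv rG v s.
Proof. by rewrite actv.unlock /= -scalemxAr. Qed.

Lemma invar_sgn A v : invar sgn_repr A v <-> alter rG A v.
Proof.
split=> [iv a b aA bA ab|iv]; last first.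
  apply: invarP => a b aA bA ab.
  by rewrite actv_sgn odd_tperm ab expr1 scaleN1r iv ?opprK.
by rewrite -[in RHS](iv a b aA bA) actv_sgn odd_tperm ab expr1 scaleN1r opprK.
Qed.

Lemma alter_sgn A v : alter sgn_repr A v <-> invar rG A v.
Proof.
split=> [iv|iv a b aA bA ab]; last first.
  by rewrite actv_sgn odd_tperm ab expr1 scaleN1r iv.
apply: invarP => a b aA bA ab.
have := iv a b aA bA ab; rewrite actv_sgn odd_tperm ab expr1 scaleN1r.
exact: oppr_inj.
Qed.

Lemma stab_sgn P (H : 'M[algC]_d) : stab sgn_repr P H <-> stab rG P H.
Proof.
have E s : (H *m sgn_repr s <= H)%MS = (H *m rG s <= H)%MS.
  by rewrite /= -scalemxAr eqmx_scale ?signr_eq0.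
by split=> sH s sP; [rewrite -E|rewrite E]; apply: sH.
Qed.

Lemma alter_antisymm A b v : b \notin A -> alter rG A v ->
  alter rG (b |: A) (v - \sum_(x in A) actv rG v (tperm x b)).
Proof.
move=> bA /invar_sgn iv; apply/invar_sgn; rewrite -sumrN.
rewrite (eq_bigr (fun x => actv sgn_repr v (tperm x b))); first exact: invar_symm.
move=> x xA; rewrite actv_sgn odd_tperm.
by case: eqP xA => [->|]; rewrite ?(negPf bA) // expr1 scaleN1r.
Qed.

End SignTwist.

(** * Subspaces without vectors fixed by a p-cycle *)

Section Bad.

Variables (T : finType) (d : nat).
Variable rG : mx_representation algC [set: {perm T}]%G d.

Local Notation "v |> s" := (actv rG v s) (at level 45, left associativity).
Local Notation stab := (stab rG).

Implicit Types (v w : 'rV[algC]_d) (s t g : {perm T}) (a b c x y z : T).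
Implicit Types (A B D P Q : {set T}) (H U : 'M[algC]_d).

Definition bad P H := stab P H /\
  forall g v, cycle_on P g -> (v <= H)%MS -> v |> g = v -> v = 0.

Definition Ksum P v := \sum_(s in cycles P) (v |> s).
(** The Jucys-Murphy element of [x] relative to [P]. *)
Definition Jsum P x v := \sum_(a in P) (v |> tperm a x).

Lemma Jsum_act P x v s : x \notin P -> perm_on P s ->
  Jsum P x v |> s = Jsum P x (v |> s).
Proof.
move=> xP sP; rewrite /Jsum actv_sum.
rewrite -[in RHS](im_perm_on sP) big_imset /=; last first.
  by move=> ? ? _ _; apply: perm_inj.
by apply: eq_bigr => a aP; rewrite actv_tpermJ (out_perm sP xP).
Qed.

(** Iterated, this factors the sum of all full cycles into Jucys-Murphy elements; [Ksum_setU1'] puts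
    the new factor on the other side. *)
Lemma Ksum_setU1 P x v : x \notin P -> P != set0 ->
  Ksum (x |: P) v = Ksum P (Jsum P x v).
Proof.
move=> xP P0; have [E inj] := cycles_setU1 xP P0.
rewrite /Ksum E big_imset //= /Jsum.
rewrite (eq_bigl (fun u => (u.1 \in P) && (u.2 \in cycles P))); last first.
  by move=> [a s]; rewrite in_setX.
rewrite -(pair_big (mem P) (mem (cycles P))
  (fun a s => v |> (tperm a x * s)%g)) /= exchange_big /=.
by apply: eq_bigr => s _; rewrite actv_sum; apply: eq_bigr => a _; rewrite actvM.
Qed.

Lemma Ksum_setU1' P x v : x \notin P -> P != set0 ->
  Ksum (x |: P) v = Jsum P x (Ksum P v).
Proof.
move=> xP P0; rewrite Ksum_setU1 // /Ksum.
rewrite (eq_bigr (fun s => Jsum P x (v |> s))) => [|s]; last first.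
  by rewrite inE => /cycle_on_perm sP; rewrite Jsum_act.
rewrite /Jsum exchange_big /=; apply: eq_bigr => a _.
by rewrite actv_sum.
Qed.

Lemma Jsum0 P x : Jsum P x 0 = 0.
Proof. by rewrite /Jsum big1 // => a _; rewrite actv0. Qed.

Lemma Ksum0 P : Ksum P 0 = 0.
Proof. by rewrite /Ksum big1 // => a _; rewrite actv0. Qed.

Lemma Ksum_eq0S P Q v : Q != set0 -> Q \subset P -> Ksum Q v = 0 -> Ksum P v = 0.
Proof.
move=> Q0 sQP KQ; have [n] := ubnP #|P :\: Q|.
elim: n P sQP => // n IH P sQP len.
have [E|/set0Pn[x]] := eqVneq (P :\: Q) set0.
  by have -> : P = Q by apply/eqP; rewrite eqEsubset sQP -setD_eq0 E eqxx.
rewrite inE => /andP[xQ xP].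
have QPx : Q \subset P :\ x by rewrite subsetD1 sQP.
rewrite -(setD1K xP) Ksum_setU1' ?inE ?eqxx //; last first.
  have [y yQ] := set0Pn _ Q0; apply/set0Pn; exists y.
  exact: (subsetP QPx).
rewrite IH ?Jsum0 //; move: len; rewrite ltnS; apply: leq_trans.
apply: proper_card; apply/properP; split.
  by apply: setSD; apply: subD1set.
by exists x; rewrite !inE ?eqxx ?xQ ?xP.
Qed.

(** The i-th power is undone by the j-th power when i j is 1 modulo the prime; Euler's theorem
    supplies j. *)
Lemma cycles_expg P i : prime #|P| -> (0 < i < #|P|)%N ->
  [set (s ^+ i)%g | s in cycles P] = cycles P
  /\ {in cycles P &, injective (fun s => s ^+ i)%g}.
Proof.
move=> pP /andP[i0 iP].
have P0 : P != set0 by rewrite -card_gt0 prime_gt0.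
have co : coprime #|P| i.
  by rewrite prime_coprime // gtnNdvd.
set j := (i ^ (totient #|P|).-1)%N.
have ij : (i * j = 1 %[mod #|P|])%N.
  rewrite /j -expnS prednK ?totient_gt0 ?prime_gt0 //.
  by apply: Euler_exp_totient; rewrite coprime_sym.
have sK : {in cycles P, cancel (fun s => s ^+ i)%g (fun s => s ^+ j)%g}.
  move=> s; rewrite inE => cs; rewrite -expgM.
  rewrite -(expg_mod _ (cycle_on_expg_card P0 cs)) ij.
  by rewrite (expg_mod _ (cycle_on_expg_card P0 cs)) expg1.
have inj : {in cycles P &, injective (fun s => s ^+ i)%g}.
  by move=> s t cs ct E; rewrite -(sK s cs) /= E (sK t).
split=> //; apply/eqP; rewrite eqEcard (card_in_imset inj) leqnn andbT.
apply/subsetP=> _ /imsetP[s cs ->]; rewrite !inE in cs *.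
exact: cycle_onX.
Qed.

Lemma actv_powsum g v n : (g ^+ n = 1)%g ->
  (\sum_(i < n) (v |> (g ^+ i)%g)) |> g = \sum_(i < n) (v |> (g ^+ i)%g).
Proof.
case: n => [|n] gn; first by rewrite !big_ord0 actv0.
rewrite actv_sum big_ord_recr [RHS]big_ord_recl /= addrC actvM -expgSr gn.
by congr (_ + _); apply: eq_bigr => i _; rewrite actvM -expgSr.
Qed.

(** For each p-cycle g, the sum of the v g^i is fixed by g, hence zero. Summed over all g, the
    exponent 0 contributes (p - 1)! v, and each of the p - 1 others contributes [Ksum P v], because
    taking powers permutes the p-cycles. *)
Lemma Ksum_bad P H v : prime #|P| -> bad P H -> (v <= H)%MS ->
  Ksum P v = - ((#|P|.-2)`!%:R *: v).
Proof.
move=> pP [sH badH] vH; set p := #|P| in pP *.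
have P0 : P != set0 by rewrite -card_gt0 prime_gt0.
have p2 : (1 < p)%N := prime_gt1 pP.
have N0 g : cycle_on P g -> \sum_(i < p) (v |> (g ^+ i)%g) = 0.
  move=> cg; apply: (badH g) => //.
    apply: summx_sub => i _; apply: stab_act sH _ vH.
    by apply: perm_onX; apply: cycle_on_perm.
  exact: actv_powsum (cycle_on_expg_card P0 cg).
have : \sum_(g in cycles P) \sum_(i < p) (v |> (g ^+ i)%g) = 0.
  by apply: big1 => g; rewrite inE; apply: N0.
rewrite exchange_big /= -(prednK (ltnW p2)) big_ord_recl /=.
rewrite (eq_bigr (fun=> v)) => [|g _]; last by rewrite expg0 actv1.
rewrite sumr_const card_cycles // -/p.
rewrite (eq_bigr (fun=> Ksum P v)) => [|i _]; last first.
  rewrite /Ksum; have [|E inj] := @cycles_expg P (bump 0 i) pP.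
    by rewrite /bump /= add1n -/p -[X in (_ < X)%N](prednK (ltnW p2)) ltnS.
  by rewrite -[in RHS]E big_imset.
rewrite sumr_const card_ord => /eqP; rewrite addr_eq0 => /eqP E.
have q0 : p.-1%:R != 0 :> algC by rewrite pnatr_eq0; lia.
apply: (scalerI q0); rewrite [LHS]scaler_nat -[LHS]opprK -E scalerN scalerA.
have -> : p.-1 = p.-2.+1 by lia.
by rewrite -scaler_nat factS natrM.
Qed.

Lemma Ksum_inj P H v : prime #|P| -> bad P H -> (v <= H)%MS ->
  Ksum P v = 0 -> v = 0.
Proof.
move=> pP bH vH; rewrite (Ksum_bad pP bH vH) => /eqP.
rewrite oppr_eq0 scaler_eq0 pnatr_eq0 => /orP[|/eqP//].
by rewrite eqn0Ngt fact_gt0.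
Qed.

(* The left-hand side lies in the isotypic component of shape (2,2) for the   *)
(* symmetric group of {a, a', b, b'}, where the Jucys-Murphy element          *)
(* J = (a b') + (a' b') + (b b') vanishes: the last cell has content 0.       *)
Lemma bad_no22 P H w a a' b b' : prime #|P| -> bad P H -> (w <= H)%MS ->
  uniq [:: a; a'; b; b'] -> [set a; a'; b; b'] \subset P ->
  w |> tperm a a' = w -> w |> tperm b b' = w ->
  w - (w |> tperm a b) - (w |> tperm a' b')
    + (w |> tperm a b |> tperm a' b') = 0.
Proof.
move=> pP bH wH; rewrite /= !inE !negb_or -!andbA.
case/and3P=> aa' ab /and3P[ab' a'b] /and3P[a'b' bb' _] sP waa wbb.
have [aP a'P bP b'P] : [/\ a \in P, a' \in P, b \in P & b' \in P].
  by split; apply: (subsetP sP); rewrite !inE eqxx ?orbT.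
have [ba b'a] : b != a /\ b' != a by split; rewrite eq_sym.
have [a'a ba' b'a' b'b] : [/\ a' != a, b != a', b' != a' & b' != b].
  by split; rewrite eq_sym.
have waa2 : w |> tperm a' a = w by rewrite tpermC.
have wbb2 : w |> tperm b' b = w by rewrite tpermC.
set y := (X in X = 0).
have yH : (y <= H)%MS.
  have [sH _] := bH.
  by rewrite addmx_sub ?submxB ?(stab_tperm sH) // (stab_tperm sH).
apply: (Ksum_inj pP bH yH).
apply: (@Ksum_eq0S _ (b' |: [set a; a'; b])) => //.
- by apply/set0Pn; exists b'; rewrite setU11.
- by apply/subsetP=> z; rewrite !inE -!orbA => /or4P[]/eqP->.
have S3 : [set a; a'; b] != set0.
  by apply/set0Pn; exists a; rewrite !inE eqxx.
have b'S : b' \notin [set a; a'; b] by rewrite !inE !negb_or b'a b'a'.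
rewrite Ksum_setU1 //; suff -> : Jsum [set a; a'; b] b' y = 0 by apply: Ksum0.
rewrite /Jsum setUC big_setU1 /=; last by rewrite !inE negb_or ba.
rewrite big_setU1 ?big_set1 ?inE //=.
pose F1 := w |> tperm a b'; pose F2 := w |> tperm a' b.
pose x := (tperm a b * tperm a' b')%g.
have Ex s : w |> tperm a b |> tperm a' b' |> s = w |> (x * s)%g.
  by rewrite !actvM mulgA.
have xa : x a = b by rewrite permM tpermL tpermD.
have xb' : x b' = a' by rewrite permM [tperm a b _]tpermD // tpermR.
have xb : x b = a by rewrite permM tpermR tpermD.
have xa' : x a' = b' by rewrite permM [tperm a b _]tpermD // tpermL.
have conjx z u : (x * tperm (x z) (x u) = tperm z u * x)%g.
  by rewrite -tpermJ -conjgC.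
have E1 : w |> tperm a b |> tperm a b' = w |> tperm a b.
  by rewrite actv_tt_l // wbb.
have E2 : w |> tperm a' b' |> tperm a b' = w |> tperm a' b'.
  by rewrite ![tperm _ b']tpermC actv_tt_l // waa2.
have E3 : w |> tperm a b |> tperm a' b' |> tperm a b' = F2.
  rewrite Ex; have := conjx b a'; rewrite xb xa' => ->.
  rewrite -actvM /x -actvM [tperm b a']tpermC -/F2 [tperm a b]tpermC.
  rewrite /F2 [tperm a' b]tpermC actv_tt_l // waa2.
  by rewrite [tperm b a']tpermC actv_tt_l // wbb.
have G1 : w |> tperm a b |> tperm b b' = F1.
  by rewrite [tperm a b]tpermC actv_tt_r // wbb tpermC.
have G2 : w |> tperm a' b' |> tperm b b' = F2.
  by rewrite [tperm a' b']tpermC [tperm b b']tpermC actv_tt_r // wbb2 tpermC.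
have G3 : w |> tperm a b |> tperm a' b' |> tperm b b'
          = w |> tperm a b |> tperm a' b'.
  by rewrite Ex; have := conjx a a'; rewrite xa xa' => ->; rewrite -actvM waa -actvM.
rewrite /y !(actvD, actvN) E1 E2 E3 G1 G2 G3 wbb !actv_tt -/F1 -/F2.
by vring.
Qed.

End Bad.

Section BadType.

Variables (T : finType) (d : nat).
Variable rG : mx_representation algC [set: {perm T}]%G d.

Local Notation "v |> s" := (actv rG v s) (at level 45, left associativity).
Local Notation invar := (invar rG).
Local Notation alter := (alter rG).
Local Notation stab := (stab rG).
Local Notation bad := (bad rG).
Local Notation Ksum := (Ksum rG).
Local Notation Jsum := (Jsum rG).

Implicit Types (v w : 'rV[algC]_d) (s t g : {perm T}) (a b c x y z : T).
Implicit Types (A B D P Q : {set T}) (H U : 'M[algC]_d).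

Definition invspace A : 'M[algC]_d :=
  (\bigcap_(u : T * T | (u.1 \in A) && (u.2 \in A))
     kermx (rG (tperm u.1 u.2) - 1%:M))%MS.

Lemma invspaceP A v : reflect (invar A v) (v <= invspace A)%MS.
Proof.
apply: (iffP sub_bigcapmxP) => [H a b aA bA|iv [a b] /= /andP[aA bA]].
  have := H (a, b); rewrite /= aA bA => /(_ isT)/sub_kermxP/eqP.
  by rewrite mulmxBr mulmx1 subr_eq0 actv.unlock => /eqP.
apply/sub_kermxP; have := iv a b aA bA.
by rewrite actv.unlock mulmxBr mulmx1 => ->; rewrite subrr.
Qed.

Lemma stab_invspace A B : [disjoint A & B] -> stab B (invspace A).
Proof.
move=> dAB; apply: stabP => v s /invspaceP iv sB; apply/invspaceP.
have /imset_fixed <- : {in A, forall a, s a = a}; last exact: invar_act.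
by move=> a aA; apply: out_perm sB _; rewrite (disjointFr dAB).
Qed.

Lemma KsumZ P k v : Ksum P (k *: v) = k *: Ksum P v.
Proof. by rewrite /Ksum scaler_sumr; apply: eq_bigr => a _; rewrite actvZ. Qed.

Lemma Ksum_inv A v : A != set0 -> invar A v -> Ksum A v = (#|A|.-1)`!%:R *: v.
Proof.
move=> A0 iv; rewrite /Ksum (eq_bigr (fun=> v)) => [|s].
  by rewrite sumr_const card_cycles // scaler_nat.
by rewrite inE => /cycle_on_perm /(invar_perm iv).
Qed.

(** Such a [v] lies in a hook shape. The Jucys-Murphy element of a point [x] of [B] acts on it by -1
    from [A] and -1 from each other point of [B], in total the content - #|B|. Removing the points
    of [B] in turn gives the signed factorial; the cycles on [A] contribute the rest. *)
Lemma Ksum_hook A B v : A != set0 -> [disjoint A & B] ->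
    invar A v -> alter B v -> {in B, forall b, v + Jsum A b v = 0} ->
  Ksum (A :|: B) v = ((-1) ^+ #|B| * (#|B|)`!%:R * (#|A|.-1)`!%:R) *: v.
Proof.
move=> A0 dAB iA; have [n] := ubnP #|B|; elim: n B dAB => // n IH B dAB len aB JB.
have [B0|/set0Pn[x xB]] := eqVneq B set0.
  by rewrite B0 setU0 cards0 expr0 fact0 !mul1r; apply: Ksum_inv.
have xA : x \notin A by rewrite (disjointFl dAB).
set B' := B :\ x; have B'B : B' \subset B by apply: subD1set.
have dAB' : [disjoint A & B'] by apply: disjointWr dAB.
have cB : #|B| = #|B'|.+1 by rewrite (cardsD1 x B) xB.
have xAB : x \notin A :|: B' by rewrite !inE eqxx (negPf xA).
have -> : A :|: B = x |: (A :|: B') by rewrite setUCA /B' setD1K.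
rewrite Ksum_setU1 //; last by apply: contraNneq A0 => /eqP; rewrite setU_eq0 => /andP[].
have -> : Jsum (A :|: B') x v = (- (#|B|)%:R) *: v.
  rewrite {1}/Jsum (bigID (mem A)) /=.
  rewrite (eq_bigl (fun a => a \in A)) => [|a]; last first.
    by rewrite in_setU; case: (a \in A); rewrite ?andbF.
  rewrite [X in _ + X](eq_bigl (fun a => a \in B')) => [|a]; last first.
    rewrite in_setU; case aA: (a \in A) => /=; last by rewrite andbT.
    by rewrite (disjointFr dAB' aA).
  rewrite [X in _ + X](eq_bigr (fun=> - v)) => [|a]; last first.
    by rewrite !inE => /andP[ax aB']; rewrite aB.
  have -> : \sum_(a in A) (v |> tperm a x) = - v.
    by apply/eqP; rewrite -addr_eq0 addrC; apply/eqP/JB.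
  by rewrite sumr_const cB scaleNr scaler_nat mulNrn mulrS opprD.
rewrite KsumZ IH // ?scalerA; last 3 first.
- by move: len; rewrite cB.
- exact: alterS aB.
- by move=> b /(subsetP B'B); apply: JB.
congr (_ *: _); rewrite cB factS natrM exprS; ring.
Qed.

Lemma fact_mul_lt i k : (1 < i)%N -> (1 < k)%N -> (i`! * k`! < (i + k).-1`!)%N.
Proof.
case: i => [|[|i]] // _; elim: i => [|i IH] k2.
  by rewrite add2n /= [k.+1`!]factS ltn_mul2r fact_gt0.
have -> : ((i.+3 + k).-1 = (i.+2 + k).-1.+1)%N by lia.
rewrite [i.+3`!]factS [(_ + k).-1.+1`!]factS -mulnA.
apply: (@leq_trans (i.+3 * (i.+2 + k).-1`!)%N).
  by rewrite ltn_mul2l /= IH.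
by rewrite leq_mul2r; apply/orP; right; lia.
Qed.

(** Here k counts the alternating points and m the invariant ones. Parity makes m even, and
    [fact_mul_lt] excludes the equation once both k and m - 1 are at least 2. *)
Lemma hook_degree k m : (0 < k)%N -> (0 < m)%N -> odd (k + m) -> odd k ->
  (k`! * m.-1`! = (k + m).-2`!)%N -> k = 1%N \/ m = 2%N.
Proof.
case: m => [|m] // k0 _; rewrite addnS /= => okm ok E.
case: m => [|[|m]] in okm E *; first by move: okm; rewrite addn0 /= ok.
  by right.
have [k1|k1] := leqP k 1; first by left; lia.
have := @fact_mul_lt m.+2 k; rewrite mulnC E => /(_ isT k1).
by rewrite addnC ltnn.
Qed.

(* A = a largest subset of P carrying an invariant vector v; then v generates *)
(* a hook representation, alternating off A, and the scalar by which the sum  *)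
(* of all p-cycles acts leaves only two possible hooks.                       *)
Lemma bad_type P H : prime #|P| -> odd #|P| -> bad P H -> H != 0 ->
  exists v x, [/\ (v <= H)%MS, v != 0, x \in P
                & invar (P :\ x) v \/ alter (P :\ x) v].
Proof.
move=> pP oP bH H0; have [sH bH2] := bH.
have P0 : P != set0 by rewrite -card_gt0 prime_gt0.
pose ok A := (A \subset P) && ((H :&: invspace A)%MS != 0).
have i0 : ok set0.
  rewrite /ok sub0set; apply: contraNneq H0 => E; rewrite -submx0 -E sub_capmx submx_refl.
  by apply/sub_bigcapmxP => u; rewrite !inE.
case: (arg_maxnP (fun A : {set T} => #|A|) i0) => A /andP[sAP /rowV0Pn[v]].
rewrite sub_capmx => /andP[vH /invspaceP iA] v0 maxA.
(* The left-hand side is invariant on [A] enlarged by [b], so maximality of [A] kills it. *)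
have hmax w b : (w <= H)%MS -> invar A w -> b \in P -> b \notin A ->
    w + Jsum A b w = 0.
  move=> wH iw bP bA; apply/eqP/negPn/negP => n0.
  suff /maxA : ok (b |: A) by rewrite /= cardsU1 bA add1n ltnn.
  rewrite /ok subUset sub1set bP sAP /=.
  apply/rowV0Pn; exists (w + Jsum A b w) => //; rewrite sub_capmx; apply/andP; split.
    rewrite addmx_sub // summx_sub // => a aA.
    by apply: stab_tperm sH _ _ _ => //; apply: (subsetP sAP).
  by apply/invspaceP; apply: invar_symm.
set B := P :\: A.
have dAB : [disjoint A & B] by rewrite disjoints_subset setCD subsetUr.
have PE : P = A :|: B.
  by apply/setP=> z; rewrite !inE; case zA: (z \in A) => //=; rewrite (subsetP sAP).
have B0 : B != set0.
  apply: contraNneq v0 => B0; rewrite B0 setU0 in PE; have [g cg] := cycle_on_ex P0.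
  apply/eqP/(bH2 g v) => //; apply: (invar_perm iA); rewrite -PE.
  exact: cycle_on_perm.
have BP b : b \in B -> b \in P /\ b \notin A by rewrite !inE => /andP[].
have A0 : A != set0.
  apply: contraNneq v0 => A0; have [b /BP[bP bA]] := set0Pn _ B0.
  by have := hmax v b vH iA bP bA; rewrite /Jsum A0 big_set0 addr0 => ->.
have [a aA] := set0Pn _ A0.
have aB : alter B v.
  move=> b b' bB b'B bb'; have [bP bA] := BP b bB; have [b'P b'A] := BP b' b'B.
  pose w := v + (v |> tperm b b').
  have wH : (w <= H)%MS by rewrite addmx_sub ?(stab_tperm sH).
  have iw : invar A w by apply: invarD => //; apply: invar_actD.
  have wbb : w |> tperm b b' = w by rewrite /w actvD actv_tt addrC.
  suff w0 : w = 0 by apply/eqP; rewrite -addr_eq0 addrC -/w w0.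
  have Aneq c z : c \in A -> z \notin A -> c != z.
    by move=> cA; apply: contraNneq => <-.
  have key c : c \in A -> w |> tperm c b = w.
    move=> cA; have [cb cb'] : c != b /\ c != b' by split; apply: Aneq.
    have J' : \sum_(z in A :\ c) (w |> tperm z b') = - w - (w |> tperm c b').
      have := hmax w b' wH iw b'P b'A; rewrite /Jsum (big_setD1 c cA) /= addrA.
      by move/eqP; rewrite addrC addr_eq0 opprD => /eqP.
    (* Summing the relations of [bad_no22] over [z] and eliminating the sums by [hmax] leaves #|A|
       (w - w (c b)) = 0. Then [w] is fixed by every (c b), and [hmax] gives (1 + #|A|) w = 0. *)
    have S0 : \sum_(z in A :\ c) (w - (w |> tperm c b) - (w |> tperm z b')
                + (w |> tperm c b |> tperm z b')) = 0.
      apply: big1 => z; rewrite !inE => /andP[zc zA].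
      apply: (bad_no22 pP bH wH) => //; last by apply: iw.
        by rewrite /= !inE !negb_or eq_sym zc cb cb' bb' !Aneq.
      rewrite !subUset !sub1set bP b'P !(subsetP sAP) //.
    move: S0; rewrite 2!big_split /= sumr_const sumrN J'.
    rewrite [X in _ + X](eq_bigr (fun z => w |> tperm z b' |> tperm c b)); last first.
      move=> z; rewrite !inE => /andP[zc zA].
      by rewrite actv_ttC // eq_sym // Aneq.
    rewrite -actv_sum J' actvB actvN actv_tt_l // 1?eq_sym // [tperm b' b]tpermC wbb.
    move=> E; have : (w - (w |> tperm c b)) *+ #|A| = 0.
      rewrite -[RHS]E (cardsD1 c A) cA add1n mulrS; vring.
    move/eqP; rewrite -scaler_nat scaler_eq0 pnatr_eq0 cards_eq0 (negPf A0) /=.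
    by rewrite subr_eq0 => /eqP.
  have := hmax w b wH iw bP bA; rewrite /Jsum (eq_bigr (fun=> w)) //.
  rewrite sumr_const -mulrS => /eqP; rewrite -scaler_nat scaler_eq0 pnatr_eq0.
  by move=> /eqP.
have cP : #|P| = (#|A| + #|B|)%N.
  by rewrite PE cardsU disjoint_setI0 // cards0 subn0.
have cA0 : (0 < #|A|)%N by rewrite card_gt0.
have cB0 : (0 < #|B|)%N by rewrite card_gt0.
have JB : {in B, forall b, v + Jsum A b v = 0} by move=> b /BP[bP bA]; apply: hmax.
(* The hook scalar must equal - (p - 2)!: its sign forces [B] to be odd, its absolute value gives
   the equation. *)
have [oB EB] : odd #|B| /\ ((#|B|)`! * (#|A|.-1)`! = (#|P|.-2)`!)%N.
  have := Ksum_hook A0 dAB iA aB JB; rewrite -PE (Ksum_bad pP bH vH).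
  rewrite -scaleNr => /eqP; rewrite -subr_eq0 -scalerBl scaler_eq0 (negPf v0) orbF.
  rewrite subr_eq0 -mulrA -natrM -signr_odd; case: (odd #|B|).
    by rewrite expr1 mulN1r eqr_opp eqr_nat => /eqP <-.
  rewrite expr0 mul1r => /eqP E; have : (0 : algC) <= - ((#|P|.-2)`!)%:R.
    by rewrite E ler0n.
  by rewrite oppr_ge0 lern0 eqn0Ngt fact_gt0.
have [B1|A2] : #|B| = 1%N \/ #|A| = 2%N.
- by apply: hook_degree => //; rewrite addnC -cP.
- have /cards1P[x Bx] : #|B| == 1%N by apply/eqP.
  exists v, x; split=> //; first by rewrite PE Bx !inE eqxx orbT.
  left; apply: invarS iA; rewrite PE Bx setUC setU1K //.
  by have [] := BP x _; rewrite // Bx set11.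
(* With [A] = {a, a'}, antisymmetrizing over [a] and [B] gives a vector alternating on p - 1 points;
   it is nonzero because f + f (a a') = p v. *)
pose f := v - \sum_(b in B) (v |> tperm b a).
have aNB : a \notin B by rewrite !inE aA.
have /cards1P[a' Aa'] : #|A :\ a| == 1%N.
  by rewrite (cardsD1 a A) aA in A2; apply/eqP; case: A2.
have : a' \in A :\ a by rewrite Aa' set11.
rewrite !inE => /andP[a'a a'A].
exists f, a'; split.
- rewrite submxB // summx_sub // => b /BP[bP _].
  by apply: stab_tperm sH _ _ _ => //; apply: (subsetP sAP).
- have Ef : f + (f |> tperm a a') = #|P|%:R *: v.
    rewrite /f actvB actv_sum iA //.
    rewrite [in X in _ + (_ - X)](eq_bigr (fun b => v |> tperm b a')); last first.
      move=> b bB; rewrite actv_tpermJ iA // tpermL tpermD //.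
        by apply: contraNneq aNB => ->.
      by apply: contraNneq (BP b bB).2 => <-.
    have E : \sum_(b in B) (v |> tperm b a) + \sum_(b in B) (v |> tperm b a')
             = - (#|B|%:R *: v).
      rewrite -big_split /= (eq_bigr (fun=> - v)) => [|b bB].
        by rewrite sumr_const scaler_nat mulNrn.
      apply/eqP; rewrite -addr_eq0 addrC ![tperm b _]tpermC; apply/eqP.
      have := JB b bB; rewrite /Jsum (big_setD1 a aA) Aa' big_set1 /= => <-.
      by vring.
    have -> : #|P|%:R = 2%:R + #|B|%:R :> algC by rewrite cP A2 natrD.
    rewrite scalerDl -[in RHS](opprK (#|B|%:R *: v)) -E; vring.
  apply: contraNneq v0 => f0; move: Ef; rewrite f0 actv0 addr0 => /esym/eqP.
  by rewrite scaler_eq0 pnatr_eq0 cards_eq0 (negPf P0).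
- exact: (subsetP sAP).
- right; have -> : P :\ a' = a |: B.
    have AE z : (z \in A) = (z == a) || (z == a').
      by rewrite -(setD1K aA) Aa' !inE.
    apply/setP=> z; rewrite !inE AE negb_or.
    have [->|za /=] := eqVneq z a; last by [].
    by rewrite eq_sym a'a (subsetP sAP).
  exact: alter_antisymm.
Qed.

End BadType.

(** * The shape (p - 1, 1) and its sign twist *)

Section Hyper.

Variables (T : finType) (d : nat).
Variable rG : mx_representation algC [set: {perm T}]%G d.

Local Notation "v |> s" := (actv rG v s) (at level 45, left associativity).
Local Notation invar := (invar rG).
Local Notation alter := (alter rG).
Local Notation stab := (stab rG).
Local Notation bad := (bad rG).

Implicit Types (v w : 'rV[algC]_d) (s t g : {perm T}) (a b c x y z : T).
Implicit Types (A B D P Q : {set T}) (H U : 'M[algC]_d).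

(* These relations hold in the permutation representation on points; in a     *)
(* bad space, for p > 3, they single out the component of shape (p - 1, 1).   *)
Definition hyper P v := forall a b c z, a \in P -> b \in P -> c \in P ->
  z \in P -> uniq [:: a; b; c; z] ->
  (v - (v |> tperm a b)) |> tperm c z = v - (v |> tperm a b).

Definition hyperspace P : 'M[algC]_d :=
  (\bigcap_(u : T * T * (T * T) | [&& u.1.1 \in P, u.1.2 \in P, u.2.1 \in P,
      u.2.2 \in P & uniq [:: u.1.1; u.1.2; u.2.1; u.2.2]])
     kermx ((1%:M - rG (tperm u.1.1 u.1.2)) *m
            (rG (tperm u.2.1 u.2.2) - 1%:M)))%MS.

Lemma hyperspaceP P v : reflect (hyper P v) (v <= hyperspace P)%MS.
Proof.
have E a b c z : (v *m ((1%:M - rG (tperm a b)) *m (rG (tperm c z) - 1%:M)) == 0)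
    = ((v - (v |> tperm a b)) |> tperm c z == v - (v |> tperm a b)).
  by rewrite actv.unlock mulmxA mulmxBr mulmx1 mulmxBr mulmx1 subr_eq0.
apply: (iffP sub_bigcapmxP) => [Hv a b c z aP bP cP zP U|hv].
  have := Hv ((a, b), (c, z)); rewrite /= aP bP cP zP.
  by move: U => /= -> /(_ isT)/sub_kermxP/eqP; rewrite E => /eqP.
move=> [[a b] [c z]] /= /and5P[aP bP cP zP U]; apply/sub_kermxP/eqP.
by rewrite E; apply/eqP/hv.
Qed.

Lemma hyper_act P v s : perm_on P s -> hyper P v -> hyper P (v |> s).
Proof.
move=> sP hv a b c z aP bP cP zP U.
have sV := perm_onV sP.
have U' : uniq [:: (s^-1 a)%g; (s^-1 b)%g; (s^-1 c)%g; (s^-1 z)%g].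
  by rewrite -(map_inj_uniq (@perm_inj _ s^-1)) in U.
have X := hv _ _ _ _ (etrans (perm_closed a sV) aP) (etrans (perm_closed b sV) bP)
  (etrans (perm_closed c sV) cP) (etrans (perm_closed z sV) zP) U'.
have E w x y : w |> s |> tperm x y = w |> tperm (s^-1 x)%g (s^-1 y)%g |> s.
  by rewrite [RHS]actv_tpermJ !permKV.
by rewrite E -actvB E X.
Qed.

Lemma hyperB P v w : hyper P v -> hyper P w -> hyper P (v - w).
Proof.
move=> hv hw a b c z aP bP cP zP U.
have := hv a b c z aP bP cP zP U; have := hw a b c z aP bP cP zP U.
rewrite !actvB => Ew Ev.
have -> : v - w - (v |> tperm a b - w |> tperm a b)
   = (v - v |> tperm a b) - (w - w |> tperm a b) by vring.
by rewrite -Ev -Ew; vring.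
Qed.

Lemma stab_hyperspace P : stab P (hyperspace P).
Proof.
by apply: stabP => v s /hyperspaceP hv sP; apply/hyperspaceP/hyper_act.
Qed.

(** If (a b) does not move [x], the difference vanishes; otherwise (c z) does not move [x], fixes
    [v] and commutes with (a b). *)
Lemma hyper_point P x v : invar (P :\ x) v -> hyper P v.
Proof.
move=> iv a b c z aP bP cP zP; rewrite /= !inE !negb_or -!andbA.
case/and3P=> ab ac /and3P[az bc] /and3P[bz cz _].
have [ax|ax] := eqVneq a x; last have [bx|bx] := eqVneq b x.
- rewrite actvB actv_ttC // iv // !inE ?cP ?zP -ax andbT eq_sym //.
- rewrite actvB actv_ttC // iv // !inE ?cP ?zP -bx andbT eq_sym //.
- by rewrite iv ?subrr ?actv0 // !inE ?ax ?bx.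
Qed.

Lemma badS P H U : bad P H -> stab P U -> (U <= H)%MS -> bad P U.
Proof.
move=> [sH bH] sU UH; split=> // g v cg vU; apply: bH => //.
exact: submx_trans vU UH.
Qed.

(** A Maschke complement of the [hyper] part is again bad; if it were nonzero, [bad_type] would give
    a vector that is either [hyper] or excluded by hypothesis. *)
Lemma bad_hyper P H : prime #|P| -> odd #|P| -> bad P H ->
    (forall v x, (v <= H)%MS -> x \in P -> alter (P :\ x) v -> v = 0) ->
  forall v, (v <= H)%MS -> hyper P v.
Proof.
move=> pP oP bH nalt v vH; have [sH _] := bH.
have sU := stab_cap sH (@stab_hyperspace P).
have [W [sW WH dec tri]] := stab_compl sH sU (capmxSl _ _).
have W0 : W = 0.
  apply/eqP; have [//|W0] := eqVneq W 0.
  have [w [x [wW w0 xP hw]]] := bad_type pP oP (badS bH sW WH) W0.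
  have wH := submx_trans wW WH.
  case/eqP: w0; case: hw => hw; last exact: nalt hw.
  apply: tri => //; rewrite sub_capmx wH; apply/hyperspaceP.
  exact: hyper_point hw.
have [u []] := dec v vH; rewrite W0 submx0 subr_eq0 sub_capmx => /andP[_ hu].
by move/eqP ->; apply/hyperspaceP.
Qed.

End Hyper.

Section HyperSign.

Variables (T : finType) (d : nat).
Variable rG : mx_representation algC [set: {perm T}]%G d.

Local Notation "v |> s" := (actv rG v s) (at level 45, left associativity).

Implicit Types (v w : 'rV[algC]_d) (s t g : {perm T}) (a b c x y z : T).
Implicit Types (A B D P Q : {set T}) (H U : 'M[algC]_d).

Lemma bad_sgn P H : odd #|P| -> bad rG P H -> bad (sgn_repr rG) P H.
Proof.
move=> oP [sH bH]; split; first exact/stab_sgn.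
move=> g v cg vH; rewrite actv_sgn; have P0 : P != set0.
  by apply: contraTneq oP => ->; rewrite cards0.
by rewrite (odd_cycle_on P0 cg) oP expr0 scale1r; apply: bH.
Qed.

Lemma bad_hyper_sgn P H : prime #|P| -> odd #|P| -> bad rG P H ->
    (forall v x, (v <= H)%MS -> x \in P -> invar rG (P :\ x) v -> v = 0) ->
  forall v, (v <= H)%MS -> hyper (sgn_repr rG) P v.
Proof.
move=> pP oP bH nalt; apply: bad_hyper => //; first exact: bad_sgn.
by move=> v x vH xP /alter_sgn; apply: nalt.
Qed.

Lemma hyper_sgnE P v a b c z : hyper (sgn_repr rG) P v ->
  a \in P -> b \in P -> c \in P -> z \in P -> uniq [:: a; b; c; z] ->
  (v + (v |> tperm a b)) |> tperm c z = - (v + (v |> tperm a b)).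
Proof.
move=> hv aP bP cP zP U; have := hv a b c z aP bP cP zP U.
move: U; rewrite /= !inE !negb_or -!andbA.
case/and3P=> ab ac /and3P[az bc] /and3P[bz cz _].
rewrite !actv_sgn !odd_tperm ab cz expr1 !scaleN1r opprK => E.
by rewrite -[in RHS]E opprK.
Qed.

(** For [a], [b], [c] in [A] and a fourth point [z], w + w (a b) = 2 w, so (c z) negates [w], and
    likewise (a z). Hence their conjugate (a c) negates [w], while it also fixes it. *)
Lemma hyper_sgn_invar3 P A w : (3 < #|P|)%N -> A \subset P -> (2 < #|A|)%N ->
  hyper (sgn_repr rG) P w -> invar rG A w -> w = 0.
Proof.
move=> P3 sAP A2 hw iw.
have /card_gt2P[a [b [c [[aA bA cA] [ab bc ca]]]]] := A2.
have [z zP zabc] : exists2 z, z \in P & z \notin [set a; b; c].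
  by apply: exists_notin; apply: leq_ltn_trans (cards3_le _ _ _) P3.
move: zabc; rewrite !inE !negb_or -andbA => /and3P[za zb zc].
have two0 : 2%:R != 0 :> algC by rewrite pnatr_eq0.
have sgn x1 x2 x3 : x1 \in A -> x2 \in A -> x3 \in A -> x1 != x2 -> x1 != x3 ->
    x2 != x3 -> z != x1 -> z != x2 -> z != x3 -> w |> tperm x3 z = - w.
  move=> h1 h2 h3 n12 n13 n23 n1 n2 n3.
  have := hyper_sgnE hw (subsetP sAP _ h1) (subsetP sAP _ h2)
    (subsetP sAP _ h3) zP; rewrite iw // => X.
  have {X} : (w + w) |> tperm x3 z = - (w + w).
    by apply: X; rewrite /= !inE !negb_or n12 n13 n23 ![_ == z]eq_sym n1 n2 n3.
  rewrite -mulr2n -scaler_nat actvZ -scalerN => E.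
  exact: (scalerI two0 E).
have Ea : w |> tperm a z = - w by apply: (sgn b c) => //; rewrite eq_sym.
have Ec : w |> tperm c z = - w by apply: (sgn a b) => //; rewrite eq_sym.
have := iw a c aA cA.
have -> : w |> tperm a c = - w.
  have := actv_tpermJ rG (w |> tperm a z) c z (tperm a z).
  rewrite actv_tt tpermR tpermD // 1?eq_sym // [tperm c a]tpermC => <-.
  by rewrite Ea actvN Ec opprK.
move=> wN; apply: (scalerI two0).
by rewrite scaler0 scaler_nat mulr2n -{1}wN addNr.
Qed.

(* The sign-twisted part of v is invariant under three points, hence zero. *)
Lemma hyper_invar3 P H A v : prime #|P| -> odd #|P| -> (3 < #|P|)%N ->
    bad rG P H -> (v <= H)%MS -> A \subset P -> (2 < #|A|)%N ->
  invar rG A v -> hyper rG P v.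
Proof.
move=> pP oP P3 bH vH sAP A2 iv; have [sH _] := bH.
have sU := stab_cap sH (@stab_hyperspace _ _ rG P).
have [W [sW WH dec tri]] := stab_compl sH sU (capmxSl _ _).
have WK : forall w, (w <= W)%MS -> hyper (sgn_repr rG) P w.
  apply: bad_hyper_sgn => //; first exact: badS bH sW WH.
  move=> w x wW xP hw; apply: tri => //; rewrite sub_capmx (submx_trans wW WH).
  by apply/hyperspaceP; apply: hyper_point hw.
have [u [uU wW]] := dec v vH; set w := v - u in wW.
suff w0 : w = 0.
  have -> : v = u by apply/eqP; rewrite -subr_eq0 -/w w0.
  by apply/hyperspaceP; move: uU; rewrite sub_capmx => /andP[].
apply: (hyper_sgn_invar3 P3 sAP A2 (WK w wW)) => x y xA yA.
apply/eqP; rewrite -subr_eq0; apply/eqP; apply: tri.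
  have -> : w |> tperm x y - w = u - u |> tperm x y.
    by rewrite /w actvB iv //; vring.
  by rewrite submxB // (stab_tperm sU) ?(subsetP sAP).
by rewrite submxB // (stab_tperm sW) ?(subsetP sAP).
Qed.

End HyperSign.

(** * Two disjoint cycles *)

Section NoFix.

Variables (T : finType) (d : nat).
Variable rG : mx_representation algC [set: {perm T}]%G d.

Local Notation "v |> s" := (actv rG v s) (at level 45, left associativity).
Local Notation invar := (invar rG).
Local Notation stab := (stab rG).
Local Notation bad := (bad rG).
Local Notation invspace := (invspace rG).
Local Notation hyper := (hyper rG).

Implicit Types (v w : 'rV[algC]_d) (s t g h : {perm T}) (a b c x y z : T).
Implicit Types (A B D P Q : {set T}) (H U : 'M[algC]_d) (p q : nat).

(** The hypothesis to be refuted. All supports [Q] are quantified over, so relations obtained for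
    different supports can be compared. *)
Definition nofix D p q H := stab D H /\
  forall Q g h v, Q \subset D -> #|D :\: Q| = p -> #|Q| = q ->
    cycle_on (D :\: Q) g -> cycle_on Q h -> (v <= H)%MS ->
    v |> g = v -> v |> h = v -> v = 0.

Lemma cardDsub D Q p q : #|D| = (p + q)%N -> Q \subset D -> #|Q| = q ->
  #|D :\: Q| = p.
Proof. by move=> cD sQD cQ; rewrite cardsD (setIidPr sQD) cD cQ addnK. Qed.

Definition fixspace h : 'M[algC]_d := kermx (rG h - 1%:M).

Lemma fixspaceP h v : reflect (v |> h = v) (v <= fixspace h)%MS.
Proof.
apply: (iffP sub_kermxP); rewrite mulmxBr mulmx1 actv.unlock => /eqP.
  by rewrite subr_eq0 => /eqP.
by move=> /eqP ->; rewrite subrr.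
Qed.

Lemma stab_fixspace P Q h : perm_on Q h -> [disjoint P & Q] ->
  stab P (fixspace h).
Proof.
move=> hQ dPQ; apply: stabP => v s /fixspaceP vh sP; apply/fixspaceP.
by rewrite actvM (perm_onC sP hQ dPQ) -actvM vh.
Qed.

Lemma nofix_bad_fix D p q H Q h : nofix D p q H -> #|D| = (p + q)%N ->
    Q \subset D -> #|Q| = q -> cycle_on Q h ->
  bad (D :\: Q) (H :&: fixspace h)%MS.
Proof.
move=> [sH nH] cD sQD cQ ch; split.
  apply: stab_cap; first exact: stabS (subsetDl _ _) sH.
  apply: (stab_fixspace (cycle_on_perm ch)).
  by rewrite disjoints_subset subsetDr.
move=> g v cg; rewrite sub_capmx => /andP[vH /fixspaceP vh] vg.
exact: (nH Q g h) (cardDsub cD sQD cQ) _ _ _ _ _ _.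
Qed.

Lemma nofix_bad D p q H Q : nofix D p q H -> #|D| = (p + q)%N -> (0 < q)%N ->
    Q \subset D -> #|Q| = q -> bad (D :\: Q) (H :&: invspace Q)%MS.
Proof.
move=> nH cD q0 sQD cQ; have [sH _] := nH.
have [h ch] : exists h, cycle_on Q h by apply: cycle_on_ex; rewrite -card_gt0 cQ.
apply: badS (nofix_bad_fix nH cD sQD cQ ch) _ _.
  apply: stab_cap; first exact: stabS (subsetDl _ _) sH.
  by apply: stab_invspace; rewrite disjoint_sym disjoints_subset subsetDr.
apply/row_subP => i; have := row_sub i (H :&: invspace Q)%MS.
rewrite !sub_capmx => /andP[-> /invspaceP iv] /=; apply/fixspaceP.
exact: invar_perm iv (cycle_on_perm ch).
Qed.

Lemma nofix_fixed D p q H Q v : nofix D p q H -> #|D| = (p + q)%N ->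
    (0 < p)%N -> (0 < q)%N -> Q \subset D -> #|Q| = q -> (v <= H)%MS ->
    (forall g, cycle_on (D :\: Q) g -> v |> g = v) ->
    (forall h, cycle_on Q h -> v |> h = v) -> v = 0.
Proof.
move=> [_ nH] cD p0 q0 sQD cQ vH fg fh; have cP := cardDsub cD sQD cQ.
have [h ch] : exists h, cycle_on Q h by apply: cycle_on_ex; rewrite -card_gt0 cQ.
have [g cg] : exists g, cycle_on (D :\: Q) g.
  by apply: cycle_on_ex; rewrite -card_gt0 cP.
by apply: (nH Q g h) => //; [apply: fg|apply: fh].
Qed.

Lemma nofix_invar D p q H Q v : nofix D p q H -> #|D| = (p + q)%N ->
    (0 < p)%N -> (0 < q)%N -> Q \subset D -> #|Q| = q -> (v <= H)%MS ->
  invar (D :\: Q) v -> invar Q v -> v = 0.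
Proof.
move=> nH cD p0 q0 sQD cQ vH iP iQ.
by apply: (nofix_fixed nH cD p0 q0 sQD cQ vH) => g /cycle_on_perm;
  apply: invar_perm.
Qed.

Lemma nofix_invarD D p q H v : nofix D p q H -> #|D| = (p + q)%N ->
  (0 < p)%N -> (0 < q)%N -> (v <= H)%MS -> invar D v -> v = 0.
Proof.
move=> nH cD p0 q0 vH iD.
have [|Q sQD cQ] := @subset_card_ex _ D q; first by rewrite cD leq_addl.
apply: (nofix_invar nH cD p0 q0 sQD cQ vH); last exact: invarS iD.
exact: invarS (subsetDl _ _) iD.
Qed.

(* w spans, with its translates, a quotient of the exterior square of the     *)
(* permutation module; being of hyperplane type for every P it is in fact of  *)
(* the form u_a - u_x.                                                        *)
Lemma nofix_edge_cocycle D p q H w a x c : nofix D p q H ->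
    #|D| = (p + q)%N -> prime p -> odd p -> (4 < p)%N -> (0 < q)%N ->
    (w <= H)%MS -> a \in D -> x \in D -> c \in D ->
    uniq [:: a; x; c] -> invar (D :\ a :\ x) w -> w |> tperm a x = - w ->
  w = (w |> tperm x c) + (w |> tperm a c).
Proof.
move=> nH cD pP oP p4 q0 wH aD xD cD' U iw wax; have [sH _] := nH.
move: (U); rewrite /= !inE !negb_or -!andbA => /and4P[ax ac xc _].
have sE : [set a; x; c] \subset D by rewrite !subUset !sub1set aD xD.
(* With [Q] off the three points, [w] is invariant on [Q] and on at least three points of its
   complement, so [hyper_invar3] applies. *)
have [|Q sQ cQ] := @subset_card_ex _ (D :\: [set a; x; c]) q.
  rewrite cardsD (setIidPr sE) cD; have := cards3_le a x c; clear -p4; lia.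
have [sQD dQ] : Q \subset D /\ [disjoint Q & [set a; x; c]].
  by apply/andP; rewrite -subsetD.
set P := D :\: Q; have cP : #|P| = p by apply: cardDsub cQ.
have nQ z : z \in [set a; x; c] -> z \notin Q by move=> h; rewrite (disjointFl dQ).
have [aP xP cP'] : [/\ a \in P, x \in P & c \in P].
  by split; rewrite inE ?aD ?xD ?cD' nQ // !inE eqxx ?orbT.
have bP := nofix_bad nH cD q0 sQD cQ; rewrite -/P in bP.
have sQ' : Q \subset D :\ a :\ x.
  apply/subsetP=> z zQ; rewrite !inE (subsetP sQD _ zQ) andbT.
  by apply/andP; split; apply: contraTneq zQ => ->; rewrite nQ // !inE eqxx ?orbT.
have hw : hyper P w.
  apply: (hyper_invar3 (A := P :\ a :\ x) _ _ _ bP); rewrite ?cP //; first exact: ltnW.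
  - by rewrite sub_capmx wH; apply/invspaceP; apply: invarS iw.
  - by apply: subset_trans (subD1set _ _) (subD1set _ _).
  - have xPa : x \in P :\ a by rewrite in_setD1 eq_sym ax xP.
    by move: cP; rewrite (cardsD1 a) aP (cardsD1 x (P :\ a)) xPa; clear -p4; lia.
  - apply: invarS iw; rewrite /P; apply: setSD; apply: setSD; exact: subsetDl.
(* [y] alternates on [a], [x], [c]. The [hyper] relations with a fourth point [z] then make 2 y
   fixed by (c z) and (x z), hence by (x c). *)
pose y := w - (w |> tperm x c) - (w |> tperm a c).
suff y0 : y = 0 by apply/eqP; rewrite -subr_eq0 opprD addrA -/y y0.
have hy : hyper P y.
  by apply: hyperB; [apply: hyperB|] => //; apply: hyper_act => //; apply: perm_on_tperm.
have wxa : w |> tperm x a = - w by rewrite tpermC.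
have [ca cx xa] : [/\ c != a, c != x & x != a] by split; rewrite eq_sym.
have yax : y |> tperm a x = - y.
  rewrite /y !actvB wax {1}[tperm a x]tpermC actv_tt_r // wxa actvN.
  by rewrite actv_tt_r // wax actvN; vring.
have yac : y |> tperm a c = - y.
  rewrite /y !actvB actv_tt [tperm x c]tpermC [X in _ - (_ |> X) - _]tpermC.
  by rewrite actv_tt_l // wxa actvN; vring.
have yxc : y |> tperm x c = - y.
  rewrite /y !actvB actv_tt [tperm a c]tpermC [X in _ - (_ |> X)]tpermC.
  by rewrite actv_tt_l // wax actvN; vring.
have [z zP zN] : exists2 z, z \in P & z \notin [set a; x; c].
  apply: exists_notin; apply: leq_ltn_trans (cards3_le _ _ _) _.
  by rewrite cP ltnW.
move: zN; rewrite !inE !negb_or -andbA => /and3P[za zx zc].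
have two0 : 2%:R != 0 :> algC by rewrite pnatr_eq0.
have ycz : y |> tperm c z = y.
  have := hy a x c z aP xP cP' zP; rewrite yax opprK -mulr2n -scaler_nat actvZ.
  move=> E; apply: (scalerI two0); apply: E.
  by rewrite /= !inE !negb_or ax ac xc ![_ == z]eq_sym za zx zc.
have yxz : y |> tperm x z = y.
  have := hy a c x z aP cP' xP zP; rewrite yac opprK -mulr2n -scaler_nat actvZ.
  move=> E; apply: (scalerI two0); apply: E.
  by rewrite /= !inE !negb_or ax ac cx ![_ == z]eq_sym za zx zc.
have E : y |> tperm x c = y.
  have := actv_tpermJ rG (y |> tperm c z) x z (tperm c z).
  rewrite actv_tt tpermR tpermD // 1?eq_sym // => <-.
  by rewrite ycz yxz ycz.
move: yxc; rewrite E => yN; apply: (scalerI two0).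
by rewrite scaler0 scaler_nat mulr2n {1}yN addNr.
Qed.

(** The symmetrization [u] of [w] off [a] satisfies u - u (a x) = #|D| w by the cocycle relation, so
    it suffices to show that [u] vanishes. *)
Lemma nofix_edge D p q H w a x : nofix D p q H ->
    #|D| = (p + q)%N -> prime p -> odd p -> (4 < p)%N -> (0 < q)%N ->
    (w <= H)%MS -> a \in D -> x \in D -> a != x ->
    invar (D :\ a :\ x) w -> w |> tperm a x = - w ->
  w = 0.
Proof.
move=> nH cD pP oP p4 q0 wH aD xD ax iw wax; have [sH _] := nH.
have p0 : (0 < p)%N by apply: prime_gt0.
set A := D :\ a :\ x.
have xaD : x \in D :\ a by rewrite !inE eq_sym ax.
have xA : x \notin A by rewrite !inE eqxx.
have xAE : x |: A = D :\ a by rewrite setD1K.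
have AD z : z \in A -> [/\ z \in D, z != a & z != x].
  by rewrite !inE => /and3P[-> -> ->].
pose u := w + \sum_(c in A) (w |> tperm c x).
have uH : (u <= H)%MS.
  by rewrite addmx_sub // summx_sub // => c /AD[cA _ _]; apply: stab_tperm sH _ _ _.
have iu : invar (D :\ a) u by rewrite -xAE; apply: invar_symm.
have uax : u - (u |> tperm a x) = #|D|%:R *: w.
  rewrite /u actvD actv_sum wax.
  rewrite [in X in _ - (_ + X)](eq_bigr (fun c => - (w |> tperm a c))); last first.
    move=> c /AD[_ ca cx]; rewrite [tperm c x]tpermC [tperm a x]tpermC.
    by rewrite actv_tt_r // 1?eq_sym // tpermC wax actvN.
  have E : \sum_(c in A) (w |> tperm c x) + \sum_(c in A) (w |> tperm a c)
           = #|A|%:R *: w.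
    rewrite -big_split /= (eq_bigr (fun=> w)) => [|c /AD[cA ca cx]].
      by rewrite sumr_const scaler_nat.
    rewrite [tperm c x]tpermC; apply/esym.
    apply: (nofix_edge_cocycle nH) => //.
    by rewrite /= !inE !negb_or ax ![_ == c]eq_sym ca cx.
  have -> : #|D| = (2 + #|A|)%N by rewrite (cardsD1 a) aD (cardsD1 x (D :\ a)) xaD.
  by rewrite natrD scalerDl -E sumrN; vring.
have nu c : c \in D -> c != a -> invar (D :\ a :\ c) (u |> tperm c a).
  move=> cD' ca; apply: invar_actD; rewrite ?inE ?eqxx ?andbF //.
  by apply: invarS iu; apply: subD1set.
(* The sum is invariant on the p-set formed by [a] and [C] and on its complement, so it is fixed by
   a p-cycle and a q-cycle. *)
have sumC (C : {set T}) : C \subset D :\ a -> #|C| = p.-1 ->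
    u + \sum_(c in C) (u |> tperm c a) = 0.
  move=> sC cC; set y := u + _.
  have aC : a \notin C by apply/negP => /(subsetP sC); rewrite !inE eqxx.
  have sP : a |: C \subset D.
    by rewrite subUset sub1set aD; apply: subset_trans sC (subD1set _ _).
  have cP : #|a |: C| = p by rewrite cardsU1 aC cC add1n prednK.
  apply: (nofix_invar (Q := D :\: (a |: C)) nH cD p0 q0 (subsetDl _ _)).
  - by rewrite cardsD (setIidPr sP) cD cP addKn.
  - rewrite addmx_sub // summx_sub // => c cC'.
    by apply: stab_tperm sH _ _ uH => //; apply: (subsetP sP); rewrite !inE cC' orbT.
  - have -> : D :\: (D :\: (a |: C)) = a |: C by rewrite setDDr setDv set0U (setIidPr sP).
    by apply: invar_symm => //; apply: invarS iu.
  apply: invarD; first by apply: invarS iu; apply: setDS; apply: subsetUl.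
  apply: invar_sum => c cC'; have := subsetP sC c cC'; rewrite !inE => /andP[ca cD'].
  apply: invarS (nu c cD' ca); apply/subsetP=> z; rewrite !inE negb_or.
  by case/andP=> /andP[-> zC ->]; rewrite !andbT; apply: contraNneq zC => ->.
pose r := u |> tperm x a.
(* Exchanging one element of [C] in [sumC] shows that all translates agree. Comparison with the sum
   over all of [D] then gives q r = 0. *)
have rE c : c \in D :\ a -> u |> tperm c a = r.
  move=> cDa; have [->//|cx] := eqVneq c x.
  have cA : c \in A by rewrite !inE cx; move: cDa; rewrite !inE.
  have [|C sC cC] := @subset_card_ex _ (A :\ c) (p.-2).
    move: cD; rewrite (cardsD1 a) aD (cardsD1 x (D :\ a)) xaD -/A (cardsD1 c A) cA.
    by clear -q0 p4; lia.
  have [cNC xNC] : c \notin C /\ x \notin C.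
    by split; apply/negP => /(subsetP sC); rewrite !inE eqxx ?andbF.
  have sub z : z \in D :\ a -> z |: C \subset D :\ a.
    move=> zD; rewrite subUset sub1set zD (subset_trans sC) //.
    by rewrite (subset_trans (subD1set _ _)) // subD1set.
  have cards z : z \notin C -> #|z |: C| = p.-1.
    by move=> zC; rewrite cardsU1 zC cC; clear -p4; lia.
  have := etrans (sumC _ (sub c cDa) (cards c cNC))
                 (esym (sumC _ (sub x xaD) (cards x xNC))).
  rewrite !big_setU1 //= => /addrI E.
  exact: addIr E.
have sumD : u + \sum_(c in D :\ a) (u |> tperm c a) = 0.
  apply: (nofix_invarD nH) => //.
    rewrite addmx_sub // summx_sub // => c; rewrite !inE => /andP[_ cD'].
    exact: stab_tperm sH _ _ uH.
  rewrite -[X in invar X](setD1K aD); apply: invar_symm => //.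
  by rewrite !inE eqxx.
have [|C sC cC] := @subset_card_ex _ (D :\ a) p.-1.
  by move: cD; rewrite (cardsD1 a) aD; clear -q0; lia.
have sumr (B : {set T}) : B \subset D :\ a ->
    \sum_(c in B) (u |> tperm c a) = r *+ #|B|.
  by move/subsetP=> sB; rewrite (eq_bigr (fun=> r)) ?sumr_const // => c /sB/rE.
have r0 : r = 0.
  have := etrans (sumC C sC cC) (esym sumD).
  rewrite !sumr // cC => /addrI/eqP.
  have -> : #|D :\ a| = (p.-1 + q)%N.
    by move: cD; rewrite (cardsD1 a) aD; clear -p0; lia.
  rewrite mulrnDr eq_sym -subr_eq0 addrC addKr -scaler_nat scaler_eq0 pnatr_eq0.
  by rewrite eqn0Ngt q0 => /eqP.
have u0 : u = 0 by apply/eqP; rewrite -(actv_eq0 rG u (tperm x a)) -/r r0.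
move/eqP: uax; rewrite u0 actv0 subrr eq_sym scaler_eq0 pnatr_eq0 cD addn_eq0.
by rewrite !eqn0Ngt p0 => /eqP.
Qed.

End NoFix.

Section Pair.

Variables (T : finType) (d : nat).
Variable rG : mx_representation algC [set: {perm T}]%G d.

Local Notation "v |> s" := (actv rG v s) (at level 45, left associativity).
Local Notation invar := (invar rG).
Local Notation hyper := (hyper rG).
Local Notation nofix := (nofix rG).

Implicit Types (v w : 'rV[algC]_d) (s t g h : {perm T}) (a b c x y z : T).
Implicit Types (A B D P Q R : {set T}) (H U : 'M[algC]_d) (p q : nat).
Implicit Types (l : seq (T * T)).

(** This is [nofix_edge] for v - v (a x): a transposition (y z) off [a] and [x] commutes with (a x),
    so it may fix either [v] or the difference. *)
Lemma nofix_tperm D p q H v a x : nofix D p q H ->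
    #|D| = (p + q)%N -> prime p -> odd p -> (4 < p)%N -> (0 < q)%N ->
    (v <= H)%MS -> a \in D -> x \in D -> a != x ->
    (forall y z, y \in D :\ a :\ x -> z \in D :\ a :\ x ->
       v |> tperm y z = v \/
       (v - (v |> tperm a x)) |> tperm y z = v - (v |> tperm a x)) ->
  v |> tperm a x = v.
Proof.
move=> nH cD pP oP p4 q0 vH aD xD ax hv; have [sH _] := nH.
apply/eqP; rewrite eq_sym -subr_eq0; apply/eqP.
apply: (nofix_edge nH cD pP oP p4 q0 _ aD xD ax).
- by rewrite submxB // (stab_tperm sH).
- move=> y z yE zE; case: (hv y z yE zE) => // E.
  move: yE zE; rewrite !inE => /and3P[yx ya _] /and3P[zx za _].
  by rewrite actvB actv_ttC 1?eq_sym // E.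
- by rewrite actvB actv_tt opprB.
Qed.

Lemma invar_mixed A B D v : D \subset A :|: B -> invar A v -> invar B v ->
    (forall a b, a \in A -> b \in B -> v |> tperm a b = v) ->
  invar D v.
Proof.
move=> /subsetP sD iA iB iAB a b /sD + /sD; rewrite !inE.
case/orP=> ha /orP[] hb; [exact: iA|exact: iAB|rewrite tpermC; exact: iAB|].
exact: iB.
Qed.

Lemma nofix_hyper D p q H Q1 A v : nofix D p q H -> #|D| = (p + q)%N ->
    prime p -> odd p -> (4 < p)%N -> (0 < q)%N -> (v <= H)%MS ->
    Q1 \subset D -> #|Q1| = q -> invar Q1 v ->
    A \subset D :\: Q1 -> (2 < #|A|)%N -> invar A v ->
  hyper (D :\: Q1) v.
Proof.
move=> nH cD pP oP p4 q0 vH sQD cQ iQ sA A2 iA.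
have cP := cardDsub cD sQD cQ; have bP := nofix_bad nH cD q0 sQD cQ.
apply: (hyper_invar3 _ _ _ bP _ sA A2 iA); rewrite ?cP //; first exact: ltnW.
by rewrite sub_capmx vH; apply/invspaceP.
Qed.

(** For q = 1 the fixed point [z] may be placed anywhere; off [x], [y], [a], [b] it makes [v] of
    type [hyper] on a set containing these four. *)
Lemma nofix_point1 D p H v x y : nofix D p 1 H -> #|D| = (p + 1)%N ->
    prime p -> odd p -> (4 < p)%N -> (v <= H)%MS -> x \in D -> y \in D ->
    x != y -> invar (D :\ y :\ x) v ->
  v = 0.
Proof.
move=> nH cD pP oP p4 vH xD yD xy iv.
have key a : a \in D :\ y :\ x -> v |> tperm x a = v.
  rewrite !inE => /and3P[ax ay aD].
  have xa : x != a by rewrite eq_sym.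
  have main b : b \in D :\ y :\ x -> b != a ->
      (v - (v |> tperm x a)) |> tperm y b = v - (v |> tperm x a).
    rewrite !inE => /and3P[bx by' bD] ba.
    have [z zD zN] : exists2 z, z \in D & z \notin b |: [set x; y; a].
      apply: exists_notin; rewrite cD.
      apply: leq_ltn_trans (_ : 4 < _)%N; last by clear -p4; lia.
      rewrite cardsU1; apply: leq_trans (leq_add (leq_b1 _) (cards3_le _ _ _)) _.
      by [].
    move: zN; rewrite !inE !negb_or -!andbA => /and4P[zb zx zy za].
    have hv : hyper (D :\: [set z]) v.
      apply: (nofix_hyper nH cD pP oP p4 _ vH (A := D :\ y :\ x :\ z)) => //.
      - by rewrite sub1set.
      - by rewrite cards1.
      - by move=> ? ? /set1P-> /set1P->; rewrite tperm1 actv1.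
      - by apply: setSD; apply: subset_trans (subD1set _ _) (subD1set _ _).
      - move: cD; rewrite (cardsD1 y) yD (cardsD1 x) !inE xy xD.
        rewrite (cardsD1 z (D :\ y :\ x)) !inE zx zy zD; clear -p4; lia.
      - by apply: invarS iv; apply: subD1set.
    apply: hv; rewrite ?inE ?xD ?aD ?yD ?bD ?andbT 1?eq_sym //.
    by rewrite /= !inE !negb_or xa xy [x == b]eq_sym bx ay [a == b]eq_sym ba [y == b]eq_sym by'.
  apply: (nofix_tperm nH) => // z t.
  rewrite !inE => /and3P[za zx zD] /and3P[ta tx tD].
  have [->|zy] := eqVneq z y.
    have [->|ty] := eqVneq t y; first by left; rewrite tperm1 actv1.
    by right; apply: main => //; rewrite !inE tx ty.
  have [->|ty] := eqVneq t y.
    by right; rewrite [tperm z y]tpermC; apply: main => //; rewrite !inE zx zy.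
  by left; apply: iv; rewrite !inE ?zx ?tx ?zy ?ty.
have iy : invar (D :\: [set y]) v.
  apply: (@invar_mixed [set x] (D :\ y :\ x)) => //.
  - by rewrite setD1K // !inE xy.
  - by move=> ? ? /set1P-> /set1P->; rewrite tperm1 actv1.
  - by move=> _ a /set1P-> /key.
apply: (nofix_invar nH cD (prime_gt0 pP) _ _ (cards1 y) vH iy) => //.
  by rewrite sub1set.
by move=> ? ? /set1P-> /set1P->; rewrite tperm1 actv1.
Qed.

(** A q-cycle support [Q1] chosen among the other points leaves [Q], with its at least three
    invariant points, inside the complement of [Q1]; there [v] is [hyper], and [nofix_tperm] absorbs
    [x] into [Q]. *)
Lemma nofix_point D p q H Q v x : nofix D p q H -> #|D| = (p + q)%N ->
    prime p -> odd p -> (4 < p)%N -> (2 < q)%N -> (q + 2 <= p)%N ->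
    (v <= H)%MS -> Q \subset D -> #|Q| = q -> x \in D :\: Q ->
    invar Q v -> invar (D :\: Q :\ x) v ->
  invar (x |: Q) v /\ invar (D :\: (x |: Q)) v.
Proof.
move=> nH cD pP oP p4 q2 qp vH sQD cQ xDQ iQ iP.
have q0 : (0 < q)%N by apply: leq_trans q2.
have cP : #|D :\: Q| = p by apply: cardDsub cQ.
have [xD xQ] : x \in D /\ x \notin Q by move: xDQ; rewrite inE => /andP[].
split; last first.
  by apply: invarS iP; rewrite setDDl setUC.
apply: (@invar_mixed [set x] Q) => //.
  by move=> ? ? /set1P-> /set1P->; rewrite tperm1 actv1.
move=> _ a /set1P-> aQ.
have aD : a \in D by apply: (subsetP sQD).
have ax : a != x by apply: contraNneq xQ => <-.
have main c b : c \in Q -> c != a -> b \in D :\: Q :\ x ->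
    (v - (v |> tperm a x)) |> tperm c b = v - (v |> tperm a x).
  move=> cQ' ca bP.
  have [|Q1 sQ1 cQ1] := @subset_card_ex _ (D :\: Q :\ x :\ b) q.
    move: cP; rewrite (cardsD1 x) xDQ (cardsD1 b) bP; clear -qp; lia.
  have sQ1' : Q1 \subset D :\: Q :\ x by apply: subset_trans sQ1 (subD1set _ _).
  have sQ1D : Q1 \subset D.
    by apply: subset_trans sQ1' _; apply: subset_trans (subD1set _ _) (subsetDl _ _).
  have notQ1 y : y \notin D :\: Q :\ x :\ b -> y \notin Q1.
    by apply: contraNN; apply: (subsetP sQ1).
  have sQ : Q \subset D :\: Q1.
    apply/subsetP=> y yQ; rewrite inE (subsetP sQD) // andbT notQ1 //.
    by rewrite !inE yQ !andbF.
  have hv := nofix_hyper nH cD pP oP p4 q0 vH sQ1D cQ1 (invarS sQ1' iP) sQ.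
  move: bP; rewrite !inE => /and3P[bx bQ bD].
  apply: hv; rewrite ?cQ //.
  - exact: (subsetP sQ).
  - by rewrite inE xD notQ1 // !inE eqxx andbF.
  - exact: (subsetP sQ).
  - by rewrite inE bD notQ1 // !inE eqxx.
  rewrite /= !inE !negb_or ax [a == c]eq_sym ca.
  have -> : a != b by apply: contraNneq bQ => <-.
  have -> : x != c by apply: contraNneq xQ => ->.
  rewrite [x == b]eq_sym bx.
  by have -> : c != b by apply: contraNneq bQ => <-.
rewrite tpermC; apply: (nofix_tperm nH) => // y z.
rewrite !inE => /and3P[yx ya yD] /and3P[zx za zD].
case yQ: (y \in Q); case zQ: (z \in Q).
- by left; apply: iQ.
- by right; apply: main; rewrite // !inE zx zQ.
- by right; rewrite [tperm y z]tpermC; apply: main; rewrite // !inE yx yQ.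
- by left; apply: iP; rewrite !inE ?yx ?zx ?yQ ?zQ.
Qed.

(* v has two-row shape (p - 1, q + 1). *)
Lemma nofix_tworow D p q H R v : nofix D p q H -> #|D| = (p + q)%N ->
    prime p -> odd p -> (4 < p)%N -> (2 < q)%N -> (q + 4 <= p)%N ->
    (v <= H)%MS -> R \subset D -> #|R| = q.+1 -> invar R v -> invar (D :\: R) v ->
  v = 0.
Proof.
move=> nH cD pP oP p4 q2 qp vH sRD cR iR iP.
have q0 : (0 < q)%N by apply: leq_trans q2.
have cP : #|D :\: R| = p.-1 by rewrite cardsD (setIidPr sRD) cD cR; clear -p4; lia.
apply: (nofix_invarD nH cD (prime_gt0 pP) q0 vH).
apply: (@invar_mixed R (D :\: R)) => //.
  by apply/subsetP=> z zD; rewrite !inE zD andbT orbN.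
move=> a b aR bP.
have aD : a \in D by apply: (subsetP sRD).
have [bD bR] : b \in D /\ b \notin R by move: bP; rewrite inE => /andP[].
have ab : a != b by apply: contraNneq bR => <-.
have main y z : y \in R -> y != a -> z \in D :\: R -> z != b ->
    (v - (v |> tperm a b)) |> tperm y z = v - (v |> tperm a b).
  move=> yR ya zP zb.
  have zPb : z \in D :\: R :\ b by rewrite in_setD1 zb.
  (* This set has p - 3 elements: there is room for [Q1] when q + 4 <= p, but not for twin
     primes. *)
  have [|Q1 sQ1 cQ1] := @subset_card_ex _ (D :\: R :\ b :\ z) q.
    move: cP; rewrite (cardsD1 b) bP (cardsD1 z) zPb; clear -qp; lia.
  have sQ1' : Q1 \subset D :\: R.
    by apply: subset_trans sQ1 _; apply: subset_trans (subD1set _ _) (subD1set _ _).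
  have sQ1D : Q1 \subset D by apply: subset_trans sQ1' (subsetDl _ _).
  have notQ1 u : u \notin D :\: R :\ b :\ z -> u \notin Q1.
    by apply: contraNN; apply: (subsetP sQ1).
  have sR : R \subset D :\: Q1.
    apply/subsetP=> u uR; rewrite inE (subsetP sRD) // andbT notQ1 //.
    by rewrite !inE uR !andbF.
  have hv := nofix_hyper nH cD pP oP p4 q0 vH sQ1D cQ1 (invarS sQ1' iP) sR.
  move: zP; rewrite !inE => /andP[zR zD].
  apply: hv; rewrite ?cR //.
  - exact: leqW.
  - exact: (subsetP sR).
  - by rewrite inE bD notQ1 // !inE eqxx andbF.
  - exact: (subsetP sR).
  - by rewrite inE zD notQ1 // !inE eqxx.
  rewrite /= !inE !negb_or ab [a == y]eq_sym ya.
  have -> : a != z by apply: contraNneq zR => <-.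
  have -> : b != y by apply: contraNneq bR => ->.
  rewrite [b == z]eq_sym zb.
  by have -> : y != z by apply: contraNneq zR => <-.
apply: (nofix_tperm nH) => // y z.
rewrite !inE => /and3P[yb ya yD] /and3P[zb za zD].
case yR: (y \in R); case zR: (z \in R).
- by left; apply: iR.
- by right; apply: main; rewrite // !inE zR.
- by right; rewrite [tperm y z]tpermC; apply: main; rewrite // !inE yR.
- by left; apply: iP; rewrite !inE ?yR ?zR.
Qed.

End Pair.

(** * Two-row shapes for twin primes p = q + 2 *)

Section Twin.

Variables (T : finType) (d : nat).
Variable rG : mx_representation algC [set: {perm T}]%G d.

Local Notation "v |> s" := (actv rG v s) (at level 45, left associativity).
Local Notation invar := (invar rG).
Local Notation stab := (stab rG).
Local Notation bad := (bad rG).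
Local Notation invspace := (invspace rG).
Local Notation hyper := (hyper rG).
Local Notation nofix := (nofix rG).

Implicit Types (v w x : 'rV[algC]_d) (s t g h : {perm T}) (a b c y z : T).
Implicit Types (A B D P Q R : {set T}) (H U : 'M[algC]_d) (p q : nat).
Implicit Types (u : T * T) (l : seq (T * T)).

Definition tau v u := v - (v |> tperm u.1 u.2).
(** A partial column antisymmetrizer: the product of the 1 - (a b) over the pairs in [l]. *)
Definition taus l v := foldr (fun u w => tau w u) v l.

Lemma tauD v w u : tau (v + w) u = tau v u + tau w u.
Proof. by rewrite /tau actvD; vring. Qed.

Lemma tau0 u : tau 0 u = 0.
Proof. by rewrite /tau actv0 subrr. Qed.

Lemma tausD l v w : taus l (v + w) = taus l v + taus l w.
Proof. by elim: l => //= u l ->; rewrite tauD. Qed.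

Lemma taus0 l : taus l 0 = 0.
Proof. by elim: l => //= u l ->; rewrite tau0. Qed.

Lemma taus_sum l (I : Type) (r : seq I) (F : pred I) (f : I -> 'rV_d) :
  taus l (\sum_(i <- r | F i) f i) = \sum_(i <- r | F i) taus l (f i).
Proof. by apply: (big_morph (taus l) (tausD l) (taus0 l)). Qed.

Definition fixpair s u := (s u.1 == u.1) && (s u.2 == u.2).

Lemma tau_act v u s : fixpair s u -> tau (v |> s) u = tau v u |> s.
Proof.
by case/andP=> /eqP s1 /eqP s2; rewrite /tau actvB [in RHS]actv_tpermJ s1 s2.
Qed.

Lemma taus_act l v s : all (fixpair s) l -> taus l (v |> s) = taus l v |> s.
Proof. by elim: l => //= u l IH /andP[su /IH ->]; rewrite tau_act. Qed.

Lemma invar_tau A v u : u.1 \notin A -> u.2 \notin A -> invar A v ->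
  invar A (tau v u).
Proof. by move=> n1 n2 iv; apply: invarB => //; apply: invar_actD. Qed.

Section PairsAcross.

Variables (D R : {set T}).

Definition across l := [&& uniq (unzip1 l), all (mem R) (unzip1 l),
  uniq (unzip2 l) & all (mem (D :\: R)) (unzip2 l)].

Lemma across_cons u l : across (u :: l) =
  [&& u.1 \in R, u.2 \in D :\: R, u.1 \notin unzip1 l, u.2 \notin unzip2 l
    & across l].
Proof.
rewrite /across /=; move: (u.1 \in R) (u.2 \in D :\: R) (u.1 \notin _)
  (u.2 \notin _) (uniq _) (uniq _) (all _ _) (all _ _).
by do 8!case.
Qed.

Lemma across_fix a b l : a \in R -> b \in D :\: R -> a \notin unzip1 l ->
  b \notin unzip2 l -> across l -> all (fixpair (tperm a b)) l.
Proof.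
move=> aR bR al bl /and4P[_ /allP R1 _ /allP R2]; apply/allP=> -[c e] cel.
have c1 : c \in unzip1 l by apply: (map_f fst cel).
have e2 : e \in unzip2 l by apply: (map_f snd cel).
have cR := R1 c c1; have eR := R2 e e2; rewrite /= !inE in cR eR bR.
case/andP: bR => bR _; case/andP: eR => eR _.
rewrite /fixpair /= !tpermD ?eqxx //.
- by apply: contraNneq eR => <-.
- by apply: contraNneq bl => ->.
- by apply: contraNneq al => ->.
- by apply: contraNneq bR => ->.
Qed.

Lemma taus_fixed0 l u v : across l -> u \in l -> v |> tperm u.1 u.2 = v ->
  taus l v = 0.
Proof.
elim: l => // u' l IH; rewrite across_cons => /and5P[u1 u2 n1 n2 acl].
rewrite inE => /predU1P[->|ul] vu /=; last by rewrite IH ?tau0.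
by rewrite /tau -taus_act ?vu ?subrr //; apply: across_fix.
Qed.

End PairsAcross.

(** Put the first two pairs into [Q] and the last two into its complement [P]. Applying the last two
    factors produces a space that is bad for [Q], since q is prime as well; there the image of [v]
    is [hyper], so the first two factors kill it. *)
Lemma twin_four D q H R v l : nofix D q.+2 q H -> #|D| = (q.+2 + q)%N ->
    prime q.+2 -> prime q -> odd q -> (4 < q)%N -> (v <= H)%MS -> R \subset D ->
    invar R v -> invar (D :\: R) v -> across D R l -> size l = 4 ->
  taus l v = 0.
Proof.
move=> nH cD pP qP oq q4 vH sRD iR iP.
case: l => // -[a1 b1] [] // [a2 b2] [] // [a3 b3] [] // [a4 b4] [] // acl _.
have [sH _] := nH.
have [/= aR bD] : all (mem R) [:: a1; a2; a3; a4] /\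
    all (mem (D :\: R)) [:: b1; b2; b3; b4].
  by case/and4P: acl.
case/and5P: aR => a1R a2R a3R a4R _.
move: bD; rewrite !inE => /and5P[] /andP[b1R b1D] /andP[b2R b2D].
move=> /andP[b3R b3D] /andP[b4R b4D] _.
have nab y z : y \in R -> z \notin R -> y != z.
  by move=> yR; apply: contraNneq => <-.
have nba y z : y \notin R -> z \in R -> y != z.
  by move=> yR zR; rewrite eq_sym nab.
have U : uniq [:: a1; b1; a2; b2; a3; b3; a4; b4].
  have /and4P[/= ua _ ub _] := acl.
  move: ua ub; rewrite !inE !negb_or.
  case/and4P=> /and3P[e12 e13 e14] /andP[e23 e24] e34 _.
  case/and4P=> /and3P[f12 f13 f14] /andP[f23 f24] f34 _.
  rewrite e12 e13 e14 e23 e24 e34 f12 f13 f14 f23 f24 f34.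
  by rewrite !(nab a1) // !(nab a2) // !(nab a3) // !(nab a4) // !(nba b1) //
    !(nba b2) // !(nba b3).
pose s1 := [:: a1; b1; a2; b2]; pose s2 := [:: a3; b3; a4; b4].
have [us1 us12 us2] : [/\ uniq s1, ~~ has (mem s1) s2 & uniq s2].
  by apply/and3P; rewrite -cat_uniq; apply: U.
have sD8 : [set y in s1 ++ s2] \subset D.
  have /allP aD : all (fun y => y \in D) (s1 ++ s2).
    by rewrite /= b1D b2D b3D b4D !(subsetP sRD).
  by apply/subsetP=> y; rewrite inE => /aD.
have [|C sC cC] := @subset_card_ex _ (D :\: [set y in s1 ++ s2]) (q - 4).
  by rewrite cardsD (setIidPr sD8) cD cardsE (card_uniqP (U : uniq (s1 ++ s2))) /=; clear -q4; lia.
have CD y : y \in C -> [/\ y \in D, y \notin s1 & y \notin s2].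
  by move/(subsetP sC); rewrite in_setD in_set mem_cat negb_or => /andP[/andP[]].
pose Q := [set y in s1] :|: C.
have sQD : Q \subset D.
  apply/subsetP=> y; rewrite in_setU in_set => /orP[yE|/CD[]//].
  by apply: (subsetP sD8); rewrite in_set mem_cat yE.
have cQ : #|Q| = q.
  rewrite cardsU disjoint_setI0 ?cards0 ?subn0.
    by rewrite cC cardsE (card_uniqP us1) /=; clear -q4; lia.
  rewrite -setI_eq0; apply/eqP/setP=> y; rewrite in_setI in_set in_set0; apply/negP=> /andP[ys1].
  by case/CD; rewrite ys1.
pose P := D :\: Q; have cP : #|P| = q.+2 by apply: cardDsub cQ.
have s1Q y : y \in s1 -> y \in Q by move=> ys; rewrite in_setU in_set ys.
have s2P y : y \in s2 -> y \in P.
  move=> ys; rewrite in_setD in_setU in_set negb_or; apply/andP; split; last first.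
    by apply: (subsetP sD8); rewrite in_set mem_cat ys orbT.
  apply/andP; split; first by apply: contraNN us12 => ys1; apply/hasP; exists y.
  by apply/negP=> /CD[_ _]; rewrite ys.
have PQ y : y \in P -> y \notin Q by rewrite inE => /andP[].
pose H1 := (H :&: invspace (R :&: P) :&: invspace (P :\: R))%MS.
have H1P (y : 'rV_d) : (y <= H1)%MS <-> [/\ (y <= H)%MS, invar (R :&: P) y & invar (P :\: R) y].
  rewrite /H1 !sub_capmx -andbA.
  split=> [/and3P[h1 /invspaceP h2 /invspaceP h3] //|].
  by case=> h1 /invspaceP h2 /invspaceP h3; apply/and3P.
pose B := (1%:M - rG (tperm a4 b4)) *m (1%:M - rG (tperm a3 b3)).
have BE (y : 'rV_d) : y *m B = tau (tau y (a4, b4)) (a3, b3).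
  by rewrite /tau /= actv.unlock mulmxA !mulmxBr !mulmx1.
pose M := H1 *m B.
have MP x : (x <= M)%MS -> exists2 y : 'rV_d, (y <= H1)%MS & x = tau (tau y (a4, b4)) (a3, b3).
  case/submxP=> X ->; exists (X *m H1); first exact: submxMl.
  by rewrite -BE mulmxA.
have MI (y : 'rV_d) : (y <= H1)%MS -> (tau (tau y (a4, b4)) (a3, b3) <= M)%MS.
  by move=> yH; rewrite -BE submxMr.
have fixQ s u : perm_on Q s -> u.1 \in P -> u.2 \in P -> fixpair s u.
  by move=> sQ u1 u2; rewrite /fixpair !(out_perm sQ) ?PQ ?eqxx.
have [a3P b3P a4P b4P] : [/\ a3 \in P, b3 \in P, a4 \in P & b4 \in P].
  by split; apply: s2P; rewrite !inE eqxx ?orbT.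
have [a1Q b1Q a2Q b2Q] : [/\ a1 \in Q, b1 \in Q, a2 \in Q & b2 \in Q].
  by split; apply: s1Q; rewrite !inE eqxx ?orbT.
have dPQ : [disjoint P & Q] by rewrite disjoints_subset subsetDr.
have sH1 : stab Q H1.
  apply: stab_cap; first (apply: stab_cap; first exact: stabS sH).
    by apply: stab_invspace; apply: disjointWl dPQ; apply: subsetIr.
  by apply: stab_invspace; apply: disjointWl dPQ; apply: subsetDl.
have tau_s (y : 'rV_d) s : perm_on Q s ->
    tau (tau (y |> s) (a4, b4)) (a3, b3) = tau (tau y (a4, b4)) (a3, b3) |> s.
  by move=> sQ; rewrite !tau_act ?fixQ.
(* Among five points, three lie on the same side of [R], where the vectors at hand are invariant. *)
have three (X : {set T}) : (4 < #|X|)%N -> (2 < #|R :&: X|)%N \/ (2 < #|X :\: R|)%N.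
  rewrite -(cardsID R X) [X :&: R]setIC => X4.
  have [h|h] := ltnP 2 #|R :&: X|; [by left|right].
  by move: X4 h; clear; lia.
have sDR : P :\: R \subset D :\: R by apply: setSD; apply: subsetDl.
have bM : bad Q M.
  split; first apply: stabP => x s /MP[y yH ->] sQ.
    by rewrite -tau_s //; apply: MI; apply: stab_act sH1 sQ yH.
  move=> h x ch /MP[y yH xE] xh.
  have hQ := cycle_on_perm ch.
  (* Averaging over [h] moves [y] into the bad space of vectors fixed by [h]. There [y'] is [hyper]
     on [P], so the two factors kill it; but they also send it to q x. *)
  pose y' := \sum_(i < q) (y |> (h ^+ i)%g).
  have y'H : (y' <= H1)%MS.
    by apply: summx_sub => i _; apply: stab_act sH1 (perm_onX i hQ) yH.
  have y'h : y' |> h = y'.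
    apply: actv_powsum; rewrite -cQ; apply: cycle_on_expg_card => //.
    by rewrite -card_gt0 cQ prime_gt0.
  have [y'HH i1 i2] := (H1P y').1 y'H.
  have bP := nofix_bad_fix nH cD sQD cQ ch; rewrite -/P in bP.
  have y'L : (y' <= H :&: fixspace rG h)%MS by rewrite sub_capmx y'HH; apply/fixspaceP.
  have hy' : hyper P y'.
    have P3 : (3 < #|P|)%N by rewrite cP; clear -q4; lia.
    have P4 : (4 < #|P|)%N by rewrite cP; clear -q4; lia.
    have pP' : prime #|P| by rewrite cP.
    have oP' : odd #|P| by rewrite cP /= oq.
    case: (three P P4) => h2.
      by apply: (hyper_invar3 pP' oP' P3 bP y'L _ h2 i1); apply: subsetIr.
    by apply: (hyper_invar3 pP' oP' P3 bP y'L _ h2 i2); apply: subsetDl.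
  have E : tau (tau y' (a4, b4)) (a3, b3) = q%:R *: x.
    have -> : q%:R *: x = \sum_(i < q) (x |> (h ^+ i)%g).
      rewrite scaler_nat -[q in LHS]card_ord -sumr_const; apply: eq_bigr => i _.
      elim: {i}(i : nat) => [|i IH]; first by rewrite expg0 actv1.
      by rewrite expgS -actvM xh.
    have -> : tau (tau y' (a4, b4)) (a3, b3) = taus [:: (a3, b3); (a4, b4)] y' by [].
    rewrite taus_sum; apply: eq_bigr => i _.
    by rewrite /= tau_s ?xE //; apply: perm_onX.
  have : tau (tau y' (a4, b4)) (a3, b3) = 0.
    rewrite {1}/tau /=; apply/eqP; rewrite subr_eq0; apply/eqP/esym.
    apply: hy' => //; move: us2; rewrite /= !inE !negb_or.
    by case/and4P=> /and3P[e1 e2 e3] /andP[e4 e5] e6 _;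
      rewrite e6 ![a4 == _]eq_sym ![b4 == _]eq_sym e1 e2 e3 e4 e5.
  rewrite E => /eqP; rewrite scaler_eq0 pnatr_eq0 eqn0Ngt prime_gt0 //=.
  by move/eqP.
have vH1 : (v <= H1)%MS.
  by apply/H1P; split=> //; [apply: invarS iR; apply: subsetIl|apply: invarS iP].
pose x := tau (tau v (a4, b4)) (a3, b3).
have xM : (x <= M)%MS by apply: MI.
have notQ (X : {set T}) y : X \subset Q -> y \in P -> y \notin X.
  by move=> sX /PQ; apply: contraNN; apply: (subsetP sX).
have ix (X : {set T}) : X \subset Q -> invar X v -> invar X x.
  by move=> sX iX; do 2 (apply: invar_tau; rewrite ?(notQ X) //).
have hx : hyper Q x.
  have q3 : (3 < #|Q|)%N by rewrite cQ; clear -q4; lia.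
  have pQ' : prime #|Q| by rewrite cQ.
  have oQ' : odd #|Q| by rewrite cQ.
  have Q4 : (4 < #|Q|)%N by rewrite cQ.
  case: (three Q Q4) => h2.
    apply: (hyper_invar3 pQ' oQ' q3 bM xM (subsetIr R Q) h2).
    by apply: ix; [apply: subsetIr|apply: invarS iR; apply: subsetIl].
  apply: (hyper_invar3 pQ' oQ' q3 bM xM (subsetDl Q R) h2).
  by apply: ix; [apply: subsetDl|apply: invarS iP; apply: setSD].
rewrite /= -/x {1}/tau /=; apply/eqP; rewrite subr_eq0; apply/eqP/esym.
apply: hx => //; move: us1; rewrite /= !inE !negb_or.
by case/and4P=> /and3P[e1 e2 e3] /andP[e4 e5] e6 _;
  rewrite e6 ![a2 == _]eq_sym ![b2 == _]eq_sym e1 e2 e3 e4 e5.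
Qed.

(* Removing one factor: average the relation  v + \sum_(b notin R) v (b z) = 0  *)
(* for a point z of R off l.                                                  *)
Lemma taus_descent D p q H R v l : nofix D p q H -> #|D| = (p + q)%N ->
    (0 < p)%N -> (0 < q)%N -> (v <= H)%MS -> R \subset D -> #|R| = q.+1 ->
    invar R v -> invar (D :\: R) v -> across D R l -> (size l <= q)%N ->
    (forall u, across D R (u :: l) -> taus (u :: l) v = 0) ->
  taus l v = 0.
Proof.
move=> nH cD p0 q0 vH sRD cR iR iP acl sl ext; have [sH _] := nH.
have [uA /allP AR uB /allP BR] := and4P acl.
have [z zR zA] : exists2 z, z \in R & z \notin [set a in unzip1 l].
  apply: exists_notin; rewrite cardsE (card_uniqP uA) size_map cR.
  by rewrite ltnS.
rewrite inE in zA; have zD : z \in D by apply: (subsetP sRD).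
have zP : z \notin D :\: R by rewrite inE zR.
have rel : v + \sum_(b in D :\: R) (v |> tperm b z) = 0.
  apply: (nofix_invar (Q := R :\ z) nH cD p0 q0) => //.
  - by apply: subset_trans (subD1set _ _) sRD.
  - by move: cR; rewrite (cardsD1 z) zR => -[].
  - rewrite addmx_sub // summx_sub // => b; rewrite inE => /andP[_ bD].
    exact: stab_tperm sH _ _ _.
  - have -> : D :\: (R :\ z) = z |: (D :\: R).
      apply/setP=> y; rewrite !inE negb_and negbK.
      by have [->|//] := eqVneq y z.
    exact: invar_symm.
  apply: invarD; first by apply: invarS iR; apply: subD1set.
  apply: invar_sum => b; rewrite inE => /andP[bR _].
  apply: invar_actD; rewrite ?inE ?eqxx // ?(negPf bR) ?andbF //.
  by apply: invarS iR; apply: subD1set.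
have := congr1 (taus l) rel; rewrite taus0 tausD taus_sum.
set w := taus l v.
rewrite (bigID (mem (unzip2 l))) /= big1 ?add0r; last first.
  move=> b /andP[_ /mapP[u ul bE]].
  apply: (taus_fixed0 acl ul); rewrite -bE [tperm u.1 b]tpermC.
  have u1R : u.1 \in R by apply: AR; apply: map_f.
  have bR : b \notin R.
    have : b \in D :\: R by apply: BR; rewrite bE; apply: map_f.
    by rewrite inE => /andP[].
  rewrite actv_tt_l; first by rewrite iR.
  - by apply: contraNneq bR => ->.
  - by apply: contraNneq bR => ->.
  - by apply: contraNneq zA => ->; apply: map_f.
rewrite (eq_bigr (fun=> w)) => [|b /andP[bP bB]]; last first.
  rewrite [tperm b z]tpermC taus_act; last exact: (across_fix zR bP zA bB acl).
  have := ext (z, b); rewrite across_cons /= zR bP zA bB acl => /(_ isT)/eqP.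
  by rewrite /tau subr_eq0 => /eqP <-.
rewrite sumr_const -mulrS => /eqP; rewrite -scaler_nat scaler_eq0 pnatr_eq0.
by move=> /eqP.
Qed.

Lemma twin_tworow D q H R v : nofix D q.+2 q H -> #|D| = (q.+2 + q)%N ->
    prime q.+2 -> prime q -> odd q -> (4 < q)%N -> (v <= H)%MS -> R \subset D ->
    #|R| = q.+1 -> invar R v -> invar (D :\: R) v ->
  v = 0.
Proof.
move=> nH cD pP qP oq q4 vH sRD cR iR iP.
have q0 : (0 < q)%N by apply: prime_gt0.
suff H4 k l : (k <= 4)%N -> across D R l -> size l = (4 - k)%N -> taus l v = 0.
  exact: (H4 4 [::]).
elim: k l => [|k IH] l k4 acl sl.
  exact: (twin_four nH cD pP qP oq q4 vH sRD iR iP acl).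
apply: (taus_descent nH cD _ q0 vH sRD cR iR iP acl) => //.
  by rewrite sl; apply: leq_trans (leq_subr _ _) _; apply: ltnW.
move=> u acu; apply: IH => //; first exact: ltnW.
by rewrite /= sl; clear -k4; lia.
Qed.

End Twin.

(** Either p exceeds q by at least 4, or the two are twin primes with q at least 5; the pair (5,3)
    is left out. *)
Definition okpair p q : bool :=
  [&& prime p, odd p, (4 < p)%N, (q == 1)%N || prime q && odd q
    & (q + 4 <= p)%N || (p == q.+2) && (4 < q)%N].

Lemma okpair_odd p q : okpair p q -> odd q.
Proof. by case/and5P=> _ _ _ /orP[/eqP->|/andP[]]. Qed.

Lemma okpair_le p q : okpair p q -> (q + 2 <= p)%N.
Proof. by case/and5P=> _ _ _ _ /orP[|/andP[/eqP->]]; lia. Qed.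

Section PairTheorem.

Variables (T : finType) (d : nat).
Variable rG : mx_representation algC [set: {perm T}]%G d.

Local Notation "v |> s" := (actv rG v s) (at level 45, left associativity).
Local Notation invar := (invar rG).
Local Notation alter := (alter rG).
Local Notation nofix := (nofix rG).

Implicit Types (v w : 'rV[algC]_d) (s t g h : {perm T}) (a b c x y z : T).
Implicit Types (A B D P Q R : {set T}) (H U : 'M[algC]_d) (p q : nat).

Lemma nofix_case1 D p q H Q v x : nofix D p q H -> #|D| = (p + q)%N ->
    okpair p q -> (v <= H)%MS -> Q \subset D -> #|Q| = q -> x \in D :\: Q ->
    invar Q v -> invar (D :\: Q :\ x) v ->
  v = 0.
Proof.
move=> nH cD ok vH sQD cQ xDQ iQ iP.
have [pP oP p4 hq hpq] := and5P ok; have qp := okpair_le ok.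
have [xQ xD] : x \notin Q /\ x \in D by move: xDQ; rewrite inE => /andP[].
case/orP: hq => [/eqP q1|/andP[qP oq]].
  have /cards1P[y yE] : #|Q| == 1%N by rewrite cQ q1.
  rewrite q1 in nH cD; rewrite yE in iP xQ sQD.
  apply: (nofix_point1 nH cD pP oP p4 vH xD _ _ iP).
    by rewrite sub1set in sQD.
  by rewrite inE in xQ.
have q2 : (2 < q)%N by move: (prime_gt1 qP) oq; case: (q) => [|[|[]]].
have [iR iDR] := nofix_point nH cD pP oP p4 q2 qp vH sQD cQ xDQ iQ iP.
have sR : x |: Q \subset D by rewrite subUset sub1set xD.
have cR : #|x |: Q| = q.+1 by rewrite cardsU1 xQ cQ.
case/orP: hpq => [q4|/andP[/eqP pE q4]].
  exact: (nofix_tworow nH cD pP oP p4 q2 q4 vH sR cR iR iDR).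
rewrite pE in nH cD pP.
exact: (twin_tworow nH cD pP qP oq q4 vH sR cR iR iDR).
Qed.

(** [nofix_case1] removes the shape (p - 1, 1) from the invariants of [Q], so only its sign twist is
    left. *)
Lemma nofix_hyper_sgn D p q H Q v : nofix D p q H -> #|D| = (p + q)%N ->
    okpair p q -> (v <= H)%MS -> Q \subset D -> #|Q| = q -> invar Q v ->
  hyper (sgn_repr rG) (D :\: Q) v.
Proof.
move=> nH cD ok vH sQD cQ iQ; have [pP oP p4 _ _] := and5P ok.
have cP := cardDsub cD sQD cQ.
have q0 : (0 < q)%N by rewrite odd_gt0 ?(okpair_odd ok).
apply: (bad_hyper_sgn _ _ (nofix_bad nH cD q0 sQD cQ)); rewrite ?cP //.
  move=> w x; rewrite sub_capmx => /andP[wH /invspaceP iw] xP iPw.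
  exact: (nofix_case1 nH cD ok wH sQD cQ xP iw iPw).
by rewrite sub_capmx vH; apply/invspaceP.
Qed.

(** Double counting. Moving one point between the blocks of size q + 1 gives blocks of odd sizes p
    and q, on which alternating vectors are fixed by full cycles. So the sum of the v (x b) is v for
    each [x] in [A] and -v for each [b] in the other block. *)
Lemma nofix_invar_alter D p q H A v : nofix D p q H -> #|D| = (p + q)%N ->
    odd p -> odd q -> p = q.+2 -> (v <= H)%MS -> A \subset D ->
    #|A| = q.+1 -> invar A v -> alter (D :\: A) v -> v = 0.
Proof.
move=> nH cD oP oQ pE vH sAD cA iA aB; have [sH _] := nH.
have p0 : (0 < p)%N by rewrite odd_gt0.
have q0 : (0 < q)%N by rewrite odd_gt0.
set B := D :\: A in aB.
have cB : #|B| = q.+1 by rewrite /B cardsD (setIidPr sAD) cD cA pE; lia.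
have AD a : a \in A -> a \in D by apply: (subsetP sAD).
have BD b : b \in B -> b \in D by rewrite inE => /andP[].
have AB a b : a \in A -> b \in B -> a != b.
  by move=> aA; rewrite inE => /andP[bA _]; apply: contraNneq bA => <-.
have alter_cyc (X : {set T}) g w : odd #|X| -> cycle_on X g -> alter X w -> w |> g = w.
  move=> oX cg aw; rewrite (alter_perm aw (cycle_on_perm cg)).
  rewrite (odd_cycle_on _ cg) ?oX ?expr0 ?scale1r //.
  by apply: contraTneq oX => ->; rewrite cards0.
have S1 x : x \in A -> \sum_(b in B) (v |> tperm b x) = v.
  move=> xA; apply/eqP; rewrite eq_sym -subr_eq0; apply/eqP.
  have E : D :\: (A :\ x) = x |: B.
    apply/setP=> y; rewrite !inE negb_and negbK.
    by have [->|//] := eqVneq y x; rewrite AD.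
  have xB : x \notin B by rewrite inE xA.
  apply: (nofix_fixed nH cD p0 q0 (Q := A :\ x)).
  - by apply: subset_trans (subD1set _ _) sAD.
  - by move: cA; rewrite (cardsD1 x) xA => -[].
  - by rewrite submxB // summx_sub // => b bB; apply: (stab_tperm sH); auto.
  - move=> g; rewrite E => cg; apply: alter_cyc cg _; last exact: alter_antisymm.
    by rewrite cardsU1 xB cB add1n /= negbK.
  - move=> h /cycle_on_perm; apply: invar_perm; apply: invarB.
      by apply: invarS iA; apply: subD1set.
    apply: invar_sum => b bB; apply: invar_actD.
    + by rewrite !inE; move: bB; rewrite inE => /andP[/negPf->]; rewrite andbF.
    + by rewrite !inE eqxx.
    + by apply: invarS iA; apply: subD1set.
have S2 b : b \in B -> \sum_(x in A) (v |> tperm x b) = - v.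
  move=> bB; apply/eqP; rewrite -addr_eq0 addrC; apply/eqP.
  have bA : b \notin A by move: bB; rewrite inE => /andP[].
  have E : D :\: (B :\ b) = b |: A.
    apply/setP=> y; rewrite !inE negb_and negbK.
    have [->|/= _] := eqVneq y b; first by rewrite BD.
    rewrite negb_and negbK; case yD: (y \in D); rewrite ?andbT ?orbF ?andbF //.
    by apply/esym/negbTE; apply: contraFN yD; apply: AD.
  apply: (nofix_fixed nH cD p0 q0 (Q := B :\ b)).
  - by apply: subset_trans (subD1set _ _) (subsetDl _ _).
  - by move: cB; rewrite (cardsD1 b) bB => -[].
  - by rewrite addmx_sub // summx_sub // => x xA; apply: (stab_tperm sH); auto.
  - move=> g; rewrite E => /cycle_on_perm; apply: invar_perm.
    exact: invar_symm.
  - move=> h ch; apply: alter_cyc ch _.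
      by move: cB; rewrite (cardsD1 b) bB add1n => -[->].
    apply: alterD; first by apply: alterS aB; apply: subD1set.
    apply: alter_sum => x xA; apply: alter_actD.
    + by rewrite !inE xA andbF.
    + by rewrite !inE eqxx.
    + by apply: alterS aB; apply: subD1set.
have : \sum_(x in A) \sum_(b in B) (v |> tperm b x)
       = \sum_(b in B) \sum_(x in A) (v |> tperm x b).
  rewrite exchange_big /=; apply: eq_bigr => b _; apply: eq_bigr => x _.
  by rewrite tpermC.
rewrite (eq_bigr _ S1) (eq_bigr _ S2) !sumr_const cA cB mulNrn => /eqP.
rewrite -addr_eq0 -mulrnDr -scaler_nat scaler_eq0 pnatr_eq0.
by move=> /eqP.
Qed.

(** Take [Q] inside [A]. If q + 4 <= p, at least three points of [A] remain and [hyper_sgn_invar3]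
    applies. For twin primes just one remains; letting it vary shows that [v] alternates off [A]. *)
Lemma nofix_subfull D p q H A v : nofix D p q H -> #|D| = (p + q)%N ->
    okpair p q -> (v <= H)%MS -> A \subset D -> #|A| = p.-1 -> invar A v ->
  v = 0.
Proof.
move=> nH cD ok vH sAD cA iA; have [pP oP p4 hq hpq] := and5P ok.
have oq := okpair_odd ok; have qp := okpair_le ok; have [sH _] := nH.
case/orP: hpq => [q4|/andP[/eqP pE q4]].
  have [|Q sQA cQ] := @subset_card_ex _ A q; first by rewrite cA; clear -q4; lia.
  have sQD := subset_trans sQA sAD.
  have hv := nofix_hyper_sgn nH cD ok vH sQD cQ (invarS sQA iA).
  apply: (hyper_sgn_invar3 _ _ _ hv (invarS (subsetDl A Q) iA)).
  - by rewrite (cardDsub cD sQD cQ) ltnW.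
  - exact: setSD.
  - by rewrite cardsD (setIidPr sQA) cA cQ; clear -q4; lia.
apply: (nofix_invar_alter nH cD oP oq pE vH sAD _ iA); first by rewrite cA pE.
set B := D :\: A.
have cB : #|B| = q.+1 by rewrite /B cardsD (setIidPr sAD) cD cA pE; clear; lia.
move=> b b2 bB b2B bb2; apply/eqP; rewrite -addr_eq0 addrC; apply/eqP.
set w := _ + _.
have [b1 b1B b1N] : exists2 b1, b1 \in B & b1 \notin [set b; b2].
  by apply: exists_notin; rewrite cards2 bb2 cB; clear -q4; lia.
have /card_gt1P[x [x' [xA x'A xx']]] : (1 < #|A|)%N.
  by rewrite cA pE; clear -q4; lia.
move: b1N; rewrite !inE negb_or => /andP[b1b b1b2].
have AB a c : a \in A -> c \in B -> a != c.
  by move=> aA; rewrite inE => /andP[cA' _]; apply: contraNneq cA' => <-.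
(* Here [Q] is [A] without [a]. Conjugating these relations makes a transposition inside [A] negate
   [w], which it fixes. *)
have wx a : a \in A -> w |> tperm a b1 = - w.
  move=> aA; have sQA : A :\ a \subset A by apply: subD1set.
  have cQ : #|A :\ a| = q by move: cA; rewrite pE (cardsD1 a) aA => -[].
  have hv := nofix_hyper_sgn nH cD ok vH (subset_trans sQA sAD) cQ (invarS sQA iA).
  have BP c : c \in B -> c \in D :\: (A :\ a).
    by rewrite !inE => /andP[/negPf-> ->]; rewrite andbF.
  apply: (hyper_sgnE hv (BP _ bB) (BP _ b2B) _ (BP _ b1B)).
    by rewrite !inE eqxx (subsetP sAD).
  rewrite /= !inE !negb_or bb2 [b == a]eq_sym [b == b1]eq_sym [b2 == a]eq_sym.
  by rewrite [b2 == b1]eq_sym b1b b1b2 !AB.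
have iw : w |> tperm x' x = w.
  by rewrite /w actvD iA // actv_ttC ?(iA x' x) // eq_sym AB.
have wN : w |> tperm x' x = - w.
  have := actv_tpermJ rG (w |> tperm x b1) x' b1 (tperm x b1).
  rewrite actv_tt tpermR tpermD // 1?eq_sym ?AB // => <-.
  by rewrite wx // actvN wx // opprK wx.
move: wN; rewrite iw => wN.
have two0 : 2%:R != 0 :> algC by rewrite pnatr_eq0.
by apply: (scalerI two0); rewrite scaler0 scaler_nat mulr2n {1}wN addNr.
Qed.

End PairTheorem.

Section PairExists.

Variables (T : finType) (d : nat).

Implicit Types (A B D P Q R : {set T}) (H U : 'M[algC]_d) (p q : nat).
Implicit Types (rG : mx_representation algC [set: {perm T}]%G d).

Lemma nofix_sgn rG D p q H : odd p -> odd q -> nofix rG D p q H ->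
  nofix (sgn_repr rG) D p q H.
Proof.
move=> oP oQ [sH nH]; split; first exact/stab_sgn.
have odd0 (X : {set T}) : odd #|X| -> X != set0.
  by move=> oX; apply: contraTneq oX => ->; rewrite cards0.
move=> Q g h v sQD cP cQ cg ch vH; rewrite !actv_sgn.
rewrite (odd_cycle_on _ cg) ?(odd_cycle_on _ ch) ?odd0 ?cP ?cQ ?oP ?oQ //.
by rewrite expr0 !scale1r; apply: nH cg ch vH.
Qed.

Lemma nofix_false rG D p q H Q h : nofix rG D p q H -> #|D| = (p + q)%N ->
    okpair p q -> Q \subset D -> #|Q| = q -> cycle_on Q h ->
  (H :&: fixspace rG h)%MS = 0.
Proof.
move=> nH cD ok sQD cQ ch; have [pP oP _ _ _] := and5P ok.
have cP := cardDsub cD sQD cQ; apply/eqP/negPn/negP => L0.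
have [||v [x [vL v0 xP hv]]] :=
  bad_type _ _ (nofix_bad_fix nH cD sQD cQ ch) L0; rewrite ?cP //.
have vH : (v <= H)%MS by move: vL; rewrite sub_capmx => /andP[].
have sA : D :\: Q :\ x \subset D.
  by apply: subset_trans (subD1set _ _) (subsetDl _ _).
have cA : #|D :\: Q :\ x| = p.-1 by move: cP; rewrite (cardsD1 x) xP => <-.
case/eqP: v0; case: hv => hv.
  exact: (nofix_subfull nH cD ok vH sA cA hv).
have nH' := nofix_sgn oP (okpair_odd ok) nH.
by apply: (nofix_subfull nH' cD ok vH sA cA); apply/invar_sgn.
Qed.

Definition cycfixed rG D p H := exists P g, [/\ P \subset D, #|P| = p,
  cycle_on P g & (H :&: fixspace rG g)%MS != 0].

Lemma pair_exists rG D p q H : stab rG D H -> #|D| = (p + q)%N ->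
    okpair p q -> cycfixed rG D q H ->
  exists Q g h v, [/\ Q \subset D, #|Q| = q, cycle_on (D :\: Q) g,
    cycle_on Q h & [/\ (v <= H)%MS, v != 0, actv rG v g = v & actv rG v h = v]].
Proof.
move=> sH cD ok [Q0 [h0 [sQ0 cQ0 ch0 L0]]].
pose ok3 (u : {set T} * {perm T} * {perm T}) :=
  [&& u.1.1 \subset D, #|u.1.1| == q, cycle_on (D :\: u.1.1) u.1.2,
      cycle_on u.1.1 u.2
    & (H :&: (fixspace rG u.1.2 :&: fixspace rG u.2))%MS != 0].
case: (pickP ok3) => [[[Q g] h] /and5P[/= sQ /eqP cQ cg ch /rowV0Pn[v]]|none].
  rewrite !sub_capmx => /and3P[vH /fixspaceP vg /fixspaceP vh] v0.
  by exists Q, g, h, v.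
have nH : nofix rG D p q H.
  split=> // Q g h v sQ _ cQ cg ch vH vg vh; apply/eqP/negPn/negP => v0.
  have /negP[] := none (Q, g, h); rewrite /ok3 /= sQ cQ eqxx cg ch /=.
  apply/rowV0Pn; exists v => //; rewrite !sub_capmx vH /=.
  by apply/andP; split; apply/fixspaceP.
by rewrite (nofix_false nH cD ok sQ0 cQ0 ch0) eqxx in L0.
Qed.

Lemma cycfixed1 rG D H : D != set0 -> H != 0 -> cycfixed rG D 1 H.
Proof.
move=> /set0Pn[y yD] H0; exists [set y], 1%g.
rewrite sub1set cards1 cycle_on1; split=> //.
rewrite /fixspace repr_mx1 subrr; apply: contraNneq H0 => E.
rewrite -submx0 -E sub_capmx submx_refl.
by apply/sub_kermxP; rewrite mulmx0.
Qed.

(** The case q = 1 of [pair_exists], on p + 1 points. *)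
Lemma cycfixed_ge5 rG D p H : stab rG D H -> H != 0 -> prime p -> odd p ->
  (4 < p)%N -> (p < #|D|)%N -> cycfixed rG D p H.
Proof.
move=> sH H0 pP oP p4 pD.
have [D' sD' cD'] := subset_card_ex pD.
have ok : okpair p 1 by rewrite /okpair pP oP p4.
have c1 : cycfixed rG D' 1 H by apply: cycfixed1; rewrite // -card_gt0 cD'.
have cD1 : #|D'| = (p + 1)%N by rewrite cD' addn1.
have [Q [g [h [v [sQ cQ cg _ [vH v0 vg _]]]]]] :=
  pair_exists (stabS sD' sH) cD1 ok c1.
exists (D' :\: Q), g; split=> //.
- by apply: subset_trans (subsetDl _ _) sD'.
- exact: cardDsub cD1 sQ cQ.
- by apply/rowV0Pn; exists v => //; rewrite sub_capmx vH; apply/fixspaceP.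
Qed.

(* Without fixed vectors of 3-cycles, (a b) + (a c) + (b c) = 0 for all       *)
(* triples, which forces (a b) = (c e) for disjoint transpositions.           *)
Lemma cycfixed3 rG D H : stab rG D H -> H != 0 -> (4 < #|D|)%N ->
  cycfixed rG D 3 H.
Proof.
move=> sH H0 D4.
pose ok2 (u : {set T} * {perm T}) := [&& u.1 \subset D, #|u.1| == 3,
  cycle_on u.1 u.2 & (H :&: fixspace rG u.2)%MS != 0].
case: (pickP ok2) => [[P g] /and4P[sP /eqP cP cg L0]|none]; first by exists P, g.
have bad3 P : P \subset D -> #|P| = 3 -> bad rG P H.
  move=> sP cP; split; first exact: stabS sH.
  move=> g v cg vH vg; apply/eqP/negPn/negP => v0.
  have /negP[] := none (P, g); rewrite /ok2 /= sP cP eqxx cg /=.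
  by apply/rowV0Pn; exists v => //; rewrite sub_capmx vH; apply/fixspaceP.
have tri a b c v : a \in D -> b \in D -> c \in D -> uniq [:: a; b; c] ->
    (v <= H)%MS ->
    actv rG v (tperm a b) + actv rG v (tperm a c) + actv rG v (tperm b c) = 0.
  move=> aD bD cD; rewrite /= !inE !negb_or => /and3P[/andP[ab ac] bc _] vH.
  have a0 : [set a] != set0 by apply/set0Pn; exists a; rewrite set11.
  have ba : b \notin [set a] by rewrite inE eq_sym.
  have cab : c \notin b |: [set a] by rewrite !inE negb_or ![c == _]eq_sym bc ac.
  pose P := c |: (b |: [set a]).
  have cP : #|P| = 3 by rewrite /P !cardsU1 cab ba cards1.
  have sP : P \subset D by rewrite !subUset !sub1set aD bD cD.
  have := Ksum_bad _ (bad3 P sP cP) vH.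
  rewrite cP scale1r => /(_ isT); rewrite /P Ksum_setU1 //; last first.
    by apply/set0Pn; exists b; rewrite setU11.
  rewrite Ksum_setU1 // Ksum_inv //; last first.
    by move=> ? ? /set1P-> /set1P->; rewrite tperm1 actv1.
  rewrite cards1 scale1r /Jsum big_set1 big_setU1 //= big_set1 => E.
  have := actv_tt rG (actv rG v (tperm b c) + actv rG v (tperm a c)) a b.
  by rewrite E actvN => EE; rewrite -addrA [X in _ + X]addrC -EE subrr.
have dis a b c e v : a \in D -> b \in D -> c \in D -> e \in D ->
    uniq [:: a; b; c; e] -> (v <= H)%MS ->
    actv rG v (tperm a b) = actv rG v (tperm c e).
  move=> aD bD cD eD; rewrite /= !inE !negb_or -!andbA.
  case/and3P=> ab ac /and3P[ae bc] /and3P[be ce _] vH.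
  have t1 : uniq [:: a; b; c] by rewrite /= !inE !negb_or ab ac bc.
  have t2 : uniq [:: a; b; e] by rewrite /= !inE !negb_or ab ae be.
  have t3 : uniq [:: a; c; e] by rewrite /= !inE !negb_or ac ae ce.
  have t4 : uniq [:: b; c; e] by rewrite /= !inE !negb_or bc be ce.
  have E1 := tri a b c v aD bD cD t1 vH; have E2 := tri a b e v aD bD eD t2 vH.
  have E3 := tri a c e v aD cD eD t3 vH; have E4 := tri b c e v bD cD eD t4 vH.
  have two0 : 2%:R != 0 :> algC by rewrite pnatr_eq0.
  apply: (scalerI two0); apply/eqP; rewrite -subr_eq0; apply/eqP.
  (* The relations for abc and abe minus those for ace and bce leave 2 (a b) - 2 (c e). *)
  transitivity (0 + 0 - 0 - 0 : 'rV[algC]_d); last by rewrite !subr0 addr0.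
  by rewrite -{1}E1 -{1}E2 -{1}E3 -E4; vring.
have /rowV0Pn[v vH v0] := H0.
have /card_gt2P[a [b [c [[aD bD cD] [ab bc ca]]]]] : (2 < #|D|)%N.
  by apply: leq_trans D4.
have [e eD] : exists2 e, e \in D & e \notin [set a; b; c].
  apply: exists_notin; apply: leq_ltn_trans (cards3_le _ _ _) _.
  by apply: leq_trans D4.
rewrite !inE !negb_or -andbA => /and3P[ea eb ec].
have [f fD] : exists2 f, f \in D & f \notin e |: [set a; b; c].
  apply: exists_notin; apply: leq_ltn_trans D4; rewrite cardsU1.
  exact: leq_add (leq_b1 _) (cards3_le _ _ _).
rewrite !inE !negb_or -!andbA => /and4P[fe fa fb fc].
have [ac be ae ce] : [/\ a != c, b != e, a != e & c != e] by rewrite ![_ == e]eq_sym [a == c]eq_sym.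
have [af bf cf ef] : [/\ a != f, b != f, c != f & e != f] by rewrite ![_ == f]eq_sym.
case/eqP: v0.
have ab_ef : actv rG v (tperm a b) = actv rG v (tperm e f).
  by apply: dis; rewrite //= !inE !negb_or ab ae af be bf ef.
have ac_ef : actv rG v (tperm a c) = actv rG v (tperm e f).
  by apply: dis; rewrite //= !inE !negb_or ac ae af ce cf ef.
have bc_ef : actv rG v (tperm b c) = actv rG v (tperm e f).
  by apply: dis; rewrite //= !inE !negb_or bc be bf ce cf ef.
have : uniq [:: a; b; c] by rewrite /= !inE !negb_or ab ac bc.
move/(tri a b c v aD bD cD)/(_ vH); rewrite ab_ef ac_ef bc_ef => E.
apply/eqP; rewrite -(actv_eq0 rG v (tperm e f)); apply/eqP.
have three0 : 3%:R != 0 :> algC by rewrite pnatr_eq0.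
by apply: (scalerI three0); rewrite scaler0 scaler_nat -[RHS]E; vring.
Qed.

End PairExists.

(** * Occurrence in conjugacy classes *)

Lemma part_ok_cases p : part_ok p -> p = 1%N \/ p = 3 \/
  [/\ prime p, odd p & (4 < p)%N].
Proof.
case/orP=> [/eqP|/andP[]]; first by left.
by case: p => [|[|[|[|[|p]]]]] // pP oP; right; [left|right].
Qed.

Lemma parts_ok_pair la : parts_ok la -> size la = 2 ->
  exists p q, perm_eq la [:: p; q] /\ okpair p q.
Proof.
case: la => // a [] // b [] // /and5P[u ok _ n31 n53] _.
have swap (x y : nat) : perm_eq [:: x; y] [:: y; x] by rewrite (perm_catC [:: x] [:: y]).
wlog ltab : a b u ok n31 n53 / (b < a)%N.
  move=> H; move: (u); rewrite /= inE andbT neq_ltn => /orP[|] lt.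
    have [||||p [q [E pq]]] := H b a _ _ _ _ lt.
    - by move: u; rewrite /= !inE eq_sym.
    - by move: ok; rewrite /= !andbT andbC.
    - by apply: contraNN n31 => E; exact: perm_trans (swap a b) E.
    - by apply: contraNN n53 => E; exact: perm_trans (swap a b) E.
    by exists p, q; split=> //; apply: perm_trans (swap a b) E.
  exact: H.
exists a, b; split=> //; move: ok; rewrite /= andbT => /andP[oka okb].
case: (part_ok_cases oka) => [a1|[a3|[pa oa a4]]].
- by move: okb; rewrite a1 ltnS leqn0 in ltab; rewrite (eqP ltab).
- move: okb ltab n31; rewrite a3 => /part_ok_cases[->|[->|[_ _ b4]]] //.
  by move/(ltn_trans b4).
rewrite /okpair pa oa a4 -/(part_ok b) okb.
case: (part_ok_cases okb) => [->|[b3|[pb ob b4]]]; first by rewrite a4.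
  rewrite b3 in ltab n53 *; rewrite andbF orbF; case: (ltngtP 6 a) => // [|aE].
    case: a a4 oa n53 {u n31 oka pa ltab} => [|[|[|[|[|[|[|a]]]]]]] //.
  by rewrite -aE in oa.
rewrite b4 andbT; case: (ltngtP a b.+1) ltab => // lt _.
  case: (ltngtP a b.+2) => //; last by rewrite orbT.
  - by clear -lt; lia.
  move=> lt2; rewrite orbF addnC; case: (ltngtP a b.+3) => // aE.
    by clear -aE lt2; lia.
  by move: oa; rewrite aE /= negbK ob.
by move: oa; rewrite lt /= ob.
Qed.

(** * Induction on the number of cycles *)

Section ListInduction.

Variables (T : finType) (d : nat).
Variable rG : mx_representation algC [set: {perm T}]%G d.

Implicit Types (v w : 'rV[algC]_d) (s t g h : {perm T}) (a b c x y z : T).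
Implicit Types (A B D P Q R : {set T}) (H U : 'M[algC]_d) (p q : nat).
Implicit Types (la : seq nat).

Fixpoint cycfix la D v : Prop :=
  if la is p :: la' then
    exists P g, [/\ P \subset D, #|P| = p, cycle_on P g, actv rG v g = v
                  & cycfix la' (D :\: P) v]
  else D = set0.

Lemma cycfixed_part D p H : stab rG D H -> H != 0 -> part_ok p ->
  (p < #|D|)%N -> (4 < #|D|)%N -> cycfixed rG D p H.
Proof.
move=> sH H0 okp pD D4; case: (part_ok_cases okp) => [->|[->|[pP oP p4]]].
- by apply: cycfixed1 => //; rewrite -card_gt0; apply: leq_trans D4.
- exact: cycfixed3.
exact: cycfixed_ge5.
Qed.

Lemma cycfix_pair D p q H : stab rG D H -> H != 0 -> okpair p q ->
    #|D| = (p + q)%N ->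
  exists v, [/\ (v <= H)%MS, v != 0 & cycfix [:: p; q] D v].
Proof.
move=> sH H0 ok cD; have [pP oP p4 hq _] := and5P ok.
have qp := okpair_le ok.
have cq : cycfixed rG D q H.
  apply: cycfixed_part => //; rewrite cD; first by rewrite -[X in (X < _)%N]add0n ltn_add2r prime_gt0.
  exact: ltn_addr.
have [Q [g [h [v [sQ cQ cg ch [vH v0 vg vh]]]]]] := pair_exists sH cD ok cq.
exists v; split=> //; exists (D :\: Q), g; split=> //; first exact: subsetDl.
  exact: cardDsub cQ.
have DQ : D :\: (D :\: Q) = Q by rewrite setDDr setDv set0U (setIidPr sQ).
by rewrite DQ; exists Q, h; split=> //; rewrite setDv.
Qed.

Lemma cycfix_exists la D H : parts_ok la -> #|D| = sumn la -> stab rG D H ->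
    H != 0 ->
  exists v la', [/\ (v <= H)%MS, v != 0, perm_eq la la' & cycfix la' D v].
Proof.
have [n] := ubnP (size la); elim: n la D H => // n IH la D H len ok cD sH H0.
have [ula okla s1 n31 n53] := and5P ok.
have [s2|s2] := leqP (size la) 2.
  have sE : size la = 2 by apply/eqP; rewrite eqn_leq s2.
  have [p [q [pE pq]]] := parts_ok_pair ok sE.
  have cD2 : #|D| = (p + q)%N.
    by rewrite cD (perm_sumn pE) /= addn0.
  have [v [vH v0 cv]] := cycfix_pair sH H0 pq cD2.
  by exists v, [:: p; q].
(* Splitting off a part 3 first keeps the remainder from becoming (3,1) or (5,3). The remaining
   parts, distinct and different from 3, add up to at least 6, so [cycfixed_part] applies. *)
pose r := if 3 \in la then 3 else head 0%N la.
have rla : r \in la.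
  rewrite /r; case: ifP => //; case: (la) s1 => //= a l _ _.
  by rewrite inE eqxx.
pose la0 := rem r la.
have pla : perm_eq la (r :: la0) by apply: perm_to_rem.
have n3 : 3 \notin la0.
  rewrite /la0 mem_rem_uniq // inE negb_and negbK /r.
  by case: ifP => _; rewrite ?eqxx ?orbT.
have s0 : size la0 = (size la).-1 by rewrite size_rem.
have ok0 : parts_ok la0.
  apply/and5P; split.
  - exact: rem_uniq.
  - by apply/allP=> x /mem_rem/(allP okla).
  - by rewrite s0; case: (size la) s2 => [|[|[|]]].
  - by apply: contraNN n3 => /perm_mem->.
  - by apply: contraNN n3 => /perm_mem->.
have cD0 : #|D| = (r + sumn la0)%N by rewrite cD (perm_sumn pla).
have okr : part_ok r by apply: (allP okla).
have big0 : (5 < sumn la0)%N.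
  move: ok0 n3 => /and5P[u0 /allP ok0 s0' _ _] n3.
  case: la0 u0 ok0 s0' n3 {pla s0 cD0} => // a [] // b l; rewrite /= !inE !negb_or.
  case/andP=> /andP[ab _] _ ok0 _ /and3P[a3 b3 _].
  have oka : part_ok a by apply: ok0; rewrite inE eqxx.
  have okb : part_ok b by apply: ok0; rewrite !inE eqxx orbT.
  case: (part_ok_cases oka) (part_ok_cases okb) a3 b3 ab.
    move=> -> [->|[->|[_ _ b4]]] // _ _ _; clear -b4; lia.
  case=> [->//|[_ _ a4] _ _ _ _].
  have : (0 < b)%N by case: (b) okb.
  clear -a4; lia.
have [P [g [sP cP cg /rowV0Pn L0]]] : cycfixed rG D r H.
  by apply: cycfixed_part => //; rewrite cD0; clear -big0; lia.
set L := (H :&: fixspace rG g)%MS in L0.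
have sL : stab rG (D :\: P) L.
  apply: stab_cap; first exact: stabS (subsetDl _ _) sH.
  apply: (stab_fixspace _ (cycle_on_perm cg)).
  by rewrite disjoints_subset subsetDr.
have cDP : #|D :\: P| = sumn la0.
  by rewrite cardsD (setIidPr sP) cD0 cP addKn.
have [||v [la' [vL v0 pe cv]]] := IH la0 (D :\: P) L _ ok0 cDP sL.
- by rewrite s0; case: (size la) s1 len.
- exact/rowV0Pn.
move: vL; rewrite sub_capmx => /andP[vH /fixspaceP vg].
exists v, (r :: la'); split=> //; last by exists P, g.
by apply: perm_trans pla _; rewrite perm_cons.
Qed.

End ListInduction.

(** * From fixed cycles to the centralizer *)

Section Centralizer.

Local Open Scope nat_scope.

Variables (T : finType) (d : nat).
Variable rG : mx_representation algC [set: {perm T}]%G d.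

Implicit Types (v w : 'rV[algC]_d) (s t g h c : {perm T}) (x y z : T).
Implicit Types (D P : {set T}) (la : seq nat).

(** [c] is the factor of [g] through [x] in its decomposition into disjoint cycles. *)
Definition orbit_fixed g v x := exists c, [/\ cycle_on (porbit g x) c,
  actv rG v c = v & {in porbit g x, c =1 g}].

Lemma cycfix_perm la D v : uniq la -> 0 \notin la -> cycfix rG la D v ->
  exists g, [/\ perm_on D g, {in D, forall x, #|porbit g x| \in la},
    forall k, k \in la -> exists2 x, x \in D & #|porbit g x| = k,
    {in D &, forall x y, #|porbit g x| = #|porbit g y| -> porbit g x = porbit g y}
    & {in D, forall x, orbit_fixed g v x}].
Proof.
elim: la D => [|p la IH] D.
  by move=> _ _ ->; exists 1%g; split=> // [||? ?|?]; rewrite ?perm_on1 ?inE // => x;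
    rewrite inE.
rewrite /= inE negb_or eq_sym -lt0n => /andP[pla ula] /andP[p0 nla].
case=> P [c [sP cP cc vc /(IH _ ula nla)[g [gD g1 g2 g3 g4]]]].
have cperm := cycle_on_perm cc.
have gP x : x \in P -> g x = x.
  by move=> xP; apply: (out_perm gD); rewrite inE xP.
have cD x : x \notin P -> c x = x by apply: out_perm.
pose G := (c * g)%g.
have GP x : x \in P -> G x = c x.
  by move=> xP; rewrite permM gP // perm_closed.
have GD x : x \notin P -> G x = g x by move=> xP; rewrite permM cD.
have orbP x : x \in P -> porbit G x = P.
  move=> xP; rewrite -[RHS](cycle_on_porbit cc xP); apply/esym/eq_in_porbit.
  by move=> y; rewrite (cycle_on_porbit cc xP) => /GP.
have orbsub x : x \in D :\: P -> porbit g x \subset D :\: P by apply: porbit_sub.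
have orbD x : x \in D :\: P -> porbit G x = porbit g x.
  move=> xD; apply/esym/eq_in_porbit => y /(subsetP (orbsub x xD)).
  by rewrite inE => /andP[/GD].
have DP x : x \in D -> x \in P \/ x \in D :\: P.
  by move=> xD; rewrite inE xD andbT; case: (x \in P); [left|right].
have nP x : x \in D :\: P -> p <> #|porbit g x|.
  by move=> /g1 h pE; move: pla; rewrite pE h.
exists G; split.
- by apply: perm_onM; [apply: perm_onS cperm|apply: perm_onS gD; apply: subsetDl].
- move=> x /DP[xP|xD]; rewrite inE; first by rewrite orbP // cP eqxx.
  by rewrite orbD // g1 ?orbT.
- move=> k; rewrite inE => /predU1P[->|/g2[x xD xk]].
    have /set0Pn[x xP] : P != set0 by rewrite -card_gt0 cP.
    by exists x; rewrite ?(subsetP sP) // orbP.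
  by exists x; rewrite ?orbD //; move: xD; rewrite inE => /andP[].
- move=> x y /DP[xP|xD] /DP[yP|yD].
  + by rewrite !orbP.
  + by rewrite orbP // orbD // cP => /nP-/(_ yD).
  + by rewrite orbD // orbP // cP => /esym /nP-/(_ xD).
  + by rewrite !orbD //; apply: g3.
- move=> x /DP[xP|xD].
    by exists c; rewrite orbP //; split=> // y /GP.
  have [e [ce ve eE]] := g4 x xD; exists e; rewrite orbD //; split=> // y yo.
  rewrite eE //; have := subsetP (orbsub x xD) y yo.
  by rewrite inE => /andP[/GD].
Qed.

(* A permutation commuting with g preserves each orbit of g, as the orbits    *)
(* have distinct sizes, and acts on it as a power of g.                       *)
Lemma cent_fixed g v h :
    (forall x y, #|porbit g x| = #|porbit g y| -> porbit g x = porbit g y) ->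
    (forall x, orbit_fixed g v x) -> commute g h ->
  actv rG v h = v.
Proof.
move=> inj fx; have [k] := ubnP #|[set x | h x != x]|.
elim: k h => // k IH h; rewrite ltnS => lek gh.
have [E|/set0Pn[x]] := eqVneq [set x | h x != x] set0.
  have -> : h = 1%g; last exact: actv1.
  apply/permP=> x; rewrite perm1; apply/eqP/negPn/negP => hx.
  by have := in_set0 x; rewrite -E inE hx.
rewrite inE => hx; have [c [cc vc cE]] := fx x.
have hg y i : h ((g ^+ i)%g y) = (g ^+ i)%g (h y).
  by rewrite -!permM (commuteX i (commute_sym gh)).
have horb y : h @: porbit g y = porbit g (h y).
  apply/setP=> z; apply/imsetP/porbitP => [[_ /porbitP[i ->] ->]|[i ->]].
    by exists i; rewrite hg.
  by exists ((g ^+ i)%g y); rewrite ?mem_porbit // hg.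
have hx_orb : h x \in porbit g x.
  rewrite -eq_porbit_mem; apply/eqP; apply: inj.
  by rewrite -horb card_imset //; apply: perm_inj.
case/porbitP: hx_orb => i hxi.
have cX j y : y \in porbit g x -> (c ^+ j)%g y = (g ^+ j)%g y.
  move=> yx; elim: j => [|j IHj]; first by rewrite !expg0.
  rewrite !expgSr !permM IHj cE //.
  by rewrite -eq_porbit_mem porbit_perm eq_porbit_mem.
have gO y : (g y \in porbit g x) = (y \in porbit g x).
  by rewrite -!eq_porbit_mem; have := porbit_perm g 1 y; rewrite expg1 => ->.
have cO y : y \notin porbit g x -> c y = y by apply: out_perm (cycle_on_perm cc).
have gc : commute g c.
  apply/permP=> y; rewrite !permM; have [yO|yO] := boolP (y \in porbit g x).
    by rewrite !cE ?gO.
  by rewrite !cO ?gO.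
have hO y : y \in porbit g x -> h y = (c ^+ i)%g y.
  move=> yO; rewrite (cX i y yO); case/porbitP: yO => j ->.
  by rewrite hg hxi -!permM -!expgD addnC.
have h_O y : (h y \in porbit g x) = (y \in porbit g x).
  apply/idP/idP => [|yO]; last first.
    by rewrite (hO y yO) (perm_closed _ (perm_onX i (cycle_on_perm cc))).
  have Oh : h @: porbit g x = porbit g x by rewrite horb hxi porbit_perm.
  by rewrite -{1}Oh => /imsetP[z zO /perm_inj->].
pose h' := (h * c ^- i)%g.
have h'O y : y \in porbit g x -> h' y = y.
  by move=> yO; rewrite permM hO // permK.
have h'D y : y \notin porbit g x -> h' y = h y.
  move=> yO; rewrite permM (out_perm (perm_onV (perm_onX i (cycle_on_perm cc)))) //.
  by rewrite h_O.
have vci j : actv rG v (c ^+ j)%g = v.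
  by elim: j => [|j IHj]; rewrite ?expg0 ?actv1 // expgS -actvM vc.
have -> : h = (h' * c ^+ i)%g by rewrite /h' mulgKV.
rewrite -actvM IH //; last by apply: commuteM => //; apply: commuteV; apply: commuteX.
apply: leq_trans lek; apply: proper_card; apply/properP; split.
  apply/subsetP=> y; rewrite !inE; have [yO|yO] := boolP (y \in porbit g x).
    by rewrite h'O ?eqxx.
  by rewrite h'D.
by exists x; rewrite inE ?hx // h'O ?porbit_id ?eqxx.
Qed.

End Centralizer.

Lemma mxtrace_idempotent (F : fieldType) n (E : 'M[F]_n) :
  E *m E = E -> \tr E = (\rank E)%:R.
Proof.
move=> EE.
move: (col_base E) (row_base E) (mulmx_base E) (col_base_full E)
  (row_base_free E) => C B CB fC fB.
have : C *m (B *m C *m B) = C *m (1%:M *m B).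
  by rewrite mul1mx !mulmxA CB -mulmxA CB EE.
move/(row_full_inj fC)/(row_free_inj fB) => BC.
by rewrite -[in LHS]CB mxtrace_mulC BC mxtrace1.
Qed.

Section Occurs.

Variables (gT : finGroupType) (G : {group gT}).

(** The average over [H] is the projector onto the fixed vectors, and the trace of a projector is
    its rank. *)
Lemma sum_repr_neq0 d (rG : mx_representation algC G d) (H : {group gT}) :
    H \subset G ->
  (\sum_(h in H) \tr (rG h) != 0) <->
  (exists2 v : 'rV_d, v != 0 & forall h, h \in H -> v *m rG h = v).
Proof.
move=> sHG; pose E := \sum_(h in H) rG h.
have Eh h : h \in H -> E *m rG h = E.
  move=> hH; rewrite mulmx_suml [RHS](reindex_inj (mulIg h)) /=.
  apply: eq_big => [k|k kH]; first by rewrite groupMr.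
  by rewrite repr_mxM ?(subsetP sHG).
have EE : E *m E = #|H|%:R *: E.
  by rewrite {2}/E mulmx_sumr (eq_bigr _ Eh) sumr_const scaler_nat.
have cH : #|H|%:R != 0 :> algC by rewrite pnatr_eq0 -lt0n cardG_gt0.
have trE : \sum_(h in H) \tr (rG h) = \tr E by rewrite raddf_sum.
rewrite trE; split=> [tr0|[v v0 vh]].
  have /rowV0Pn[v /submxP[D ->] v0] : E != 0.
    by apply: contraNneq tr0 => ->; rewrite mxtrace0.
  by exists (D *m E) => // h hH; rewrite -mulmxA Eh.
have E'E' : (#|H|%:R^-1 *: E) *m (#|H|%:R^-1 *: E) = #|H|%:R^-1 *: E.
  by rewrite -scalemxAl -scalemxAr EE !scalerA -mulrA mulVf // mulr1.
have vE : v *m (#|H|%:R^-1 *: E) = v.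
  rewrite -scalemxAr mulmx_sumr (eq_bigr (fun=> v) vh) sumr_const -scaler_nat.
  by rewrite scalerA mulVf // scale1r.
have := mxtrace_idempotent E'E'; rewrite mxtraceZ => E1.
apply: contraNneq v0 => tr0; move: E1; rewrite tr0 mulr0 => /esym/eqP.
by rewrite pnatr_eq0 mxrank_eq0 => /eqP R0; rewrite -vE R0 mulmx0.
Qed.

Lemma cfRepr_class (C : {set gT}) (clC : C \in classes G) h : h \in G ->
  cfRepr (class_repr clC) h = \sum_(x in C) ((x ^ h)%g == x)%:R.
Proof.
move=> hG; rewrite cfunE hG mulr1n /mxtrace /=.
rewrite (big_enum_val (fun x => ((x ^ h)%g == x)%:R)) /=.
by apply: eq_bigr => i _; rewrite mxE.
Qed.

(** Frobenius reciprocity: exchanging the sums over the class and over [G], each element of the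
    class contributes the conjugate of the character sum over the centralizer of [g]. *)
Lemma occursP (g : gT) (i : Iirr G) (clC : (g ^: G)%g \in classes G) :
    g \in G ->
  occurs_in_class clC i <->
  (exists2 v : 'rV_(irr_degree (socle_of_Iirr i)), v != 0 &
     forall h, h \in 'C_G[g]%g -> v *m 'Chi_i h = v).
Proof.
move=> gG; rewrite -(sum_repr_neq0 'Chi_i (subcent1_sub g G)).
rewrite /occurs_in_class irr_consttE.
pose S x := \sum_(h in G) ((x ^ h)%g == x)%:R * ('chi_i h)^*.
have SJ k : k \in G -> S (g ^ k)%g = S g.
  move=> kG; rewrite /S (reindex_inj (conjg_inj k)) /=.
  apply: eq_big => [h|h hG]; first by rewrite groupJr.
  rewrite groupJr // in hG.
  by rewrite cfunJ // -conjgM -conjgC conjgM (inj_eq (conjg_inj k)).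
have SE : S g = (\sum_(h in 'C_G[g]%g) \tr ('Chi_i h))^*.
  rewrite rmorph_sum /= /S (bigID (mem 'C[g]%g)) /= [X in _ + X]big1 ?addr0.
    apply: eq_big => [h|h /andP[hG /cent1P gh]]; first by rewrite in_setI.
    by rewrite conjgE -gh mulKg eqxx mul1r -irrRepr cfunE hG mulr1n.
  move=> h /andP[hG]; case: eqP => [E|]; last by rewrite mul0r.
  by move/negP; case; apply/cent1P/commute_sym/commgP/conjg_fixP.
have -> : '[cfRepr (class_repr clC), 'chi_i]
    = #|G|%:R^-1 * (#|(g ^: G)%g|%:R * S g).
  rewrite cfdotE; congr (_ * _).
  under eq_bigr => h hG do rewrite cfRepr_class // mulr_suml.
  rewrite exchange_big /= (eq_bigr (fun=> S g)); first by rewrite sumr_const mulr_natl.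
  by move=> _ /imsetP[k kG ->]; rewrite -(SJ k kG).
rewrite !mulf_eq0 invr_eq0 !pnatr_eq0 !eqn0Ngt cardG_gt0 SE fmorph_eq0 /=.
have -> : (0 < #|(g ^: G)%g|)%N by apply/card_gt0P; exists g; apply: class_refl.
by [].
Qed.

End Occurs.

Section Global.

Lemma fixed_of_type n d (rG : mx_representation algC [set: 'S_n]%G d) la :
    (0 < d)%N -> is_partition n la -> parts_ok la ->
  exists (g : 'S_n) (v : 'rV[algC]_d), [/\ cycle_type g = la, v != 0
                & forall h, commute g h -> v *m rG h = v].
Proof.
move=> d0 /and3P[sla nla /eqP sumla] ok; have [ula _ _ _ _] := and5P ok.
have cT : #|[set: 'I_n]| = sumn la by rewrite cardsT card_ord.
have H0 : 1%:M != 0 :> 'M[algC]_d by case: d d0 {rG} => // d _; apply: oner_neq0.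
have sH : stab rG [set: 'I_n] 1%:M by move=> s _; apply: submx1.
have [v [la' [_ v0 pla cv]]] := cycfix_exists ok cT sH H0.
have ula' : uniq la' by rewrite -(perm_uniq pla).
have nla' : 0%N \notin la' by rewrite -(perm_mem pla).
have [g [_ g1 g2 g3 g4]] := cycfix_perm ula' nla' cv.
have inj x y : #|porbit g x| = #|porbit g y| -> porbit g x = porbit g y.
  by apply: g3; rewrite inE.
exists g, v; split=> //.
  apply: cycle_typeE => // [x|k]; first by rewrite (perm_mem pla) g1 ?inE.
  by rewrite (perm_mem pla) => /g2[x _ xk]; exists x.
move=> h gh; have := cent_fixed (v := v) inj _ gh; rewrite actv.unlock; apply.
by move=> x; apply: g4; rewrite inE.
Qed.

Lemma occurs_ext (gT : finGroupType) (G : {group gT}) (C : {set gT})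
    (clC : C \in classes G) (g : gT) (i : Iirr G) :
    C = (g ^: G)%g -> g \in G ->
  occurs_in_class clC i <->
  (exists2 v : 'rV_(irr_degree (socle_of_Iirr i)), v != 0 &
     forall h, h \in 'C_G[g]%g -> v *m 'Chi_i h = v).
Proof. by move=> CE; subst C => gG; apply: occursP. Qed.

(** The permutation found by [fixed_of_type] varies with the representation, but its cycle type,
    hence its class, does not. *)
Lemma global_parts n la : is_partition n la -> parts_ok la ->
  global_class [set: 'S_n]%G (cycle_type_class n la).
Proof.
move=> pla ok; have [sla _ _] := and3P pla; have [ula _ _ _ _] := and5P ok.
have main (i : Iirr [set: 'S_n]%G) := fixed_of_type 'Chi_i (irr_degree_gt0 _) pla ok.
have [g [_ [gla _ _]]] := main 0.
have CE := cycle_type_class_class sla ula gla.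
have clC : cycle_type_class n la \in classes [set: 'S_n]%G.
  by rewrite CE; apply: mem_classes; rewrite inE.
exists clC => i; have [gi [v [gila v0 vfix]]] := main i.
have CEi := cycle_type_class_class sla ula gila.
apply/(occurs_ext clC i CEi); first by rewrite inE.
exists v => // h /setIP[_ /cent1P hg]; exact/vfix/commute_sym.
Qed.

(** A nonzero submodule contains an irreducible one, which has a fixed vector. Allowing any
    submodule makes it unnecessary to identify irreducible constituents. *)
Lemma global_fixed (gT : finGroupType) (G : {group gT}) (g : gT) :
    g \in G -> global_class G (g ^: G)%g ->
  forall d (rG : mx_representation algC G d) (U : 'M_d),
    mxmodule rG U -> U != 0 ->
  exists v : 'rV_d, [/\ v != 0, (v <= U)%MS &
    forall h, h \in 'C_G[g]%g -> v *m rG h = v].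
Proof.
move=> gG [clC glob] d rG U modU U0.
have sCG := subcent1_sub g G.
(* [mxsimple_exists] is only a classical existence statement, so the goal is first put in boolean
   form as a nonzero trace sum. *)
have fixU : \sum_(h in 'C_G[g]%g) \tr (submod_repr modU h) != 0.
  apply: (mxsimple_exists modU U0) => -[M simM MU]; have [modM M0 _] := simM.
  apply/(sum_repr_neq0 _ sCG).
  have /irrP[i Ei] : cfRepr (submod_repr modM) \in irr G.
    by apply/irr_reprP; exists (Representation (submod_repr modM));
      [apply/submod_mx_irr|].
  have [w w0 wC] : exists2 w : 'rV_(\rank M), w != 0 &
      forall h, h \in 'C_G[g]%g -> w *m submod_repr modM h = w.
    apply/(sum_repr_neq0 _ sCG).
    have -> : \sum_(h in 'C_G[g]%g) \tr (submod_repr modM h)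
        = \sum_(h in 'C_G[g]%g) \tr ('Chi_i h).
      apply: eq_bigr => h hC; have hG := subsetP sCG h hC.
      by move/cfunP/(_ h): Ei; rewrite -irrRepr !cfunE hG !mulr1n.
    by apply/(sum_repr_neq0 _ sCG)/(occursP _ clC gG).
  have vU : (val_submod w <= U)%MS := submx_trans (val_submodP w) MU.
  exists (in_submod U (val_submod w)).
    by rewrite -val_submod_eq0 in_submodK // val_submod_eq0.
  move=> h hC; have hG := subsetP sCG h hC.
  by rewrite -in_submodJ // -(val_submodJ modM) // wC.
have [w w0 wC] := (sum_repr_neq0 _ sCG).1 fixU.
exists (val_submod w); split; rewrite ?val_submod_eq0 ?val_submodP //.
by move=> h hC; rewrite -(val_submodJ modU) ?wC // (subsetP sCG).
Qed.

End Global.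

(** * Classes that are not global *)

Section NotGlobal.

(* The space of vectors of coordinate sum zero has no nonzero vector fixed by *)
(* g.                                                                         *)
Lemma trans_not_global (gT : finGroupType) (G : {group gT}) (rT : finType)
    (to : {action gT &-> rT}) (S : {set rT}) (g : gT) :
    [acts G, on S | to] -> (1 < #|S|)%N -> g \in G ->
    {in S &, forall x y, exists i, y = to x (g ^+ i)%g} ->
  ~ global_class G (g ^: G)%g.
Proof.
move=> aS S2 gG tr glob; pose J : 'cV[algC]_#|S| := const_mx 1.
have rJ h : h \in G -> perm_repr aS h *m J = J.
  move=> hG; apply/colP=> i; rewrite !mxE.
  have iS : to (enum_val i) h \in S by rewrite (acts_act aS) ?enum_valP.
  rewrite (bigD1 (enum_rank_in iS (to (enum_val i) h))) //= !mxE.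
  rewrite enum_rankK_in // eqxx mulr1 big1 ?addr0 // => j jn; rewrite !mxE mulr1.
  case: eqP => // E; case/eqP: jn; apply: enum_val_inj.
  by rewrite enum_rankK_in.
have modU : mxmodule (perm_repr aS) (kermx J).
  apply/mxmoduleP=> h hG; apply/sub_kermxP.
  by rewrite -mulmxA rJ // mulmx_ker.
have U0 : kermx J != 0.
  by rewrite -mxrank_eq0 mxrank_ker; have := rank_leq_col J; lia.
have [v [v0 vU vC]] := global_fixed gG glob modU U0.
have vg i : v *m perm_repr aS (g ^+ i)%g = v.
  by apply: vC; rewrite inE groupX //=; apply/cent1P/commute_sym/commuteX.
have vconst i j : v 0 j = v 0 i.
  have [k jk] := tr _ _ (enum_valP i) (enum_valP j).
  rewrite -{1}(vg k) mxE (bigD1 i) //= mxE jk eqxx mulr1 big1 ?addr0 // => l li.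
  rewrite mxE jk; case: eqP => [/act_inj/enum_val_inj E|]; last by rewrite mulr0.
  by rewrite E eqxx in li.
move: vU => /sub_kermxP/matrixP/(_ 0 0); rewrite !mxE.
have iS : (0 < #|S|)%N by apply: ltnW.
rewrite (eq_bigr (fun=> v 0 (Ordinal iS))); last first.
  by move=> j _; rewrite mxE mulr1; apply: vconst.
rewrite sumr_const card_ord -mulr_natr => /eqP.
rewrite mulf_eq0 pnatr_eq0 eqn0Ngt iS orbF => /eqP vi0.
case/eqP: v0; apply/rowP=> j; rewrite mxE.
by rewrite (vconst (Ordinal iS)).
Qed.

Section Perm.

Variable T : finType.
Implicit Types (g h : {perm T}) (x y z : T).

Let G := [set: {perm T}]%G.

(** The sign representation is one-dimensional, so a fixed vector of the centralizer forces every
    sign on it to be 1. *)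
Lemma global_even g h : global_class G (g ^: G)%g -> commute g h ->
  odd_perm h = false.
Proof.
move=> glob gh.
have sgnP : mx_repr G (fun s : {perm T} => ((-1) ^+ s)%:M : 'M[algC]_1).
  split=> [|s t _ _]; first by rewrite odd_perm1.
  by rewrite odd_permM signr_addb scalar_mxM.
have gG : g \in G by rewrite inE.
have [|v [v0 _ /(_ h)]] :=
    global_fixed gG glob (mxmodule1 (MxRepresentation sgnP)).
  exact: oner_neq0.
rewrite inE /= inE => vh; case: odd_perm vh => //= vh.
have /eqP : v *m (-1)%:M = v by apply: vh; apply/cent1P/commute_sym.
rewrite mul_mx_scalar scaleN1r eq_sym -subr_eq0 opprK -mulr2n -scaler_nat.
by rewrite scaler_eq0 pnatr_eq0 /= (negPf v0).
Qed.

(** The restriction of [g] to the orbit is a cycle commuting with [g], hence even. *)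
Lemma global_porbit_odd g x : global_class G (g ^: G)%g -> odd #|porbit g x|.
Proof.
move=> glob; pose O := porbit g x.
have gO : g \in ('N(O | 'P))%g.
  apply/astabsP=> y /=; rewrite apermE -!eq_porbit_mem.
  by have := porbit_perm g 1 y; rewrite expg1 => ->.
have gOy y : y \in O -> g y \in O.
  by rewrite /O -!eq_porbit_mem; have := porbit_perm g 1 y; rewrite expg1 => ->.
have cO : cycle_on O (restr_perm O g).
  rewrite /cycle_on restr_perm_on; apply/forall_inP=> y yO; apply/eqP.
  rewrite -[RHS](eqP (_ : porbit g y == O)) ?eq_porbit_mem //.
  apply/esym/eq_in_porbit=> z; have /eqP-> : porbit g y == O by rewrite eq_porbit_mem.
  by move=> zO; rewrite restr_permE.
have O0 : O != set0 by apply/set0Pn; exists x; apply: porbit_id.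
have := global_even glob (commute_sym (restr_perm_commute O g)).
by rewrite (odd_cycle_on O0 cO) => /negbFE.
Qed.

(** Exchanging two orbits of equal length m along [g] commutes with [g] and is a product of m
    disjoint transpositions, hence odd, as m is. *)
Lemma global_porbit_inj g x y : global_class G (g ^: G)%g ->
  #|porbit g x| = #|porbit g y| -> porbit g x = porbit g y.
Proof.
move=> glob cxy; apply/eqP/negPn/negP=> nxy.
have om := global_porbit_odd x glob; set m := #|porbit g x| in om cxy.
pose t i := tperm ((g ^+ i)%g x) ((g ^+ i)%g y).
have nxy_i i j : (g ^+ i)%g x != (g ^+ j)%g y.
  apply: contraNneq nxy => E; rewrite -(porbit_perm g i x) E.
  by rewrite porbit_perm.
have tJ i : (t i ^ g)%g = t i.+1 by rewrite tpermJ -!permM -!expgSr.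
have inj z i j : #|porbit g z| = m -> (i < m)%N -> (j < m)%N ->
    ((g ^+ i)%g z == (g ^+ j)%g z) = (i == j).
  move=> cz im jm; rewrite !permX.
  rewrite -(nth_traject g im) -(nth_traject g jm) nth_uniq ?size_traject //.
  by rewrite -cz uniq_traject_porbit.
have tC i j : (i < m)%N -> (j < m)%N -> commute (t i) (t j).
  move=> im jm; have [->//|ij] := eqVneq i j.
  apply/commute_sym/commgP/conjg_fixP; rewrite tpermJ.
  by rewrite !tpermD // ?inj // ?nxy_i // 1?eq_sym ?nxy_i.
have tm : t m = t 0%N.
  have gm z : #|porbit g z| = m -> (g ^+ m)%g z = z.
    by move=> cz; rewrite permX -cz iter_porbit.
  by rewrite /t !gm // !expg0 !perm1.
have m0 : (0 < m)%N by rewrite lt0n card_porbit_neq0.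
pose s k := (\prod_(i < k) t i)%g.
have os k : odd_perm (s k) = odd k.
  elim: k => [|k IH]; first by rewrite /s big_ord0 odd_perm1.
  by rewrite /s big_ord_recr /= odd_permM -/(s k) IH odd_tperm nxy_i addbT.
have sC : commute (t 0%N) (s m).
  rewrite /s; elim/big_ind: _ => [|a b ca cb|i _]; first exact: commute1.
    exact: commuteM.
  exact: tC.
(* Conjugation by [g] shifts the product to [t] 1, ..., [t] k; for k = m this closes up since [t] m
   is [t] 0. *)
have sJ k : (t 0%N * s k ^ g = s k * t k)%g.
  elim: k => [|k IH]; first by rewrite /s !big_ord0 conj1g mulg1 mul1g.
  by rewrite /s !big_ord_recr /= conjMg mulgA -!/(s k) IH tJ.
have gs : commute g (s m).
  apply/commute_sym/commgP/conjg_fixP; apply: (mulgI (t 0%N)).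
  by rewrite sJ tm sC.
by have := global_even glob gs; rewrite os om.
Qed.

Lemma ncycle_not_global g : (1 < #|T|)%N ->
    (forall x, porbit g x = [set: T]) ->
  ~ global_class G (g ^: G)%g.
Proof.
move=> T2 tr; have aT : [acts G, on [set: T] | 'P].
  by apply/actsP=> h _ x; rewrite !inE.
apply: (trans_not_global aT); rewrite ?inE ?cardsT // => x y _ _.
by apply/porbitP; rewrite tr inE.
Qed.

(** [S] consists of the three fixed-point-free involutions on four points. Such an involution is
    determined by its value at the fixed point [z] of [g], so [g] permutes them cyclically and
    [trans_not_global] applies. *)
Lemma three_cycle_not_global g x z : #|T| = 4 -> g z = z -> #|porbit g x| = 3 ->
  ~ global_class G (g ^: G)%g.
Proof.
move=> T4 gz ox.
pose S := [set k : {perm T} | [forall a, k a != a] && (k * k == 1)%g].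
have SP (k : {perm T}) : reflect ((forall a, k a != a) /\ (forall a, k (k a) = a)) (k \in S).
  rewrite inE; apply: (iffP andP) => -[/forallP nf E]; split=> //.
    by move=> a; rewrite -permM (eqP E) perm1.
  by apply/eqP/permP=> a; rewrite permM perm1.
have zx : z \notin porbit g x.
  rewrite -eq_porbit_mem; apply/eqP=> E; move: ox; rewrite -E.
  by rewrite (@porbit_out _ [set~ z] g z) ?cards1 //;
    [apply/subsetP=> a; rewrite !inE; apply: contraNneq => ->; apply/eqP|rewrite !inE eqxx].
have Tx a : a != z -> a \in porbit g x.
  have : #|z |: porbit g x| = 4 by rewrite cardsU1 zx ox.
  rewrite -T4 -cardsT => /eqP E az.
  have /eqP E' : z |: porbit g x == setT by rewrite eqEcard subsetT (eqP E) leqnn.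
  by have := in_setT a; rewrite -E' !inE (negPf az).
have det (k k' : {perm T}) : k \in S -> k' \in S -> k z = k' z -> k = k'.
  move=> /SP[nf kk] /SP[nf' kk'] E; apply/permP=> c.
  have [->//|cz] := eqVneq c z; have [->|cb] := eqVneq c (k z).
    by rewrite kk E kk'.
  have c3 : #|[set z; k z; c]| = 3.
    by rewrite setUC cardsU1 cards2 !inE (negPf cz) (negPf cb) eq_sym nf.
  have /eqP/cards1P[d dE] : #|~: [set z; k z; c]| = 1%N.
    by have := cardsC [set z; k z; c]; rewrite c3 T4; lia.
  have in_d (h : {perm T}) : (forall a, h a != a) -> (forall a, h (h a) = a) ->
      h z = k z -> h c = d.
    move=> nfh hh hz; apply/set1P; rewrite -dE !inE !negb_or nfh andbT.
    apply/andP; split.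
      by apply: contraNneq cb => hc; rewrite -hz -hc hh.
    by rewrite -hz (inj_eq perm_inj).
  by rewrite (in_d k) // (in_d k').
have aS : [acts G, on S | 'J].
  apply/actsP=> h _ k /=; apply/SP/SP => -[nf kk]; split=> a.
  - by have := nf (h a); rewrite permJ (inj_eq perm_inj).
  - by have := kk (h a); rewrite !permJ => /perm_inj.
  - by rewrite -(permKV h a) permJ (inj_eq perm_inj).
  - by rewrite -(permKV h a) !permJ kk.
apply: (trans_not_global aS); rewrite ?inE //.
  pose k := (tperm z x * tperm (g x) (g (g x)))%g.
  have := uniq_traject_porbit g x; rewrite ox /= !inE negb_or andbT.
  case/andP=> /andP[x1 x2] x12.
  have nz a : a \in porbit g x -> z != a.
    by move=> ao; apply: contraNneq zx => ->.
  have [zx0 zx1 zx2] : [/\ z != x, z != g x & z != g (g x)].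
    by split; apply: nz; rewrite porbit_traject ox !inE eqxx ?orbT.
  have kz : k z = x by rewrite permM tpermL tpermD // eq_sym.
  have kx : k x = z by rewrite permM tpermR tpermD // eq_sym.
  have k1 : k (g x) = g (g x) by rewrite permM (tpermD zx1 x1) tpermL.
  have k2 : k (g (g x)) = g x by rewrite permM (tpermD zx2 x2) tpermR.
  have all4 a : a \in [:: z; x; g x; g (g x)].
    by rewrite inE; case: eqVneq => //= /Tx; rewrite porbit_traject ox.
  have kS : k \in S.
    by apply/SP; split=> a; move: (all4 a); rewrite !inE => /or4P[]/eqP->;
      rewrite ?kz ?kx ?k1 ?k2 ?kz ?kx ?k1 ?k2 // eq_sym.
  apply/card_gt1P; exists k, (k ^ g)%g; rewrite kS -[(k ^ g)%g]/('J%act k g).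
  rewrite (acts_act aS (in_setT g)) kS; split=> //; apply: contraNneq x1 => E.
  by have := permJ k g z; rewrite gz -[(k ^ g)%g]/('J%act k g) -E kz => {1}->.
move=> k k' kS k'S; have /SP[nf kk] := kS; have /SP[nf' kk'] := k'S.
have /eqP E : porbit g (k z) == porbit g (k' z).
  have /eqP-> : porbit g (k z) == porbit g x by rewrite eq_porbit_mem Tx.
  by rewrite eq_sym eq_porbit_mem Tx.
have := porbit_id g (k' z); rewrite -E => /porbitP[i Ei]; exists i.
have giz : (g ^+ i)%g z = z.
  by elim: i {Ei} => [|i IH]; rewrite ?expg0 ?perm1 // expgSr permM IH.
apply: det => //; first by rewrite (acts_act aS (in_setT _)).
by have := permJ k (g ^+ i)%g z; rewrite giz => /= ->.
Qed.

End Perm.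

End NotGlobal.

(* The degrees with a global class *)
Local Close Scope ring_scope.

Lemma porbit_cap0 (T : finType) (g : {perm T}) x y :
  y \notin porbit g x -> porbit g x :&: porbit g y = set0.
Proof.
move=> yx; apply/setP=> a; rewrite !inE; apply/negP=> /andP[].
rewrite -!eq_porbit_mem => /eqP ax /eqP ay.
by case/negP: yx; rewrite -eq_porbit_mem -ay ax.
Qed.

(** The orbit lengths are distinct and odd. One orbit is excluded; two have even total, and 4 could
    only be 3 + 1, also excluded; three or more add up to at least 1 + 3 + 5 = 9. *)
Lemma global_degree n (C : {set 'S_n}) : 1 < n ->
  global_class [set: 'S_n]%G C -> n = 6 \/ 8 <= n.
Proof.
move=> n1 glob; have [clC _] := glob; have [g _ CE] := imsetP clC.
rewrite CE in glob; pose o x := #|porbit g x|.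
have oo x : odd (o x) := global_porbit_odd x glob.
have oN x y : y \notin porbit g x -> o x <> o y.
  move=> yx /(global_porbit_inj glob) E.
  by rewrite E porbit_id in yx.
have o0 x : 0 < o x by rewrite lt0n card_porbit_neq0.
have cn : #|[set: 'I_n]| = n by rewrite cardsT card_ord.
have nT (A : {set 'I_n}) : A != setT -> exists a, a \notin A.
  by rewrite -subTset => /subsetPn[a _ aA]; exists a.
have no31 a b : n = 4 -> o a = 1 -> o b = 3 -> False.
  move=> n4 /eqP/cards1P[c cE] ob.
  have ga : g a = a.
    have := mem_porbit g 1 a; have := porbit_id g a; rewrite cE !inE expg1.
    by move=> /eqP-> /eqP->.
  by apply: (three_cycle_not_global _ ga ob glob); rewrite card_ord.
have [x _] : exists x : 'I_n, true by exists (Ordinal (ltnW n1)).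
have := oo x; have := o0 x.
have [xT|] := eqVneq (porbit g x) setT.
  case: (@ncycle_not_global _ g _ _ glob); rewrite ?card_ord // => y.
  by rewrite -xT; apply/eqP; rewrite eq_porbit_mem xT inE.
case/nT=> y yx.
have := oo y; have := o0 y; have := oN x y yx.
have cU : #|porbit g x :|: porbit g y| = o x + o y.
  by rewrite cardsU porbit_cap0 // cards0 subn0.
have [xyT|xynT] := eqVneq (porbit g x :|: porbit g y) setT.
  rewrite xyT cn in cU; have := no31 x y; have := no31 y x.
  by move: (o x) (o y) cU n1; clear; lia.
have [z] := nT _ xynT; rewrite inE negb_or => /andP[zx zy].
have := oo z; have := o0 z; have := oN x z zx; have := oN y z zy.
have : o x + o y + o z <= n.
  rewrite -cU -[X in _ <= X]cn -[o z]/#|porbit g z|.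
  have D : (porbit g x :|: porbit g y) :&: porbit g z = set0.
    by rewrite setIUl !porbit_cap0 // setU0.
  by rewrite -[_ + _]subn0 -(cards0 'I_n) -D -cardsU subset_leq_card ?subsetT.
clear; lia.
Qed.

(** The excluded types (3,1) and (5,3) have degrees 4 and 8. *)
Lemma parts_okP n la : n = 6 \/ 9 <= n -> is_partition n la -> uniq la ->
    (forall p, p \in la -> 1 < p -> prime p && odd p) -> 2 <= size la ->
  parts_ok la.
Proof.
move=> hn /and3P[_ la0 /eqP sla] ula hla sz.
have np m la' : sumn la' = m -> m != n -> ~~ perm_eq la la'.
  by move=> <-; apply: contraNN => /perm_sumn E; rewrite -sla E.
have [n4 n8] : 4 != n /\ 8 != n by case: hn => [->|h] //; split; rewrite neq_ltn; lia.
rewrite /parts_ok ula sz (np 4 [:: 3; 1]) ?(np 8 [:: 5; 3]) // !andbT.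
apply/allP=> p pla; rewrite /part_ok; case: eqP => //= p1.
apply: hla => //; have : p <> 0 by move=> p0; rewrite -p0 pla in la0.
by move: p1; clear; lia.
Qed.

Theorem theorem1p1 (n : nat) (hn : 2 <= n) :
  [/\ (exists C : {set 'S_n}, global_class [set: 'S_n]%G C)
        <-> (n = 6 \/ 8 <= n),
      (forall la : seq nat,
         is_partition n la ->
         uniq la ->
         (forall p : nat, p \in la -> 1 < p -> prime p && odd p) ->
         2 <= size la ->
         n = 6 \/ 9 <= n ->
         global_class [set: 'S_n]%G (cycle_type_class n la))
    & (n = 8 -> global_class [set: 'S_n]%G (cycle_type_class n [:: 7; 1]))].
Proof.
have n8 : n = 8 -> global_class [set: 'S_n]%G (cycle_type_class n [:: 7; 1]).
  by move=> ->; apply: global_parts.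
split=> //; last by move=> la pla *; apply/global_parts/(@parts_okP n).
split=> [[C]|]; first exact: global_degree.
case=> [->|]; first by exists (cycle_type_class 6 [:: 5; 1]); apply: global_parts.
rewrite leq_eqVlt => /predU1P[/esym n_8|n9].
  by exists (cycle_type_class n [:: 7; 1]); apply: n8.
have [la [pla ok]] := parts_exist n9.
by exists (cycle_type_class n la); apply: global_parts.
Qed.
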